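(* Suppose $\varepsilon=\mathcal{O}(h^\beta)$ for some $\beta\ge2$, $0<h<h_0$, and $f\in L^2(\Omega)$. Let $u^\varepsilon\in H^2(\Omega)\cap H_0^1(\Omega)$ satisfy $$\varepsilon(\Delta u^\varepsilon,\Delta v)-(A:D^2u^\varepsilon,v)=(f,v)\qquad\forall v\in H^2(\Omega)\cap H_0^1(\Omega),$$ and let $u_h^\varepsilon\in V_h$ satisfy $$\varepsilon(\Delta u_h^\varepsilon,\Delta v_h)-(A:D^2u_h^\varepsilon,v_h)=(f,v_h)\qquad\forall v_h\in V_h.$$ Then $$\|u^\varepsilon-u_h^\varepsilon\|_{H^2(\Omega)}\le C\inf_{v_h\in V_h}\|u^\varepsilon-v_h\|_{H^2(\Omega)}.$$ Moreover, if $u^\varepsilon\in H^s(\Omega)$ for some $s\ge2$, then $$\|u^\varepsilon-u_h^\varepsilon\|_{H^2(\Omega)}\le C h^{r-2}\|u^\varepsilon\|_{H^r(\Omega)},\qquad r=\min\{k+1,s\}.$$ Here $C>0$ is independent of $h$, $\varepsilon$ and $u^\varepsilon$.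
   Context: $\Omega\subset\mathbb{R}^n$ is an open bounded domain; $A\in[C(\overline\Omega)]^{n\times n}$ is uniformly elliptic: $\lambda|\xi|^2\le A(x)\xi\cdot\xi\le\overline\lambda|\xi|^2$ for all $\xi\in\mathbb{R}^n$, $x\in\overline\Omega$, with $0<\lambda\le\overline\lambda$. $(\cdot,\cdot)$ is the $L^2(\Omega)$ inner product; $A:D^2v=\sum_{i,j}A_{ij}v_{x_ix_j}$. $\varepsilon=\varepsilon(h)>0$, and $\varepsilon=\mathcal{O}(h^\beta)$ means $\varepsilon\le C_0h^\beta$ with $C_0$ independent of $h$. For each mesh size $h>0$, $\mathcal{T}_h$ is a quasi-uniform, shape-regular mesh of $\Omega$, and $V_h=\{v_h\in C^1(\overline\Omega)\cap H_0^1(\Omega): v_h|_T\in\mathbb{P}_k(T)\ \forall T\in\mathcal{T}_h\}\subset H^2(\Omega)\cap H^1_0(\Omega)$ is a $C^1$ conforming finite element space ($\mathbb{P}_k(T)$: polynomials of total degree $\le k$; e.g. cubic Hermite elements in 1-D with $k\ge3$, Argyris elements in 2-D with $k\ge5$), with standard finite element interpolation estimates available. Standing assumption: the problem $\mathcal{L}^\varepsilon u^\varepsilon:=\varepsilon\Delta^2u^\varepsilon-A:D^2u^\varepsilon=f$ in $\Omega$, $u^\varepsilon=\Delta u^\varepsilon=0$ on $\partial\Omega$, has a unique weak solution $u^\varepsilon\in H^2(\Omega)\cap H_0^1(\Omega)$ for each $f\in L^2(\Omega)$, and $\|v\|_{H^2(\Omega)}\le C\|\mathcal{L}^\varepsilon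 v\|_{L^2(\Omega)}$ with $C$ independent of $\varepsilon$ and $v$, for $v\in H^2(\Omega)\cap H_0^1(\Omega)$ whose image $\mathcal{L}^\varepsilon v$ (in the weak sense) is in $L^2(\Omega)$. Let $(\mathcal{L}_h^\varepsilon)^*:V_h\to V_h$ be defined by $((\mathcal{L}_h^\varepsilon)^*w_h,v_h)=\varepsilon(\Delta v_h,\Delta w_h)-(A:D^2v_h,w_h)$ for all $v_h\in V_h$, and $\|v\|_{H_h^{-2}(\Omega)}=\sup_{0\ne w_h\in V_h}(v,w_h)/\|w_h\|_{H^2(\Omega)}$. The constant $h_0>0$ is a fixed threshold (whose existence the paper establishes) such that for all $h<h_0$ and $\varepsilon=\mathcal{O}(h^\beta)$ with $\beta\ge2$, $\|v_h\|_{L^2(\Omega)}\le C\|(\mathcal{L}_h^\varepsilon)^*v_h\|_{H_h^{-2}(\Omega)}$ for all $v_h\in V_h$, with $C$ independent of $h$, $\varepsilon$, $v_h$. *)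

(* Defs.v *)
From HB Require Import structures.
From mathcomp Require Import all_boot all_order all_algebra.
From mathcomp Require Import all_classical all_reals all_analysis.
Set Implicit Arguments.
Unset Strict Implicit.
Unset Printing Implicit Defensive.
Import Order.TTheory GRing.Theory Num.Theory.
Import numFieldNormedType.Exports.
Local Open Scope classical_set_scope.
Local Open Scope ring_scope.

(** * Lebesgue measure on R^n

    The row vectors carry the sigma-algebra generated by the coordinates (which
    is the Borel sigma-algebra), and [leb R n] is the n-fold product of the
    one-dimensional Lebesgue measure, transported along
    R x R^n -> R^(n+1), (t, x) |-> (t, x_1, .., x_n). *)

Definition rV_coord (R : realType) (n : nat) (i : 'I_n) (x : 'rV[R]_n) :
  measurableTypeR R := x 0 i.

Definition rV_display : measure_display.
Proof. exact. Qed.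

Definition rV_measurable (R : realType) (n : nat) : set (set 'rV[R]_n) :=
  g_sigma_preimage (@rV_coord R n).

Lemma rV_measurable0 (R : realType) (n : nat) : @rV_measurable R n set0.
Proof. exact: sigma_algebra0. Qed.

Lemma rV_measurableC (R : realType) (n : nat) (A : set 'rV[R]_n) :
  rV_measurable A -> rV_measurable (~` A).
Proof. exact: sigma_algebraC. Qed.

Lemma rV_measurable_bigcup (R : realType) (n : nat)
  (F : (set 'rV[R]_n)^nat) :
  (forall i, rV_measurable (F i)) -> rV_measurable (\bigcup_i F i).
Proof. exact: sigma_algebra_bigcup. Qed.

HB.instance Definition _ (R : realType) (n : nat) :=
  @isMeasurable.Build rV_display 'rV[R]_n (@rV_measurable R n)
    (@rV_measurable0 R n) (@rV_measurableC R n) (@rV_measurable_bigcup R n).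

Lemma measurable_rV_coord (R : realType) (n : nat) (i : 'I_n) :
  measurable_fun [set: 'rV[R]_n] (@rV_coord R n i).
Proof.
move=> _ Y mY; rewrite setTI; apply: sub_sigma_algebra => /=.
rewrite -bigcup_seq/=; exists i => /=; first by rewrite mem_index_enum.
by exists Y => //; rewrite setTI.
Qed.

Lemma measurable_rVP (R : realType) (n : nat) d (T : measurableType d)
    (f : T -> 'rV[R]_n) :
  (forall i, measurable_fun [set: T] (@rV_coord R n i \o f)) ->
  measurable_fun [set: T] f.
Proof.
move=> mf _ Y mY; rewrite setTI.
suff : @rV_measurable R n `<=` [set A | measurable (f @^-1` A)] by apply.
apply: smallest_sub.
  split => /=.
  - by rewrite preimage_set0.
  - by move=> A mA; rewrite setTD preimage_setC; exact: measurableC.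
  - by move=> F mF; rewrite preimage_bigcup; exact: bigcup_measurable.
move=> A; rewrite -bigcup_seq /= => -[i _ [B mB <-]].
by rewrite setTI; have := mf i measurableT B mB; rewrite setTI.
Qed.

Definition rV_cons (R : realType) (n : nat)
  (p : measurableTypeR R * 'rV[R]_n) : 'rV[R]_n.+1 :=
  row_mx (p.1 : R)%:M p.2.

Definition rV_uncons (R : realType) (n : nat) (x : 'rV[R]_n.+1) :
  measurableTypeR R * 'rV[R]_n :=
  (x 0 ord0, rsubmx (x : 'rV[R]_(1 + n))).

Lemma rV_consK (R : realType) (n : nat) :
  cancel (@rV_cons R n) (@rV_uncons R n).
Proof.
move=> [t x]; rewrite /rV_uncons /rV_cons row_mxKr; congr (_, _).
have -> : ord0 = lshift n (ord0 : 'I_1) by exact: val_inj.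
by apply: etrans (row_mxEl (t : R)%:M x 0 0) _; rewrite mxE eqxx.
Qed.

Lemma measurable_rV_cons (R : realType) (n : nat) :
  measurable_fun [set: measurableTypeR R * 'rV[R]_n] (@rV_cons R n).
Proof.
apply: measurable_rVP => i; case: (splitP (i : 'I_(1 + n))) => j ij.
  rewrite (_ : _ \o _ = fst) //; apply/funext => -[t x] /=.
  rewrite /rV_coord /rV_cons; have -> : i = lshift n j by exact: val_inj.
  by apply: etrans (row_mxEl (t : R)%:M x 0 j) _; rewrite mxE !ord1 eqxx.
rewrite (_ : _ \o _ = @rV_coord R n j \o snd).
  by apply: measurableT_comp => //; exact: measurable_rV_coord.
apply/funext => -[t x] /=.
rewrite /rV_coord /rV_cons; have -> : i = rshift 1 j by exact: val_inj.
exact: (row_mxEr (t : R)%:M x 0 j).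
Qed.

Lemma measurable_rV_uncons (R : realType) (n : nat) :
  measurable_fun [set: 'rV[R]_n.+1] (@rV_uncons R n).
Proof.
apply/measurable_fun_pair => /=; first exact: measurable_rV_coord.
apply: measurable_rVP => i.
rewrite (_ : _ \o _ = @rV_coord R n.+1 (rshift 1 i : 'I_(1 + n))).
  exact: measurable_rV_coord.
by apply/funext => x; rewrite /rV_coord /= mxE.
Qed.

Definition leb_step (R : realType) (n : nat)
  (mu : {sigma_finite_measure set 'rV[R]_n -> \bar R}) :
  set 'rV[R]_n.+1 -> \bar R :=
  pushforward (@lebesgue_measure R \x mu)%E (@rV_cons R n).

Lemma leb_step0 (R : realType) (n : nat)
  (mu : {sigma_finite_measure set 'rV[R]_n -> \bar R}) : leb_step mu set0 = 0%E.
Proof. by rewrite /leb_step /pushforward preimage_set0 measure0. Qed.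

Lemma leb_step_ge0 (R : realType) (n : nat)
  (mu : {sigma_finite_measure set 'rV[R]_n -> \bar R}) (A : set 'rV[R]_n.+1) :
  (0 <= leb_step mu A)%E.
Proof. by rewrite /leb_step /pushforward; exact: measure_ge0. Qed.

Lemma leb_step_sigma_additive (R : realType) (n : nat)
  (mu : {sigma_finite_measure set 'rV[R]_n -> \bar R}) :
  semi_sigma_additive (leb_step mu).
Proof.
move=> F mF tF mUF; rewrite /leb_step /pushforward preimage_bigcup.
have mp A : measurable A -> measurable (@rV_cons R n @^-1` A).
  by move=> mA; rewrite -[X in measurable X]setTI; exact: measurable_rV_cons.
apply: measure_semi_sigma_additive.
- by move=> i; exact: mp.
- apply/trivIsetP => /= i j _ _ ij; rewrite -preimage_setI.
  by move/trivIsetP : tF => /(_ _ _ _ _ ij) ->//; rewrite preimage_set0.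
- by rewrite -preimage_bigcup; exact: mp.
Qed.

HB.instance Definition _ (R : realType) (n : nat)
  (mu : {sigma_finite_measure set 'rV[R]_n -> \bar R}) :=
  isMeasure.Build _ _ _ (leb_step mu) (leb_step0 mu) (@leb_step_ge0 R n mu)
    (@leb_step_sigma_additive R n mu).

Lemma leb_step_sigma_finite (R : realType) (n : nat)
  (mu : {sigma_finite_measure set 'rV[R]_n -> \bar R}) :
  sigma_finite setT (leb_step mu).
Proof.
have [F TF mF] : sigma_finite setT (@lebesgue_measure R \x mu)%E.
  have /sigma_finiteP[F [TF ndF Foo]] := sigma_finiteT (@lebesgue_measure R).
  have /sigma_finiteP[G [TG ndG Goo]] := sigma_finiteT mu.
  exists (fun k => F k `*` G k).
    rewrite -setXTT TF TG predeqE => -[x y]; split.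
      move=> [/= [i _ Fix] [j _ Gjy]]; exists (maxn i j) => //; split.
      - by move: x Fix; exact/subsetPset/ndF/leq_maxl.
      - by move: y Gjy; exact/subsetPset/ndG/leq_maxr.
    by move=> [i _ [/= ? ?]]; split; exists i.
  move=> k; have [? ?] := Foo k; have [? ?] := Goo k.
  split; first exact: measurableX.
  by rewrite product_measure1E// lte_mul_pinfty// ge0_fin_numE.
exists (fun k => @rV_uncons R n @^-1` F k).
  by rewrite -preimage_bigcup -TF preimage_setT.
move=> k; split.
  rewrite -[X in measurable X]setTI; apply: measurable_rV_uncons => //.
  exact: (mF k).1.
rewrite /leb_step /pushforward -comp_preimage.
rewrite (_ : @rV_uncons R n \o @rV_cons R n = id); first exact: (mF k).2.
by apply/funext => p /=; rewrite rV_consK.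
Qed.

HB.instance Definition _ (R : realType) (n : nat)
  (mu : {sigma_finite_measure set 'rV[R]_n -> \bar R}) :=
  Measure_isSigmaFinite.Build _ _ _ (leb_step mu) (leb_step_sigma_finite mu).

Fixpoint leb (R : realType) (n : nat) :
  {sigma_finite_measure set 'rV[R]_n -> \bar R} :=
  match n return {sigma_finite_measure set 'rV[R]_n -> \bar R} with
  | 0%N => \d_ (0 : 'rV[R]_0)
  | m.+1 => leb_step (leb R m)
  end.

(** * Euclidean norm, classical derivatives, test functions *)

(* The library norm on ['rV[R]_n] is the sup norm; it induces the same
   topology but not the same lengths. *)
Definition enorm (R : realType) (n : nat) (x : 'rV[R]_n) : R :=
  Num.sqrt (\sum_i x 0 i ^+ 2).

Definition pderiv (R : realType) (n : nat) (i : 'I_n) (f : 'rV[R]_n -> R) :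
  'rV[R]_n -> R := fun x => 'D_(delta_mx 0 i) f x.

Definition mi_size (n : nat) (a : 'I_n -> nat) : nat := (\sum_i a i)%N.

(* D^a for a multi-index a, i.e. a i derivatives in the i-th direction. *)
Definition mderiv (R : realType) (n : nat) (a : 'I_n -> nat)
  (f : 'rV[R]_n -> R) : 'rV[R]_n -> R :=
  foldr (fun i g => iter (a i) (pderiv i) g) f (enum 'I_n).

Definition smooth (R : realType) (n : nat) (f : 'rV[R]_n -> R) : Prop :=
  forall (s : seq 'I_n) (x : 'rV[R]_n),
    differentiable (foldr (fun i g => pderiv i g) f s) x.

(* The space C_c^oo(Omega). *)
Definition test_fun (R : realType) (n : nat) (Omega : set 'rV[R]_n) :
  set ('rV[R]_n -> R) :=
  [set phi | [/\ smooth phi,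
     compact (closure [set x | phi x != 0]) &
     closure [set x | phi x != 0] `<=` Omega]].

(** * L^2 and Sobolev spaces

    Elements of the spaces are represented by functions on all of R^n whose
    values outside [Omega] are irrelevant. *)

Definition L2 (R : realType) (n : nat) (Omega : set 'rV[R]_n) :
  set ('rV[R]_n -> R) :=
  [set f | measurable_fun Omega (f : 'rV[R]_n -> measurableTypeR R) /\
     (\int[leb R n]_(x in Omega) (f x ^+ 2)%:E < +oo)%E].

Definition ip (R : realType) (n : nat) (Omega : set 'rV[R]_n)
  (f g : 'rV[R]_n -> R) : R :=
  \int[leb R n]_(x in Omega) (f x * g x).

Definition L2norm (R : realType) (n : nat) (Omega : set 'rV[R]_n)
  (f : 'rV[R]_n -> R) : R := Num.sqrt (ip Omega f f).

Definition is_wderiv (R : realType) (n : nat) (Omega : set 'rV[R]_n)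
  (a : 'I_n -> nat) (u g : 'rV[R]_n -> R) : Prop :=
  L2 Omega g /\
  forall phi, test_fun Omega phi ->
    ip Omega u (mderiv a phi) = (-1) ^+ mi_size a * ip Omega g phi.

(* A chosen representative of the weak derivative D^a u (junk if there is no
   weak derivative in L^2); it is determined up to a null set. *)
Definition wderiv (R : realType) (n : nat) (Omega : set 'rV[R]_n)
  (a : 'I_n -> nat) (u : 'rV[R]_n -> R) : 'rV[R]_n -> R :=
  xget (fun=> 0) [set g | is_wderiv Omega a u g].

Definition Hm (R : realType) (n : nat) (Omega : set 'rV[R]_n) (m : nat) :
  set ('rV[R]_n -> R) :=
  [set u | L2 Omega u /\
     forall a : {ffun 'I_n -> 'I_m.+1}, (mi_size (fun i => a i) <= m)%N ->
       exists g, is_wderiv Omega (fun i => a i) u g].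

Definition Hmnorm (R : realType) (n : nat) (Omega : set 'rV[R]_n) (m : nat)
  (u : 'rV[R]_n -> R) : R :=
  Num.sqrt (\sum_(a : {ffun 'I_n -> 'I_m.+1} | (mi_size (fun i => a i) <= m)%N)
    L2norm Omega (wderiv Omega (fun i => a i) u) ^+ 2).

(* H^1_0(Omega) is the closure of C_c^oo(Omega) in H^1(Omega). *)
Definition H10 (R : realType) (n : nat) (Omega : set 'rV[R]_n) :
  set ('rV[R]_n -> R) :=
  [set u | Hm Omega 1 u /\
     forall e : R, 0 < e -> exists phi, test_fun Omega phi /\
       Hmnorm Omega 1 (fun x => u x - phi x) < e].

Definition H2H10 (R : realType) (n : nat) (Omega : set 'rV[R]_n) :
  set ('rV[R]_n -> R) := Hm Omega 2 `&` H10 Omega.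

(* Squared Gagliardo seminorm of order theta, 0 < theta < 1. *)
Definition gagliardo (R : realType) (n : nat) (Omega : set 'rV[R]_n)
  (theta : R) (g : 'rV[R]_n -> R) : \bar R :=
  (\int[leb R n]_(x in Omega) \int[leb R n]_(y in Omega)
     ((g x - g y) ^+ 2 / enorm (x - y) `^ (n%:R + 2 * theta))%:E)%E.

(* Sobolev-Slobodeckij spaces of real order s >= 0; for integer s this is
   [Hm Omega s]. *)
Definition Hs (R : realType) (n : nat) (Omega : set 'rV[R]_n) (s : R) :
  set ('rV[R]_n -> R) :=
  let m := Num.truncn s in
  let theta := s - m%:R in
  [set u | Hm Omega m u /\
     (0 < theta ->
      forall a : {ffun 'I_n -> 'I_m.+1}, mi_size (fun i => a i) = m ->
        (gagliardo Omega theta (wderiv Omega (fun i => a i) u) < +oo)%E)].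

Definition Hsnorm (R : realType) (n : nat) (Omega : set 'rV[R]_n) (s : R)
  (u : 'rV[R]_n -> R) : R :=
  let m := Num.truncn s in
  let theta := s - m%:R in
  Num.sqrt (Hmnorm Omega m u ^+ 2 +
    if 0 < theta then
      \sum_(a : {ffun 'I_n -> 'I_m.+1} | mi_size (fun i => a i) == m)
        fine (gagliardo Omega theta (wderiv Omega (fun i => a i) u))
    else 0).

(** * The differential operators and the weak problem *)

Definition wD2 (R : realType) (n : nat) (Omega : set 'rV[R]_n) (i j : 'I_n)
  (u : 'rV[R]_n -> R) : 'rV[R]_n -> R :=
  wderiv Omega (fun l : 'I_n => ((l == i) + (l == j))%N) u.

Definition laplacian (R : realType) (n : nat) (Omega : set 'rV[R]_n)
  (u : 'rV[R]_n -> R) : 'rV[R]_n -> R :=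
  fun x => \sum_i wD2 Omega i i u x.

(* A : D^2 u *)
Definition AD2 (R : realType) (n : nat) (Omega : set 'rV[R]_n)
  (A : 'rV[R]_n -> 'M[R]_n) (u : 'rV[R]_n -> R) : 'rV[R]_n -> R :=
  fun x => \sum_i \sum_j A x i j * wD2 Omega i j u x.

Definition uniformly_elliptic (R : realType) (n : nat) (Omega : set 'rV[R]_n)
  (A : 'rV[R]_n -> 'M[R]_n) : Prop :=
  exists lam Lam : R, [/\ 0 < lam, lam <= Lam &
    forall (x xi : 'rV[R]_n), closure Omega x ->
      lam * enorm xi ^+ 2 <= \sum_i \sum_j A x i j * xi 0 j * xi 0 i
        <= Lam * enorm xi ^+ 2].

(* eps (Delta u, Delta v) - (A : D^2 u, v) *)
Definition bform (R : realType) (n : nat) (Omega : set 'rV[R]_n)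
  (A : 'rV[R]_n -> 'M[R]_n) (eps : R) (u v : 'rV[R]_n -> R) : R :=
  eps * ip Omega (laplacian Omega u) (laplacian Omega v) -
  ip Omega (AD2 Omega A u) v.

(* Testing against all of H^2 `&` H^1_0, and not only against C_c^oo, encodes
   the second boundary condition Delta u = 0. *)
Definition weak_solution (R : realType) (n : nat) (Omega : set 'rV[R]_n)
  (A : 'rV[R]_n -> 'M[R]_n) (eps : R) (f u : 'rV[R]_n -> R) : Prop :=
  H2H10 Omega u /\
  forall v, H2H10 Omega v -> bform Omega A eps u v = ip Omega f v.

Definition well_posed (R : realType) (n : nat) (Omega : set 'rV[R]_n)
  (A : 'rV[R]_n -> 'M[R]_n) : Prop :=
  (forall eps : R, 0 < eps -> forall f, L2 Omega f ->
     (exists u, weak_solution Omega A eps f u) /\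
     (forall u v, weak_solution Omega A eps f u ->
        weak_solution Omega A eps f v ->
        {ae leb R n, forall x, Omega x -> u x = v x})) /\
  (exists C : R, 0 < C /\
     forall eps : R, 0 < eps -> forall v g, L2 Omega g ->
       weak_solution Omega A eps g v ->
       Hmnorm Omega 2 v <= C * L2norm Omega g).

(** * Meshes and the finite element space *)

Definition diam (R : realType) (n : nat) (T : set 'rV[R]_n) : R :=
  sup [set d | exists x y, [/\ T x, T y & d = enorm (x - y)]].

Definition mesh_size (R : realType) (n : nat) (Th : set (set 'rV[R]_n)) : R :=
  sup [set d | exists T, Th T /\ d = diam T].

(* A finite decomposition of closure Omega into non-overlapping elements: each
   element is the closure of its interior, which is nonempty, connected and
   contained in Omega, and has a Lebesgue-null boundary. Simplicial meshes are
   a particular case. *)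
Definition is_mesh (R : realType) (n : nat) (Omega : set 'rV[R]_n)
  (Th : set (set 'rV[R]_n)) : Prop :=
  [/\ finite_set Th,
      \bigcup_(T in Th) T = closure Omega,
      forall T, Th T ->
        [/\ T = closure (interior T), interior T !=set0,
            connected (interior T), interior T `<=` Omega &
            leb R n (T `\` interior T) = 0%E] &
      forall T T', Th T -> Th T' -> T <> T' ->
        interior T `&` interior T' = set0].

(* The mesh sizes h range over a set [hs] of positive numbers: on a bounded
   domain there is no mesh of size h when h is large. *)
Definition mesh_family (R : realType) (n : nat) (Omega : set 'rV[R]_n)
  (hs : set R) (Th : R -> set (set 'rV[R]_n)) : Prop :=
  forall h, hs h -> [/\ 0 < h, is_mesh Omega (Th h) & mesh_size (Th h) = h].

(* Every element contains a ball of radius comparable to its diameter. *)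
Definition shape_regular (R : realType) (n : nat)
  (hs : set R) (Th : R -> set (set 'rV[R]_n)) : Prop :=
  exists sigma : R, 0 < sigma /\ forall h T, hs h -> Th h T ->
    exists x, [set y | enorm (y - x) < sigma * diam T] `<=` T.

Definition quasi_uniform (R : realType) (n : nat)
  (hs : set R) (Th : R -> set (set 'rV[R]_n)) : Prop :=
  exists tau : R, 0 < tau /\ forall h T, hs h -> Th h T -> tau * h <= diam T.

Definition is_poly_on (R : realType) (n k : nat) (T : set 'rV[R]_n)
  (v : 'rV[R]_n -> R) : Prop :=
  exists c : {ffun 'I_n -> 'I_k.+1} -> R, forall x, T x ->
    v x = \sum_(a : {ffun 'I_n -> 'I_k.+1} | (mi_size (fun i => a i) <= k)%N)
            c a * \prod_i x 0 i ^+ a i.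

(* C^1(closure Omega): v and its first derivatives on Omega extend
   continuously to closure Omega. *)
Definition C1_closure (R : realType) (n : nat) (Omega : set 'rV[R]_n)
  (v : 'rV[R]_n -> R) : Prop :=
  [/\ {within closure Omega, continuous v},
      forall x, Omega x -> differentiable v x &
      forall i, exists g : 'rV[R]_n -> R,
        {within closure Omega, continuous g} /\
        forall x, Omega x -> pderiv i v x = g x].

Definition fe_space (R : realType) (n : nat) (Omega : set 'rV[R]_n) (k : nat)
  (Th : set (set 'rV[R]_n)) : set ('rV[R]_n -> R) :=
  [set v | [/\ C1_closure Omega v, H10 Omega v &
               forall T, Th T -> is_poly_on k T v]].

(* The standard interpolation estimates for functions in H^s `&` H^1_0,
   s >= 2, measured in H^m for m = 0, 1, 2. *)
Definition interpolation_estimates (R : realType) (n : nat)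
  (Omega : set 'rV[R]_n) (k : nat) (hs : set R)
  (Th : R -> set (set 'rV[R]_n)) : Prop :=
  forall s : R, 2 <= s -> exists C : R, 0 < C /\
    forall h v, hs h -> Hs Omega s v -> H10 Omega v ->
      exists vh, fe_space Omega k (Th h) vh /\
        forall m : nat, (m <= 2)%N ->
          Hmnorm Omega m (fun x => v x - vh x) <=
            C * h `^ (Num.min k.+1%:R s - m%:R) *
            Hsnorm Omega (Num.min k.+1%:R s) v.

(** * The discrete adjoint and the discrete negative norm *)

(* The operator (L_h^eps)^* : V_h -> V_h, given by the Riesz representation in
   (V_h, L^2) of v |-> eps (Delta v, Delta w) - (A : D^2 v, w). *)
Definition discrete_adjoint (R : realType) (n : nat) (Omega : set 'rV[R]_n)
  (A : 'rV[R]_n -> 'M[R]_n) (Vh : set ('rV[R]_n -> R)) (eps : R)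
  (w : 'rV[R]_n -> R) : 'rV[R]_n -> R :=
  xget (fun=> 0) [set g | Vh g /\
    forall v, Vh v -> ip Omega g v = bform Omega A eps v w].

(* The H_h^{-2} norm; [sup] of the empty set is 0, which is the right value
   when V_h = {0}. *)
Definition Hm2norm (R : realType) (n : nat) (Omega : set 'rV[R]_n)
  (Vh : set ('rV[R]_n -> R)) (v : 'rV[R]_n -> R) : R :=
  sup [set q | exists w, [/\ Vh w, (exists x, Omega x /\ w x != 0) &
                             q = ip Omega v w / Hmnorm Omega 2 w]].

(* The defining property of the threshold h0, for eps <= C0 h^beta. *)
Definition adjoint_stability (R : realType) (n : nat) (Omega : set 'rV[R]_n)
  (A : 'rV[R]_n -> 'M[R]_n) (k : nat) (hs : set R)
  (Th : R -> set (set 'rV[R]_n)) (C0 beta h0 : R) : Prop :=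
  exists C : R, 0 < C /\
    forall h eps : R, hs h -> h < h0 -> 0 < eps -> eps <= C0 * h `^ beta ->
    forall vh, fe_space Omega k (Th h) vh ->
      L2norm Omega vh <=
        C * Hm2norm Omega (fe_space Omega k (Th h))
              (discrete_adjoint Omega A (fe_space Omega k (Th h)) eps vh).

(* Main.v *)
From HB Require Import structures.
Require Import Defs.
From mathcomp Require Import all_boot all_order all_algebra.
From mathcomp Require Import all_classical all_reals all_analysis.
From mathcomp Require Import measurable_realfun zify ring lra.
Import Order.TTheory GRing.Theory Num.Theory.
Import numFieldNormedType.Exports.
Set Implicit Arguments.
Unset Strict Implicit.
Unset Printing Implicit Defensive.
Local Open Scope classical_set_scope.
Local Open Scope ring_scope.

(** The Galerkin error is controlled by an inf-sup condition for the form
    b(u, v) = eps (Delta u, Delta v) - (A : D^2 u, v) on the discrete space V_h,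
    with the H^2 norm on the trial side and only the L^2 norm on the test side.

    Stability of the discrete adjoint is that condition with the two sides
    exchanged: it bounds |v|_L2 by the supremum of b(w, v) / |w|_H2 over w.
    Since V_h is finite-dimensional modulo functions that vanish almost
    everywhere, uniqueness for the adjoint problem gives solvability, so for
    w in V_h there is v in V_h with b(z, v) = (z, w)_H2 for all z in V_h.
    Taking z = w gives b(w, v) = |w|_H2^2, and stability gives
    |v|_L2 <= C |w|_H2, with the same constant ([discrete_inf_sup]; the linear
    algebra is [bilinear_representation]).

    For w = u_h - v_h, Galerkin orthogonality replaces b(w, v) by
    b(u - v_h, v). The second-order term of the form is at most a constant
    times |u - v_h|_H2 |v|_L2. In the fourth-order term the second derivatives
    of v are traded for a factor h^-2 by an inverse estimate, and eps h^-2
    stays bounded because eps <= C0 h^beta with beta >= 2. Hence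
    |w|_H2 <= C |u - v_h|_H2, and the triangle inequality gives
    [quasi_optimality]. Inserting the interpolant of u gives the rate.

    Three tools have to be established for weak derivatives given through
    arbitrary representatives. The first is the fundamental lemma of the
    calculus of variations ([fundamental_lemma]): it makes weak derivatives
    linear up to null sets, so that the Sobolev norms come from inner products.
    The second is integration by parts against test functions
    ([integration_by_parts]), which comes from translation invariance of the
    measure; it identifies the weak derivatives of a piecewise polynomial
    inside each element ([wD2_local]). The third is the inverse estimate
    ([inverse_estimate]), obtained on a reference cube from the invertibility
    of a Gram matrix of monomials and transported by scaling. *)

(** * Lebesgue measure: Borel sets and affine changes of variable *)

Lemma rV_norm_lt (R : realType) (n : nat) (x : 'rV[R]_n) (r : R) :
  0 < r -> (`|x| < r) = [forall i, `|x 0 i| < r].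
Proof.
move=> r0; apply/idP/forallP.
  move=> xr i; apply: le_lt_trans xr.
  by rewrite [leRHS]/Num.norm /= mx_normrE; apply: (le_bigmax _ _ (0, i)).
move=> h; rewrite [ltLHS]/Num.norm /= mx_normrE; apply/bigmax_ltP; split => //.
by move=> [i j] _ /=; rewrite ord1.
Qed.

Lemma rV_norm_le (R : realType) (n : nat) (x : 'rV[R]_n) (r : R) :
  0 <= r -> (`|x| <= r) = [forall i, `|x 0 i| <= r].
Proof.
move=> r0; apply/idP/forallP.
  move=> xr i; apply: le_trans xr.
  by rewrite [leRHS]/Num.norm /= mx_normrE; apply: (le_bigmax _ _ (0, i)).
move=> h; rewrite [leLHS]/Num.norm /= mx_normrE; apply/bigmax_leP; split => //.
by move=> [i j] _ /=; rewrite ord1.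
Qed.

(** Sup-norm balls in coordinates, the form that splits as a product along
    R x R^n. *)
Definition cube (R : realType) (n : nat) (c : 'rV[R]_n) (r : R) :
  set 'rV[R]_n := [set x | forall i, `|x 0 i - c 0 i| < r].

Lemma cubeP (R : realType) (n : nat) (c x : 'rV[R]_n) (r : R) :
  0 < r -> cube c r x <-> `|x - c| < r.
Proof.
move=> r0; rewrite rV_norm_lt//; split.
  by move=> h; apply/forallP => i; rewrite !mxE; apply: h.
by move=> /forallP h i; have := h i; rewrite !mxE.
Qed.

Lemma measurable_cube (R : realType) (n : nat) (c : 'rV[R]_n) (r : R) :
  measurable (cube c r).
Proof.
rewrite (_ : cube c r =
    \bigcap_(i : 'I_n) (@rV_coord R n i @^-1` ball (c 0 i) r)); last first.
  apply/seteqP; split => x /=.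
    by move=> h i _; rewrite /ball /= distrC; apply: h.
  by move=> h i; have := h i I; rewrite /ball /= distrC.
apply: fin_bigcap_measurable => // i _.
rewrite -[X in measurable X]setTI; apply: measurable_rV_coord => //.
exact: measurable_ball.
Qed.

(** Rational cubes whose closures stay inside the open set exhaust it. There
    are countably many of them, so this gives measurability of open sets and
    reduces almost-everywhere statements to a single cube. *)
Lemma open_bigcup_cubes (R : realType) (n : nat) (U : set 'rV[R]_n) :
  open U -> U = \bigcup_(p : 'rV[rat]_n * nat)
    [set x | (forall y, `|y - map_mx ratr p.1| <= p.2.+1%:R^-1 -> U y) /\
             cube (map_mx ratr p.1) p.2.+1%:R^-1 x].
Proof.
move=> oU; apply/seteqP; split => x; last first.
  move=> [[q m] _ [h /cubeP xq]]; apply: h; apply/ltW/xq.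
  by rewrite invr_gt0.
move=> Ux; have /nbhs_ballP[e /= e0 eU] : nbhs x U by exact: open_nbhs_nbhs.
pose m := Num.bound (2 / e).
have m0 : 0 < m.+1%:R^-1 :> R by rewrite invr_gt0.
have me : m.+1%:R^-1 < e / 2.
  rewrite -[ltRHS]invrK ltf_pV2 ?posrE ?invr_gt0 ?divr_gt0// invf_div.
  apply: (lt_le_trans (archi_boundP _)); first by rewrite divr_ge0// ltW.
  by rewrite ler_nat leqnSn.
have /choice[q hq] (i : 'I_n) : exists q : rat, `|x 0 i - ratr q| < m.+1%:R^-1.
  have [|q] := @rat_in_itvoo R (x 0 i - m.+1%:R^-1) (x 0 i + m.+1%:R^-1).
    by rewrite ltrD2l gtrN.
  rewrite in_itv /= => h; exists q; rewrite ltr_norml;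
    move: (m.+1%:R^-1) (ratr q) h => r s; lra.
exists (\row_i q i, m) => //=.
have xq : cube (map_mx ratr (\row_i q i)) m.+1%:R^-1 x.
  by move=> i; rewrite !mxE.
split => // y yq; apply: eU; rewrite -ball_normE /ball_ /=.
have := xq; move/(cubeP _ _ m0) => xq'.
rewrite -(subrKA (map_mx ratr (\row_i q i))) (le_lt_trans (ler_normD _ _))//.
rewrite [X in _ + X]distrC [ltRHS]splitr ltr_leD ?(lt_trans xq')//.
by rewrite (le_trans yq)// ltW.
Qed.

Lemma measurable_open_rV (R : realType) (n : nat) (U : set 'rV[R]_n) :
  open U -> measurable U.
Proof.
move=> /open_bigcup_cubes ->.
apply: countable_bigcupT_measurable => // -[q m] /=.
have [h|h] := pselect (forall y, `|y - map_mx ratr q| <= m.+1%:R^-1 -> U y).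
  rewrite (_ : [set _ | _] = cube (map_mx ratr q) m.+1%:R^-1).
    exact: measurable_cube.
  by apply/seteqP; split => x //= -[].
by rewrite (_ : [set _ | _] = set0)//; apply/seteqP; split => x // -[].
Qed.

Lemma measurable_closed_rV (R : realType) (n : nat) (U : set 'rV[R]_n) :
  closed U -> measurable U.
Proof.
move=> cU; rewrite -[U]setCK; apply: measurableC; apply: measurable_open_rV.
exact: closed_openC.
Qed.

Lemma measurable_fun_open_continuous (R : realType) (n : nat)
  (U : set 'rV[R]_n) (f : 'rV[R]_n -> R) :
  open U -> (forall x, U x -> {for x, continuous f}) ->
  measurable_fun U (f : 'rV[R]_n -> measurableTypeR R).
Proof.
move=> oU cf.
apply: (measurability _ (RGenOpens.measurableE R)).
move=> _ [_ [a [b ->] <-]]; apply: measurable_open_rV.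
rewrite openE => x [Ux fx]; apply: filterI; first exact: open_nbhs_nbhs.
by apply: (cf x Ux); apply: open_nbhs_nbhs; split => //; exact: interval_open.
Qed.

Lemma measurable_fun_continuous_rV (R : realType) (n : nat)
  (f : 'rV[R]_n -> R) :
  continuous f -> measurable_fun setT (f : 'rV[R]_n -> measurableTypeR R).
Proof.
move=> cf; apply: measurable_fun_open_continuous; first exact: openT.
by move=> x _; exact: cf.
Qed.

Definition affine (R : realType) (n : nat) (c : 'rV[R]_n) (d : R)
  (y : 'rV[R]_n) : 'rV[R]_n := c + d *: y.

Lemma measurable_affine (R : realType) (n : nat) (c : 'rV[R]_n) (d : R) :
  measurable_fun setT (affine c d).
Proof.
apply: measurable_rVP => i.
rewrite (_ : _ \o _ = fun x : 'rV[R]_n => c 0 i + d * @rV_coord R n i x).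
  apply: measurable_funD => //; apply: measurable_funM => //.
  exact: measurable_rV_coord.
by apply/funext => x; rewrite /affine /rV_coord /= !mxE.
Qed.

Lemma lebesgue_affine (R : realType) (c d : R) (A : set R) :
  0 < d -> measurable A ->
  @lebesgue_measure R A =
  (d%:E * @lebesgue_measure R ((fun x => (c + d * x)%R) @^-1` A))%E.
Proof.
move=> d0 mA; pose dd : {nonneg R} := NngNum (ltW d0).
pose h : measurableTypeR R -> measurableTypeR R := fun x => c + d * (x : R).
have mh : measurable_fun setT h.
  by apply: measurable_funD => //; exact: measurable_funM.
apply: etrans (@lebesgue_measure_unique R (mscale dd (pushforward
  (@lebesgue_measure R) h)) _ A mA) _ => //.
move=> _ [[a b]/= _ <-]; rewrite /mscale/= /pushforward.
rewrite (_ : _ @^-1` _ = `](a - c) / d, (b - c) / d]%classic).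
  rewrite !lebesgue_measure_itv/= !lte_fin.
  rewrite ltr_pM2r ?invr_gt0// ltrD2r; case: ifPn => _; last by rewrite mule0.
  by rewrite -!EFinD -EFinM; congr EFin; field; rewrite gt_eqF.
apply/funext => x; apply/propext; rewrite /preimage /h /= !in_itv /=.
by rewrite ltr_pdivrMr// ler_pdivlMr// ltrBlDl lerBrDl mulrC.
Qed.

(** Induction on the dimension: the map splits into an affine map of R and
    one of R^n, and a product measure is determined by its values on
    rectangles. *)
Lemma leb_affine (R : realType) (n : nat) (c : 'rV[R]_n) (d : R)
  (A : set 'rV[R]_n) : 0 < d -> measurable A ->
  leb R n A = ((d ^+ n)%:E * leb R n (affine c d @^-1` A))%E.
Proof.
move=> d0; elim: n c A => [|n IH] c A mA.
  rewrite expr0 mul1e (_ : affine c d @^-1` A = A)//.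
  by apply/funext => x; rewrite /preimage /mkset /affine (thinmx0 (c + _))
    -(thinmx0 x).
pose c0 := c 0 ord0; pose c1 : 'rV[R]_n := rsubmx (c : 'rV[R]_(1 + n)).
have cE : affine c d \o @rV_cons R n =
    @rV_cons R n \o (fun p => (c0 + d * (p.1 : R), affine c1 d p.2)).
  apply/funext => -[t x] /=; rewrite /affine /rV_cons /=.
  apply/rowP => j; rewrite !mxE; case: splitP => k jk; rewrite !mxE.
    by rewrite !ord1 /= !mulr1n; congr (c _ _ + _); apply: val_inj;
      rewrite /= jk ord1.
  by congr (c _ _ + _); apply: val_inj; rewrite /= jk.
pose dd : {nonneg R} := NngNum (exprn_ge0 n.+1 (ltW d0)).
pose g (p : measurableTypeR R * 'rV[R]_n) : measurableTypeR R * 'rV[R]_n :=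
  (c0 + d * (p.1 : R), affine c1 d p.2).
have mg : measurable_fun setT g.
  apply/measurable_fun_pair => /=.
    by apply: measurable_funD => //; exact: measurable_funM.
  by apply: measurableT_comp => //; exact: measurable_affine.
rewrite /= /leb_step /pushforward.
have -> : @rV_cons R n @^-1` (affine c d @^-1` A) = g @^-1` (@rV_cons R n @^-1`
  A).
  rewrite -[LHS]/((affine c d \o @rV_cons R n) @^-1` A) cE.
  by [].
have mA' : measurable (@rV_cons R n @^-1` A).
  by rewrite -[X in measurable X]setTI; exact: measurable_rV_cons.
apply: etrans (product_measure_unique (m' := mscale dd (pushforward
   (@lebesgue_measure R \x leb R n)%E g)) _ mA') _ => // B D mB mD.
transitivity ((d ^+ n.+1)%:E * (@lebesgue_measure R \x leb R n)%E
    (((fun x => (c0 + d * x)%R) @^-1` B) `*` (affine c1 d @^-1` D)))%E => //.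
rewrite product_measure1E; last 2 first.
- rewrite -[X in measurable X]setTI.
  by apply: (measurable_funD (f := cst c0)) => //; exact: measurable_funM.
- by rewrite -[X in measurable X]setTI; apply: measurable_affine.
rewrite [X in _ = (X * _)%E](lebesgue_affine c0 d0 mB).
by rewrite [X in _ = (_ * X)%E](IH c1 D mD) exprS EFinM muleACA.
Qed.

Lemma leb_cube (R : realType) (n : nat) (c : 'rV[R]_n) (r : R) :
  0 < r -> leb R n (cube c r) = ((2 * r) ^+ n)%:E.
Proof.
move=> r0; elim: n c => [|n IH] c.
  by rewrite expr0 /= diracE mem_set// => -[].
rewrite /= /leb_step /pushforward.
pose c1 : 'rV[R]_n := rsubmx (c : 'rV[R]_(1 + n)).
rewrite (_ : _ @^-1` _ = ball (c 0 ord0) r `*` cube c1 r); last first.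
  apply/seteqP; split => -[t x] /=.
    move=> h; split.
      have := h ord0; rewrite /ball/= distrC /rV_cons.
      have -> : ord0 = lshift n (ord0 : 'I_1) by exact: val_inj.
      by rewrite (row_mxEl (t : R)%:M x 0 0) mxE eqxx.
    move=> i; have := h (rshift 1 i); rewrite /rV_cons.
    by rewrite (row_mxEr (t : R)%:M x 0 i) !mxE.
  move=> [h1 h2] i; case: (splitP (i : 'I_(1 + n))) => j ij.
    have -> : i = lshift n j by exact: val_inj.
    rewrite /rV_cons (row_mxEl (t : R)%:M x 0 j) mxE !ord1 eqxx mulr1n.
    move: h1; rewrite /ball /= distrC; congr (Num.norm (_ - c _ _) < _).
    exact: val_inj.
  have -> : i = rshift 1 j by exact: val_inj.
  rewrite /rV_cons (row_mxEr (t : R)%:M x 0 j).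
  by have := h2 j; rewrite !mxE.
rewrite product_measure1E; [|exact: measurable_ball|exact: measurable_cube].
rewrite [X in (X * _)%E](lebesgue_measure_ball _ (ltW r0)).
by rewrite [X in (_ * X)%E]IH exprS EFinM mulr_natl.
Qed.

Lemma ge0_integral_affine (R : realType) (n : nat) (c : 'rV[R]_n) (d : R)
  (D : set 'rV[R]_n) (f : 'rV[R]_n -> \bar R) : 0 < d -> measurable D ->
  measurable_fun D f -> (forall x, D x -> (0 <= f x)%E) ->
  (\int[leb R n]_(x in D) f x =
   (d ^+ n)%:E * \int[leb R n]_(x in affine c d @^-1` D) f (affine c d x))%E.
Proof.
move=> d0 mD mf f0; pose dd : {nonneg R} := NngNum (exprn_ge0 n (ltW d0)).
have mc := @measurable_affine R n c d.
apply: etrans.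
  apply: (@eq_measure_integral _ _ _ D
    (mscale dd (pushforward (leb R n) (affine c d)))) => A mA _.
  exact: leb_affine.
rewrite ge0_integral_mscale//; congr (_ * _)%E.
rewrite ge0_integral_pushforward//.
by move=> x /[!inE] Dx; apply: f0.
Qed.

Lemma ge0_integral_shift (R : realType) (n : nat) (c : 'rV[R]_n)
  (f : 'rV[R]_n -> \bar R) : measurable_fun setT f ->
  (forall x, (0 <= f x)%E) ->
  (\int[leb R n]_x f (x + c)%R = \int[leb R n]_x f x)%E.
Proof.
move=> mf f0; rewrite [RHS](ge0_integral_affine c ltr01)//.
rewrite expr1n mul1e preimage_setT.
by apply: eq_integral => x _; rewrite /affine scale1r addrC.
Qed.

Lemma integral_shift (R : realType) (n : nat) (c : 'rV[R]_n)
  (f : 'rV[R]_n -> \bar R) : measurable_fun setT f ->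
  (\int[leb R n]_x f (x + c)%R = \int[leb R n]_x f x)%E.
Proof.
move=> mf; rewrite integralE [RHS]integralE.
have p : (\int[leb R n]_x (f^\+ (x + c)%R) = \int[leb R n]_x f^\+ x)%E.
  by apply: ge0_integral_shift => //; exact: measurable_funepos.
have m : (\int[leb R n]_x (f^\- (x + c)%R) = \int[leb R n]_x f^\- x)%E.
  by apply: ge0_integral_shift => //; exact: measurable_funeneg.
rewrite -p -m.
by congr (_ - _)%E; apply: eq_integral => x _; rewrite ?funeposE ?funenegE.
Qed.

Lemma leb_bounded_fin (R : realType) (n : nat) (D : set 'rV[R]_n) :
  measurable D -> bounded_set D -> (leb R n D < +oo)%E.
Proof.
move=> mD [M [_ hM]]; pose r := `|M| + 1.
have r0 : 0 < r by rewrite ltr_wpDl.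
apply: (@le_lt_trans _ _ (leb R n (cube 0 (r + 1)))); last first.
  by rewrite leb_cube ?ltry// addr_gt0.
apply: le_measure; rewrite ?inE//; first exact: measurable_cube.
move=> x Dx; apply/cubeP; first by rewrite addr_gt0.
by rewrite subr0 (le_lt_trans (hM r _ x Dx)) ?ltrDl// (le_lt_trans (ler_norm
  M))// ltrDl.
Qed.

(** * Calculus of smooth functions *)

Lemma smooth_diff (R : realType) (n : nat) (f : 'rV[R]_n -> R) x :
  smooth f -> differentiable f x.
Proof. by move=> sf; exact: (sf [::] x). Qed.

Lemma smooth_pderiv (R : realType) (n : nat) (f : 'rV[R]_n -> R) i :
  smooth f -> smooth (pderiv i f).
Proof. by move=> sf s x; have := sf (rcons s i) x; rewrite foldr_rcons. Qed.

(** Differentiability k times, peeling off one derivative at a time: the form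
    that sums, products and compositions preserve by induction on k. *)
Fixpoint ck (R : realType) (n k : nat) (f : 'rV[R]_n -> R) : Prop :=
  if k is k'.+1 then
    (forall x, differentiable f x) /\ (forall i, ck k' (pderiv i f))
  else True.

Lemma smooth_ckP (R : realType) (n : nat) (f : 'rV[R]_n -> R) :
  smooth f <-> forall k, ck k f.
Proof.
split.
  move=> + k; elim: k f => // k IH f sf; split; first by move=> x;
    exact: smooth_diff.
  by move=> i; apply: IH; exact: smooth_pderiv.
move=> h s; elim/last_ind: s f h => [f h x|s i IH f h].
  by have [] := h 1%N.
move=> x; rewrite foldr_rcons; apply: IH => k.
by have [_] := h k.+1; exact.
Qed.

Lemma ckS (R : realType) (n k : nat) (f : 'rV[R]_n -> R) : ck k.+1 f -> ck k f.
Proof.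
elim: k f => // k IH f [df cf]; split => // i; apply: IH; exact: cf.
Qed.

Lemma pderivD (R : realType) (n : nat) (f g : 'rV[R]_n -> R) i x :
  differentiable f x -> differentiable g x ->
  pderiv i (fun y => f y + g y) x = pderiv i f x + pderiv i g x.
Proof. by move=> df dg; apply: deriveD; exact: diff_derivable. Qed.

Lemma pderivM (R : realType) (n : nat) (f g : 'rV[R]_n -> R) i x :
  differentiable f x -> differentiable g x ->
  pderiv i (fun y => f y * g y) x = pderiv i f x * g x + f x * pderiv i g x.
Proof.
move=> df dg.
have hf : derivable f x (delta_mx 0 i) by exact: diff_derivable.
have hg : derivable g x (delta_mx 0 i) by exact: diff_derivable.
by apply: etrans (deriveM hf hg) _; rewrite /GRing.scale /= addrC mulrC.
Qed.

Lemma pderivZ (R : realType) (n : nat) (f : 'rV[R]_n -> R) (a : R) i x :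
  differentiable f x -> pderiv i (fun y => a * f y) x = a * pderiv i f x.
Proof. by move=> df; apply: deriveZ; exact: diff_derivable. Qed.

Lemma pderiv_cst (R : realType) (n : nat) (a : R) i (x : 'rV[R]_n) :
  pderiv i (fun=> a) x = 0.
Proof. exact: derive_cst. Qed.

Lemma pderiv_coord (R : realType) (n : nat) i j (x : 'rV[R]_n) :
  pderiv i (fun y => y 0 j) x = (i == j)%:R.
Proof.
rewrite /pderiv deriveE; last exact: differentiable_coord.
have lc (a : R) (y z : 'rV[R]_n) : (a *: y + z) 0 j = a * y 0 j + z 0 j.
  by rewrite !mxE.
pose f : {linear 'rV[R]_n -> R} := HB.pack (fun N : 'rV[R]_n => N 0 j)
  (GRing.isLinear.Build _ _ _ _ (fun N : 'rV[R]_n => N 0 j) lc).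
rewrite (@diff_lin _ _ _ f) /=; last exact: coord_continuous.
by rewrite !mxE eqxx /= eq_sym.
Qed.

Lemma pderiv_comp (R : realType) (n : nat) (f : 'rV[R]_n -> R) (g : R ->
  R) i x :
  differentiable f x -> derivable g (f x) 1 ->
  pderiv i (fun y => g (f y)) x = (derive1 g) (f x) * pderiv i f x.
Proof.
move=> df /derivable1_diffP dg.
rewrite /pderiv -[fun y => g (f y)]/(g \o f) deriveE;
  last exact: differentiable_comp.
rewrite diff_comp//= deriveE// derive1E'//.
by rewrite -[in LHS](mulr1 ('d f x _)) -[in LHS]/(_ *: 1) linearZ mulrC.
Qed.

Lemma ckD (R : realType) (n k : nat) (f g : 'rV[R]_n -> R) :
  ck k f -> ck k g -> ck k (fun x => f x + g x).
Proof.
elim: k f g => // k IH f g [df cf] [dg cg]; split.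
  by move=> x; exact: (differentiableD (df x) (dg x)).
move=> i; rewrite (_ : pderiv i _ = fun x => pderiv i f x + pderiv i g x).
  by apply: IH; [exact: cf|exact: cg].
by apply/funext => x; exact: pderivD.
Qed.

Lemma ckM (R : realType) (n k : nat) (f g : 'rV[R]_n -> R) :
  ck k f -> ck k g -> ck k (fun x => f x * g x).
Proof.
elim: k f g => // k IH f g cf cg.
have [df cf'] := cf; have [dg cg'] := cg; split.
  by move=> x; exact: (differentiableM (df x) (dg x)).
move=> i; rewrite (_ : pderiv i _ =
  fun x => pderiv i f x * g x + f x * pderiv i g x).
  apply: ckD; apply: IH.
  - exact: cf'.
  - exact: ckS.
  - exact: ckS.
  - exact: cg'.
by apply/funext => x; exact: pderivM.
Qed.

Lemma ck_cst (R : realType) (n k : nat) (a : R) : ck k (fun _ : 'rV[R]_n => a).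
Proof.
elim: k a => // k IH a; split; first by move=> x; exact: differentiable_cst.
move=> i; rewrite (_ : pderiv i _ = fun=> 0)//.
by apply/funext => x; exact: pderiv_cst.
Qed.

Lemma ck_coord (R : realType) (n k : nat) j : ck k (fun x : 'rV[R]_n => x 0 j).
Proof.
case: k => // k; split; first by move=> x; exact: differentiable_coord.
move=> i; rewrite (_ : pderiv i _ = fun=> (i == j)%:R); first exact: ck_cst.
by apply/funext => x; exact: pderiv_coord.
Qed.

Lemma ck_prod (R : realType) (n k : nat) (I : Type) (s : seq I)
  (f : I -> 'rV[R]_n -> R) :
  (forall i, ck k (f i)) -> ck k (fun x => \prod_(i <- s) f i x).
Proof.
move=> cf; elim: s => [|i s IH].
  by under eq_fun do rewrite big_nil; exact: ck_cst.
by under eq_fun do rewrite big_cons; exact: ckM.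
Qed.

Lemma ck_sum (R : realType) (n k : nat) (I : Type) (s : seq I) (P : pred I)
  (f : I -> 'rV[R]_n -> R) :
  (forall i, ck k (f i)) -> ck k (fun x => \sum_(i <- s | P i) f i x).
Proof.
move=> cf; elim: s => [|i s IH].
  by under eq_fun do rewrite big_nil; exact: ck_cst.
by under eq_fun do rewrite big_cons; case: (P i) => //; exact: ckD.
Qed.

Fixpoint ck1 (R : realType) (k : nat) (g : R -> R) : Prop :=
  if k is k'.+1 then (forall t, derivable g t 1) /\ ck1 k' (derive1 g) else
    True.

Lemma ck_comp (R : realType) (n k : nat) (f : 'rV[R]_n -> R) (g : R -> R) :
  ck1 k g -> ck k f -> ck k (fun x => g (f x)).
Proof.
elim: k f g => // k IH f g cg cf.
have [df cf'] := cf; have [dg cg'] := cg; split.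
  move=> x; apply: (@differentiable_comp _ _ _ _ f g) => //.
  by apply/derivable1_diffP.
move=> i; rewrite (_ : pderiv i _ = fun x => (derive1 g) (f x) * pderiv i f x).
  apply: ckM; last exact: cf'.
  by apply: IH => //; exact: ckS.
by apply/funext => x; exact: pderiv_comp.
Qed.

Lemma ck1_expR (R : realType) (k : nat) : ck1 k (@expR R).
Proof.
elim: k => // k IH; split; first by move=> t; exact: derivable_expR.
rewrite (_ : derive1 _ = @expR R)//.
by apply/funext => t; rewrite derive1E derive_val.
Qed.

Lemma ck1_lin (R : realType) (k : nat) (a b : R) : forall f g : R -> R,
  ck1 k f -> ck1 k g -> ck1 k (fun t => a * f t + b * g t).
Proof.
elim: k => // k IH f g [df cf] [dg cg].
have ha t : derivable (a \*: f) t 1 by exact: derivableZ.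
have hb t : derivable (b \*: g) t 1 by exact: derivableZ.
split; first by move=> t; exact: (derivableD (ha t) (hb t)).
rewrite (_ : derive1 _ = fun t => a * derive1 f t + b * derive1 g t).
  exact: IH.
apply/funext => t; rewrite !derive1E.
by rewrite (deriveD (ha t) (hb t)) !deriveZ.
Qed.

(** * Bump functions on boxes *)

(** The function t^(-j) exp (-1/t), extended by 0 to t <= 0. The exponent j is
    a parameter because the family is closed under derivation: the derivative
    of flat_j is flat_(j+2) - j flat_(j+1). *)
Definition flat (R : realType) (j : nat) (t : R) : R :=
  if t <= 0 then 0 else t^-1 ^+ j * expR (- t^-1).

Lemma flat_ge0 (R : realType) (j : nat) (t : R) : 0 <= flat j t.
Proof.
rewrite /flat; case: (leP t 0) => //= t0.
by rewrite mulr_ge0 ?expR_ge0// exprn_ge0// invr_ge0 ltW.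
Qed.

(** From exp s >= s^(j+1) / (j+1)! at s = 1/t. Since the difference quotient
    of flat_j at 0 is flat_(j+1), this bound gives the derivative there. *)
Lemma flat_le (R : realType) (j : nat) (t : R) :
  flat j t <= j.+1`!%:R * `|t|.
Proof.
rewrite /flat; case: (leP t 0) => [_|t0] /=; first by rewrite mulr_ge0.
have f0 : 0 < j.+1`!%:R :> R by rewrite ltr0n fact_gt0.
have /(@expR_ge1Dxn _ _ j) h : 0 <= t^-1 by rewrite invr_ge0 ltW.
have {h} : t^-1 ^+ j.+1 / j.+1`!%:R <= expR t^-1 by apply: le_trans h;
  rewrite lerDr.
rewrite ler_pdivrMr// exprSr ler_pdivrMr// => h.
rewrite expRN ler_pdivrMr ?expR_gt0// gtr0_norm//.
by apply: le_trans h _; rewrite -mulrA mulrC -mulrA [t * _]mulrC.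
Qed.

Lemma is_derive_flat_pos (R : realType) (j : nat) (t : R) : 0 < t ->
  is_derive t 1 (fun s : R => s^-1 ^+ j * expR (- s^-1))
   (t^-1 ^+ j.+2 * expR (- t^-1) - j%:R * (t^-1 ^+ j.+1 * expR (- t^-1))).
Proof.
move=> t0; have tn0 : t != 0 by rewrite gt_eqF.
have dV : is_derive t 1 (fun s : R => s^-1) (- t ^- 2 *: 1).
  by apply: is_deriveV.
pose P (r : R) := r ^+ j * expR (- r).
have dP (r : R) : is_derive r 1 P (r ^+ j * - expR (- r) + expR (- r) * (j%:R *
  r ^+ j.-1)).
  have dE : is_derive r (1 : R) (fun r : R => expR (- r)) (- expR (- r)).
    by rewrite -mulrN1; apply: (@is_derive1_comp _ expR -%R).
  have dX := is_deriveX j (is_derive_id r (1 : R)).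
  have dM := is_deriveM dX dE.
  have -> : P = (id ^+ j) * (fun r : R => expR (- r)).
    by apply/funext => s; rewrite /P -[RHS]/((id ^+ j) s * expR (- s)) exprfctE.
  apply: (@is_derive_eq _ _ _ _ _ _ _ _ dM).
  by rewrite /GRing.scale /= mulr1 exprfctE.
apply: (is_derive_eq (is_derive1_comp (dP t^-1) dV)).
rewrite /GRing.scale /= mulr1 -exprVn.
case: j {P dP} => [|j] /=; first by rewrite !expr0; ring.
by rewrite !exprS; ring.
Qed.

Lemma is_derive_flat (R : realType) (j : nat) (t : R) :
  is_derive t 1 (flat j) (flat j.+2 t - j%:R * flat j.+1 t).
Proof.
have [t0|t0|->] := ltrgt0P t.
- apply: (@near_eq_is_derive _ _ _ (fun s : R => s^-1 ^+ j * expR (- s^-1))).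
    near=> s; rewrite /flat leNgt ifN// negbK.
    by near: s; exact: lt_nbhsr.
  by rewrite /flat leNgt t0 /=; exact: is_derive_flat_pos.
- apply: (@near_eq_is_derive _ _ _ (cst 0)).
    near=> s; rewrite /flat /= ifT//.
    by apply: ltW; near: s; exact: lt_nbhsl.
  by rewrite /flat ltW// mulr0 subr0; exact: is_derive_cst.
- rewrite {2 3}/flat lexx mulr0 subr0.
  have h : (fun h : R => h^-1 *: (flat j (h *: 1 + 0) - flat j 0)) @ 0^' --> (0
    : R).
    pose C : R := j.+2`!%:R.
    have C0 : 0 < C by rewrite ltr0n fact_gt0.
    apply/cvgr0Pnorm_lt => e e0; near=> h.
    have hn0 : h != 0 by near: h; exact: nbhs_dnbhs_neq.
    have he : `|h| < e / C by near: h; apply: dnbhs0_lt; rewrite divr_gt0.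
    rewrite /GRing.scale /= mulr1 addr0 {2}/flat lexx subr0.
    have -> : h^-1 * flat j h = flat j.+1 h.
      rewrite /flat; case: leP => _; first by rewrite mulr0.
      by rewrite exprS mulrA.
    rewrite ger0_norm ?flat_ge0// (le_lt_trans (flat_le _ _))//.
    by rewrite -ltr_pdivlMl// mulrC.
  by apply: DeriveDef; [apply: cvgP; exact: h|exact: cvg_lim h].
Unshelve. all: by end_near. Qed.

Lemma ck1_flat (R : realType) (k j : nat) : ck1 k (@flat R j).
Proof.
elim: k j => // k IH j; split; first by move=> t; have [] := is_derive_flat j t.
rewrite (_ : derive1 _ = fun t => 1 * flat j.+2 t + (- j%:R) * flat j.+1 t).
  exact: ck1_lin.
apply/funext => t; rewrite derive1E; have [_ ->] := is_derive_flat j t.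
by rewrite mul1r mulNr.
Qed.

Lemma flat_gt0 (R : realType) (j : nat) (t : R) : 0 < t -> 0 < flat j t.
Proof.
by move=> t0; rewrite /flat leNgt t0 /= mulr_gt0 ?expR_gt0// exprn_gt0//
  invr_gt0.
Qed.

Lemma flat0 (R : realType) (j : nat) (t : R) : t <= 0 -> flat j t = 0.
Proof. by rewrite /flat => ->. Qed.

Definition box (R : realType) (n : nat) (a b : 'rV[R]_n) : set 'rV[R]_n :=
  [set x | forall i, a 0 i < x 0 i < b 0 i].

Definition cbox (R : realType) (n : nat) (a b : 'rV[R]_n) : set 'rV[R]_n :=
  [set x | forall i, a 0 i <= x 0 i <= b 0 i].

Lemma cube_box (R : realType) (n : nat) (c : 'rV[R]_n) (r : R) :
  cube c r = box (c - const_mx r) (c + const_mx r).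
Proof.
apply/seteqP; split => x /= h i; have := h i.
  by rewrite !mxE ltr_distl.
by rewrite !mxE ltr_distl.
Qed.

Lemma measurable_box (R : realType) (n : nat) (a b : 'rV[R]_n) :
  measurable (box a b).
Proof.
rewrite (_ : box a b =
    \bigcap_(i : 'I_n) (@rV_coord R n i @^-1` `]a 0 i, b 0 i[%classic)).
  apply: fin_bigcap_measurable => // i _.
  rewrite -[X in measurable X]setTI; apply: measurable_rV_coord => //.
by apply/seteqP; split => x /= h i; have := h i; rewrite /= in_itv /=;
  [move=> + _|exact].
Qed.

Lemma closed_cbox (R : realType) (n : nat) (a b : 'rV[R]_n) : closed (cbox a b).
Proof.
rewrite (_ : cbox a b =
    \bigcap_(i : 'I_n) ((fun x : 'rV[R]_n => x 0 i) @^-1` `[a 0 i,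
      b 0 i]%classic)).
  apply: closed_bigI => i _; apply: closed_comp; last exact: itv_closed.
  by move=> x _; exact: coord_continuous.
by apply/seteqP; split => x /= h i; have := h i; rewrite /= in_itv /=;
  [move=> + _|exact].
Qed.

Lemma compact_cbox (R : realType) (n : nat) (a b : 'rV[R]_n) : compact (cbox a
  b).
Proof.
rewrite (_ : cbox a b = [set v : 'rV[R]_n | forall i, `[a 0 i,
  b 0 i]%classic (v ord0 i)]).
  apply: (@rV_compact R n (fun i => `[a 0 i, b 0 i]%classic)) => i.
  exact: segment_compact.
by apply/seteqP; split => x /= h i; have := h i; rewrite /= in_itv.
Qed.

Definition boxes (R : realType) (n : nat) : set (set 'rV[R]_n) :=
  [set X | exists a b, X = box a b].

Lemma box_setI (R : realType) (n : nat) (a b a' b' : 'rV[R]_n) :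
  box a b `&` box a' b' = box (map2_mx Num.max a a') (map2_mx Num.min b b').
Proof.
apply/seteqP; split => x /=.
  move=> [h1 h2] i; rewrite !mxE gt_max lt_min.
  by case/andP: (h1 i) => -> ->; case/andP: (h2 i) => -> ->.
move=> h; split => i; have := h i; rewrite !mxE gt_max lt_min.
  by case/andP => /andP[-> _] /andP[].
by case/andP => /andP[_ ->] /andP[].
Qed.

Lemma setI_closed_boxes (R : realType) (n : nat) : setI_closed (@boxes R n).
Proof.
move=> _ _ [a [b ->]] [a' [b' ->]]; rewrite box_setI.
by eexists; eexists; reflexivity.
Qed.

(** Boxes form a pi-system, so two finite measures that agree on them agree.
    They generate the sigma-algebra because a condition p < x_i < q on one
    coordinate is an increasing union of boxes. *)
Lemma rV_measurableE (R : realType) (n : nat) :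
  @measurable _ 'rV[R]_n = <<s @boxes R n >>.
Proof.
apply/seteqP; split; last first.
  apply: smallest_sub; first exact: sigma_algebra_measurable.
  by move=> _ [a [b ->]]; exact: measurable_box.
apply: smallest_sub; first exact: smallest_sigma_algebra.
move=> A; rewrite -bigcup_seq /= => -[i _ [Y mY <-]]; rewrite setTI.
have [s0 sC sU] := smallest_sigma_algebra setT (@boxes R n).
have {mY} : <<s @RGenOpens.G R >> Y.
  by have := RGenOpens.measurableE R => /(congr1 (@^~ Y));
    rewrite /measurable /= => <-.
suff : <<s @RGenOpens.G R >> `<=`
  [set Y | <<s @boxes R n >> (@rV_coord R n i @^-1` Y)] by apply.
apply: smallest_sub.
  split => /=.
  - by rewrite preimage_set0.
  - by move=> B mB; rewrite setTD preimage_setC -setTD; exact: sC.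
  - by move=> F mF; rewrite preimage_bigcup; exact: sU.
move=> _ [p [q ->]] /=.
rewrite (_ : _ @^-1` _ = \bigcup_m
    box (\row_j if j == i then p else - m%:R) (\row_j if j == i then q else
      m%:R)).
  by apply: sU => m; apply: sub_sigma_algebra; eexists; eexists; reflexivity.
apply/seteqP; split => x /=.
  rewrite in_itv /= /rV_coord => xpq.
  exists (Num.bound `|x|) => // j; rewrite !mxE; case: eqVneq => [->//|_].
  rewrite -ltr_norml; apply: le_lt_trans (archi_boundP (normr_ge0 x)).
  by have := lexx `|x|; rewrite rV_norm_le// => /forallP; exact.
by move=> [m _ h]; have := h i; rewrite !mxE eqxx in_itv.
Qed.

Section bump.
Variables (R : realType) (n : nat) (a b : 'rV[R]_n).

(** A product of flat functions, positive exactly on the open box. *)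
Definition bump_base (x : 'rV[R]_n) : R :=
  \prod_(i < n) (flat 0 (x 0 i - a 0 i) * flat 0 (b 0 i - x 0 i)).

(** As m grows, 1 - exp (- m w) increases to the indicator of the set where
    w > 0, while its support does not change. *)
Definition bump (m : nat) (x : 'rV[R]_n) : R :=
  1 - expR (- (m%:R * bump_base x)).

Lemma bump_base_ge0 x : 0 <= bump_base x.
Proof. by apply: prodr_ge0 => i _; rewrite mulr_ge0 ?flat_ge0. Qed.

Lemma bump_base_gt0 x : box a b x -> 0 < bump_base x.
Proof.
move=> h; apply: prodr_gt0 => i _; have /andP[ax xb] := h i.
by rewrite mulr_gt0// flat_gt0// subr_gt0.
Qed.

Lemma bump_base_eq0 x : ~ box a b x -> bump_base x = 0.
Proof.
move=> /existsNP[i /negP]; rewrite negb_and -!leNgt => h.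
rewrite /bump_base (bigD1 i)//= -mulrA.
case/orP: h => h.
  by rewrite [X in X * _]flat0 ?subr_le0// mul0r.
by rewrite [X in _ * (X * _)]flat0 ?subr_le0// mul0r mulr0.
Qed.

Lemma smooth_bump m : smooth (bump m).
Proof.
apply/smooth_ckP => k; rewrite /bump.
apply: (@ckD _ _ _ (fun=> 1) (fun x => - expR (- (m%:R * bump_base x)))).
  exact: ck_cst.
under eq_fun do rewrite -mulN1r.
apply: ckM; first exact: ck_cst.
apply: (@ck_comp _ _ _ (fun x => - (m%:R * bump_base x))).
  exact: ck1_expR.
under eq_fun do rewrite -mulNr.
apply: ckM; first exact: ck_cst.
apply: ck_prod => i; apply: ckM.
  apply: ck_comp; first exact: ck1_flat.
  by apply: ckD; [exact: ck_coord|exact: ck_cst].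
apply: ck_comp; first exact: ck1_flat.
apply: ckD; first exact: ck_cst.
under eq_fun do rewrite -mulN1r.
by apply: ckM; [exact: ck_cst|exact: ck_coord].
Qed.

Lemma bump_itv m x : 0 <= bump m x <= 1.
Proof.
by rewrite /bump subr_ge0 expR_le1 oppr_le0 mulr_ge0 ?bump_base_ge0//= gerBl
  expR_ge0.
Qed.

Lemma bump_out m x : ~ box a b x -> bump m x = 0.
Proof. by move=> h; rewrite /bump bump_base_eq0// mulr0 oppr0 expR0 subrr. Qed.

Lemma cvg_bump x : bump m x @[m --> \oo] --> (\1_(box a b) x : R).
Proof.
have [h|h] := pselect (box a b x); last first.
  rewrite indicE memNset//= (_ : (fun m => bump m x) = fun=> 0);
    first exact: cvg_cst.
  by apply/funext => m; rewrite bump_out.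
rewrite indicE mem_set//= -[X in _ --> X](subr0 (1 : R)).
apply: cvgB; first exact: cvg_cst.
have g0 := bump_base_gt0 h.
apply/cvgr0Pnorm_lt => e e0; near=> m.
rewrite ger0_norm ?expR_ge0// expRN invf_plt ?posrE ?expR_gt0//.
apply: lt_le_trans (expR_ge1Dx _); rewrite ltr_wpDl//.
rewrite -ltr_pdivrMr//; near: m; exact: nbhs_infty_gtr.
Unshelve. all: by end_near. Qed.

Lemma bump_support m : closure [set x | bump m x != 0] `<=` cbox a b.
Proof.
apply: (@subset_trans _ (closure (cbox a b))).
  apply: closure_subset => x /=; apply: contraNP => h.
  apply/eqP; apply: bump_out => h'; apply: h => i.
  by have /andP[ax xb] := h' i; rewrite !ltW.
by have /closure_id <- := @closed_cbox R n a b.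
Qed.

Lemma test_bump m (U : set 'rV[R]_n) : cbox a b `<=` U -> test_fun U (bump m).
Proof.
move=> hU; split; first exact: smooth_bump.
  apply: (subclosed_compact _ (@compact_cbox _ _ a b)).
    exact: closed_closure.
  exact: bump_support.
exact: subset_trans (@bump_support m) hU.
Qed.

End bump.

(** * The fundamental lemma of the calculus of variations *)

Section fundamental_lemma.
Variables (R : realType) (n : nat) (U : set 'rV[R]_n) (g : 'rV[R]_n -> R).
Hypotheses (oU : open U) (ig : (leb R n).-integrable U (EFin \o g)).
Hypothesis g0 : forall phi, test_fun U phi -> ip U g phi = 0.

Let mU : measurable U := measurable_open_rV oU.

Let mg : measurable_fun U (g : 'rV[R]_n -> measurableTypeR R).
Proof. by apply/measurable_EFinP; case/integrableP: ig. Qed.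

(** Dominated convergence along the bump functions of the box. *)
Lemma integral_box_eq0 (a b : 'rV[R]_n) : cbox a b `<=` U ->
  (\int[leb R n]_(x in box a b) (g x)%:E = 0)%E.
Proof.
move=> abU.
have bU : box a b `<=` U.
  by apply: subset_trans abU => x /= h i; have /andP[ax xb] := h i;
    rewrite !ltW.
have mb m : measurable_fun U (bump a b m : 'rV[R]_n -> measurableTypeR R).
  apply: measurable_funTS; apply: measurable_fun_continuous_rV => x.
  by apply: differentiable_continuous; apply: smooth_diff; exact: smooth_bump.
have mgb m : measurable_fun U (fun x => (g x * bump a b m x)%:E).
  by apply/measurable_EFinP; exact: (measurable_funM mg (mb m)).
have gb m x : (`|(g x * bump a b m x)%:E| <= `|(g x)%:E|)%E.
  rewrite !abse_EFin lee_fin normrM ler_piMr//.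
  by have /andP[h0 h1] := bump_itv a b m x; rewrite ger0_norm.
have mI : measurable_fun U (\1_(box a b) : 'rV[R]_n -> measurableTypeR R).
  by apply: measurable_funTS; apply: measurable_indic; exact: measurable_box.
have [_ _] : [/\ (leb R n).-integrable U (fun x => (g x * \1_(box a b) x)%:E),
   (\int[leb R n]_(x in U) `|(g x * bump a b m x)%:E -
       (g x * \1_(box a b) x)%:E|)%E @[m --> \oo] --> 0%E &
   (\int[leb R n]_(x in U) (g x * bump a b m x)%:E)%E @[m --> \oo] -->
   (\int[leb R n]_(x in U) (g x * \1_(box a b) x)%:E)%E].
  apply: (@dominated_convergence _ _ _ (leb R n) U mU
    (fun m x => (g x * bump a b m x)%:E) (fun x => (g x * \1_(box a b) x)%:E)
    (fun x => `|(g x)%:E|%E)) => //.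
  - by apply/measurable_EFinP; exact: (measurable_funM mg mI).
  - apply: aeW => x _; apply: cvg_EFin; first exact: nearW.
    by apply: cvgM; [exact: cvg_cst|exact: cvg_bump].
  - exact: integrable_abse ig.
  - by apply: aeW => x m _; exact: gb.
rewrite (_ : (fun m => _) = fun=> 0%E); last first.
  apply/funext => m.
  have : ip U g (bump a b m) = 0 by apply: g0; exact: test_bump.
  rewrite /ip /Rintegral => e; rewrite -[LHS]fineK ?e//.
  apply: integrable_fin_num => //.
  apply: (le_integrable mU (mgb m) _ ig) => x _; exact: gb.
move=> /(cvg_unique _ (cvg_cst _)) => /(_ (@ereal_hausdorff R)) e.
rewrite -(setIidr bU) integral_mkcondr [RHS]e.
apply: eq_integral => x _; rewrite patchE indicE.
by case: ifPn => _; rewrite ?mulr1 ?mulr0.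
Qed.

(** The sets E satisfying the conclusion form a Dynkin class, which contains
    the boxes because the intersection of two boxes is a box. *)
Lemma integral_in_box_eq0 (a b : 'rV[R]_n) (E : set 'rV[R]_n) :
  cbox a b `<=` U -> measurable E ->
  (\int[leb R n]_(x in E `&` box a b) (g x)%:E = 0)%E.
Proof.
move=> abU mE.
have bU : box a b `<=` U.
  by apply: subset_trans abU => x /= h i; have /andP[ax xb] := h i;
    rewrite !ltW.
have mB := measurable_box a b.
have igB : (leb R n).-integrable (box a b) (EFin \o g).
  by apply: integrableS ig.
have igS E' : measurable E' -> (leb R n).-integrable (E' `&` box a b) (EFin \o
  g).
  by move=> mE'; apply: integrableS igB => //; exact: measurableI.
have := mE; rewrite [X in X E]rV_measurableE.
apply: (@dynkin_induction _ _ (@boxes R n)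
  (fun E => (\int[leb R n]_(x in E `&` box a b) (g x)%:E)%E = 0%E)).
- exact: rV_measurableE.
- exact: setI_closed_boxes.
- by rewrite setTI; exact: integral_box_eq0.
- move=> _ [a' [b' ->]].
  rewrite box_setI; apply: integral_box_eq0 => x h; apply: abU => i.
  have := h i; rewrite !mxE ge_max le_min => /andP[/andP[_ ->]].
  by case/andP.
- move=> S mS IH.
  have := integral_box_eq0 abU.
  have {1}-> : box a b = (S `&` box a b) `|` (~` S `&` box a b).
    by rewrite -setIUl setUv setTI.
  rewrite integral_setU_EFin; last 1 first.
  + by apply/disj_setPS => x [[? _] []].
  + by rewrite [X in (X + _)%E]IH add0e.
  + exact: measurableI.
  + by apply: measurableI => //; exact: measurableC.
  + rewrite -setIUl setUv setTI; exact: measurable_funS mg.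
- move=> F mF tF IH; rewrite setI_bigcupl integral_bigcup//.
  + by apply: eseries0 => i _ _; exact: IH.
  + by apply: trivIset_setIr.
  + by move=> k; exact: measurableI.
  + by rewrite -setI_bigcupl; apply: igS; exact: bigcup_measurable.
Qed.

(** A function whose integral vanishes on every measurable subset of a box is
    null on the box, and countably many boxes exhaust U. *)
Lemma fundamental_lemma : {ae leb R n, forall x, U x -> g x = 0}.
Proof.
(* The cubes that exhaust U, numbered through a coding of their rational
   centres and integer inverse radii. *)
pose P (k : nat) (x : 'rV[R]_n) :=
  if @unpickle ('rV[rat]_n * nat)%type k is Some p then
    (forall y, `|y - map_mx ratr p.1| <= p.2.+1%:R^-1 -> U y) ->
             cube (map_mx ratr p.1) p.2.+1%:R^-1 x -> g x = 0 else True.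
have hP k : {ae leb R n, forall x, P k x}.
  rewrite /P; case: unpickle => [[q m]|]; last exact: aeW.
  have [h|h] := pselect (forall y, `|y - map_mx ratr q| <= m.+1%:R^-1 -> U y);
    last first.
    by apply: aeW => x /h.
  rewrite /= cube_box.
  set a := _ - _; set b := _ + _.
  have abU : cbox a b `<=` U.
    move=> x hx; apply: h; rewrite rV_norm_le ?invr_ge0//.
    apply/forallP => i; have := hx i; rewrite !mxE ler_distl.
    by [].
  have bU : box a b `<=` U.
    by apply: subset_trans abU => x /= hx i; have /andP[ax xb] := hx i;
      rewrite !ltW.
  have : ae_eq (leb R n) (box a b) (EFin \o g) (cst 0%E).
    apply: integral_ae_eq => //.
    - exact: measurable_box.
    - by apply: integrableS ig => //; exact: measurable_box.
    - move=> E EB mE; rewrite integral0 -[RHS](integral_in_box_eq0 abU mE).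
      by rewrite setIidl.
  by apply: filterS => x hx _ bx; have := hx bx => -[].
apply: filterS (ae_foralln hP) => x hx Ux.
move: Ux; rewrite (open_bigcup_cubes oU) => -[p _ [hp cp]].
by have := hx (pickle p); rewrite /P pickleK; apply.
Qed.
End fundamental_lemma.

(** * Square-integrable functions *)

Lemma discriminant_le (R : realType) (a b c : R) :
  0 <= a -> 0 <= c -> (forall t : R, 0 <= a + t * (b *+ 2) + t ^+ 2 * c) ->
  b ^+ 2 <= a * c.
Proof.
move=> a0 c0 h; have [c1|c1] := eqVneq c 0.
  suff -> : b = 0 by rewrite expr0n/= mulr_ge0.
  apply/eqP; apply: contraT => b0.
  (* If c = 0, an affine function of t of nonzero slope reaches - 1. *)
  have := h (- (a + 1) / (b *+ 2)).
  rewrite c1 mulr0 addr0 divfK ?mulrn_eq0//; lra.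
have cp : 0 < c by rewrite lt_neqAle eq_sym c1.
(* The quadratic polynomial in t is smallest at t = - b / c. *)
have := h (- b / c).
have -> : a + - b / c * (b *+ 2) + (- b / c) ^+ 2 * c = (a * c - b ^+ 2) / c.
  by field.
by rewrite pmulr_lge0 ?invr_gt0// subr_ge0.
Qed.

Lemma cauchy_schwarz_le (R : realType) (a b c : R) :
  0 <= a -> 0 <= c -> (forall t : R, 0 <= a + t * (b *+ 2) + t ^+ 2 * c) ->
  `|b| <= Num.sqrt a * Num.sqrt c.
Proof.
move=> a0 c0 h; rewrite -sqrtr_sqr -sqrtrM// ler_sqrt ?mulr_ge0//.
exact: discriminant_le.
Qed.

Lemma sqrt_triangle (R : realType) (a b c : R) : 0 <= a -> 0 <= c ->
  `|b| <= Num.sqrt a * Num.sqrt c ->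
  Num.sqrt (a + b *+ 2 + c) <= Num.sqrt a + Num.sqrt c.
Proof.
move=> a0 c0 h.
rewrite -[leRHS]ger0_norm ?addr_ge0 ?sqrtr_ge0// -sqrtr_sqr ler_wsqrtr//.
rewrite sqrrD !sqr_sqrtr// lerD2r lerD2l lerMn2r/=.
exact: le_trans (ler_norm _) h.
Qed.

Section L2_space.
Variables (R : realType) (n : nat) (Omega : set 'rV[R]_n).
Hypothesis mO : measurable Omega.
Hypothesis fO : (leb R n Omega < +oo)%E.

Lemma L2_sqr_integrable f : L2 Omega f ->
  (leb R n).-integrable Omega (fun x => (f x ^+ 2)%:E).
Proof.
move=> [mf lf]; apply/integrableP; split.
  by apply/measurable_EFinP; exact: measurable_funX.
by under eq_integral do rewrite gee0_abs ?lee_fin ?sqr_ge0//.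
Qed.

Lemma L2_mul_integrable f g : L2 Omega f -> L2 Omega g ->
  (leb R n).-integrable Omega (fun x => (f x * g x)%:E).
Proof.
move=> lf lg.
apply: (le_integrable mO (g := fun x => (f x ^+ 2)%:E + (g x ^+ 2)%:E)%E).
- by apply/measurable_EFinP; exact: (measurable_funM lf.1 lg.1).
- move=> x _; rewrite -EFinD !abse_EFin lee_fin ler_norml.
  rewrite ger0_norm ?addr_ge0 ?sqr_ge0//.
  have h1 := sqr_ge0 (f x + g x); have h2 := sqr_ge0 (f x - g x).
  have h3 := sqr_ge0 (f x); have h4 := sqr_ge0 (g x).
  rewrite sqrrD in h1; rewrite sqrrB in h2; lra.
- by apply: integrableD => //; exact: L2_sqr_integrable.
Qed.

Lemma L2_lin f g c : L2 Omega f -> L2 Omega g ->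
  L2 Omega (fun x => f x + c * g x).
Proof.
move=> lf lg; split.
  by apply: measurable_funD lf.1 _; apply: measurable_funM lg.1.
have i : (leb R n).-integrable Omega
  (fun x => ((f x ^+ 2)%:E + ((2 * c)%:E * (f x * g x)%:E + (c ^+ 2)%:E * (g x
    ^+ 2)%:E))%E).
  apply: integrableD => //; first exact: L2_sqr_integrable.
  apply: integrableD => //; apply: integrableZl => //.
    exact: L2_mul_integrable.
  exact: L2_sqr_integrable.
have /integrableP[_] := i; apply: le_lt_trans.
under [leRHS]eq_integral do rewrite -!EFinM -!EFinD.
apply: ge0_le_integral => //.
- by move=> x _; rewrite lee_fin sqr_ge0.
- apply/measurable_EFinP; apply: measurable_funX.
  by apply: measurable_funD lf.1 _; apply: measurable_funM lg.1.
- by move: (measurable_int _ i); under eq_fun do rewrite -!EFinM -!EFinD;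
  exact: measurableT_comp.
- move=> x _; rewrite abse_EFin lee_fin.
  rewrite (_ : (_ + _) ^+ 2 = f x ^+ 2 + (2 * c * (f x * g x) + c ^+ 2 * g x ^+
    2)); last by ring.
  exact: ler_norm.
Qed.

Lemma L2_bounded f M : measurable_fun Omega (f : 'rV[R]_n ->
  measurableTypeR R) ->
  (forall x, Omega x -> `|f x| <= M) -> L2 Omega f.
Proof.
move=> mf bf; split => //.
apply: (@le_lt_trans _ _ (\int[leb R n]_(x in Omega) (M ^+ 2)%:E)%E).
  apply: ge0_le_integral => //.
  - by move=> x _; rewrite lee_fin sqr_ge0.
  - by apply/measurable_EFinP; exact: measurable_funX.
  - move=> x Ox; rewrite lee_fin -real_normK ?num_real// lerXn2r ?nnegrE//.
      by apply: le_trans (bf x Ox).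
    exact: bf.
by rewrite integral_cst// lte_mul_pinfty// ?lee_fin ?sqr_ge0.
Qed.

Lemma L2_cst c : L2 Omega (fun=> c).
Proof. exact: (@L2_bounded _ `|c|). Qed.

Lemma L2_integrable f : L2 Omega f ->
  (leb R n).-integrable Omega (fun x => (f x)%:E).
Proof.
move=> lf; have := L2_mul_integrable lf (L2_cst 1).
by under eq_fun do rewrite mulr1.
Qed.

Lemma ipC (f g : 'rV[R]_n -> R) : ip Omega f g = ip Omega g f.
Proof. by rewrite /ip; under eq_Rintegral do rewrite mulrC. Qed.

Lemma ip_linl f g h c : L2 Omega f -> L2 Omega g -> L2 Omega h ->
  ip Omega (fun x => f x + c * g x) h = ip Omega f h + c * ip Omega g h.
Proof.
move=> lf lg lh; rewrite /ip.
under eq_Rintegral do rewrite mulrDl -mulrA.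
rewrite RintegralD//; last 2 first.
- exact: L2_mul_integrable.
- rewrite (_ : EFin \o _ = fun x => (c%:E * (g x * h x)%:E)%E).
    by apply: integrableZl => //; exact: L2_mul_integrable.
  by apply/funext => x /=; rewrite EFinM.
by rewrite RintegralZl//; exact: L2_mul_integrable.
Qed.

Lemma ip_linr f g h c : L2 Omega f -> L2 Omega g -> L2 Omega h ->
  ip Omega h (fun x => f x + c * g x) = ip Omega h f + c * ip Omega h g.
Proof. by move=> lf lg lh; rewrite ipC ip_linl// !(ipC h). Qed.

Lemma ip_ge0 f : 0 <= ip Omega f f.
Proof. by apply: Rintegral_ge0 => x _; rewrite -expr2 sqr_ge0. Qed.

Lemma ip_ae_eq f f' g : L2 Omega f -> L2 Omega f' -> L2 Omega g ->
  {ae leb R n, forall x, Omega x -> f x = f' x} ->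
  ip Omega f g = ip Omega f' g.
Proof.
move=> lf lf' lg e; congr fine; apply: ae_eq_integral => //.
- by apply/measurable_EFinP; exact: (measurable_funM lf.1 lg.1).
- by apply/measurable_EFinP; exact: (measurable_funM lf'.1 lg.1).
- by apply: filterS e => x h Ox; rewrite h.
Qed.

Lemma ip_cs f g : L2 Omega f -> L2 Omega g ->
  `|ip Omega f g| <= L2norm Omega f * L2norm Omega g.
Proof.
move=> lf lg; apply: cauchy_schwarz_le; rewrite ?ip_ge0// => t.
have lfg := L2_lin t lf lg.
have := ip_ge0 (fun x => f x + t * g x).
rewrite ip_linl// !ip_linr// [ip Omega g f]ipC.
by congr (0 <= _); ring.
Qed.

Lemma L2norm_ge0 (f : 'rV[R]_n -> R) : 0 <= L2norm Omega f.
Proof. exact: sqrtr_ge0. Qed.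

Lemma L2norm_sqr (f : 'rV[R]_n -> R) : L2norm Omega f ^+ 2 = ip Omega f f.
Proof. by rewrite sqr_sqrtr// ip_ge0. Qed.

End L2_space.

(** * Weak derivatives and Sobolev norms *)

Lemma smooth_continuous (R : realType) (n : nat) (f : 'rV[R]_n -> R) :
  smooth f -> continuous f.
Proof. by move=> sf x; apply: differentiable_continuous;
  exact: smooth_diff. Qed.

Lemma smooth_mderiv (R : realType) (n : nat) (a : 'I_n -> nat)
  (f : 'rV[R]_n -> R) : smooth f -> smooth (mderiv a f).
Proof.
move=> sf; rewrite /mderiv; elim: (enum 'I_n) => //= i s IH.
by elim: (a i) => //= k IHk; exact: smooth_pderiv.
Qed.

Lemma smooth_lin (R : realType) (n : nat) (f g : 'rV[R]_n -> R) c :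
  smooth f -> smooth g -> smooth (fun x => f x + c * g x).
Proof.
move=> /smooth_ckP sf /smooth_ckP sg; apply/smooth_ckP => k.
by apply: ckD => //; apply: ckM => //; exact: ck_cst.
Qed.

Lemma pderiv_lin (R : realType) (n : nat) (f g : 'rV[R]_n -> R) c i :
  smooth f -> smooth g ->
  pderiv i (fun x => f x + c * g x) = fun x => pderiv i f x + c * pderiv i g x.
Proof.
move=> sf sg; apply/funext => x; rewrite pderivD ?pderivZ//;
  try exact: smooth_diff.
by apply: differentiableZ; exact: smooth_diff.
Qed.

Section weak_derivatives.
Variables (R : realType) (n : nat) (Omega : set 'rV[R]_n).
Hypothesis oO : open Omega.
Hypothesis bO : bounded_set Omega.
Local Notation L2 := (L2 Omega).
Local Notation ip := (ip Omega).
Local Notation aeO P := {ae leb R n, forall x, Omega x -> P x}.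

Let mO : measurable Omega := measurable_open_rV oO.
Let fO : (leb R n Omega < +oo)%E := leb_bounded_fin mO bO.

Lemma compact_closure_bounded : compact (closure Omega).
Proof.
apply: bounded_closed_compact; last exact: closed_closure.
have [M [Mr hM]] := bO; exists M; split => // N MN x cx.
have : closure [set y : 'rV[R]_n | `|y| <= N] x.
  by apply: closure_subset cx => y; exact: hM.
have /closure_id <- // : closed [set y : 'rV[R]_n | `|y| <= N].
apply: (@closed_comp _ _ (@Num.norm R 'rV[R]_n) [set r | r <= N]).
  by move=> y _; exact: norm_continuous.
exact: closed_le.
Qed.

Lemma continuous_closure_bounded (f : 'rV[R]_n -> R) :
  {within closure Omega, continuous f} ->
  exists M, forall x, closure Omega x -> `|f x| <= M.
Proof.
move=> cf; have := continuous_compact cf compact_closure_bounded.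
move=> /compact_bounded[M [Mr hM]]; exists (M + 1) => x cx.
by apply: (hM (M + 1)); [rewrite ltrDl|exists x].
Qed.

Lemma continuous_L2 (f : 'rV[R]_n -> R) :
  {within closure Omega, continuous f} -> L2 f.
Proof.
move=> cf; have [M hM] := continuous_closure_bounded cf.
apply: (@L2_bounded _ _ _ mO fO _ M); last by move=> x /subset_closure;
  exact: hM.
apply: measurable_fun_open_continuous => // x Ox.
have cf' : {within Omega, continuous f} by apply: continuous_subspaceW cf;
  exact: subset_closure.
by move: cf'; rewrite continuous_open_subspace// => /(_ x); apply; rewrite inE.
Qed.

Lemma smooth_L2 (f : 'rV[R]_n -> R) : smooth f -> L2 f.
Proof.
by move=> sf; apply: continuous_L2; apply: continuous_subspaceT;
  exact: smooth_continuous.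
Qed.

Lemma test_L2 phi : test_fun Omega phi -> L2 phi.
Proof. by move=> [sp _ _]; exact: smooth_L2. Qed.

Lemma test_mderiv_L2 a phi : test_fun Omega phi -> L2 (mderiv a phi).
Proof. by move=> [sp _ _]; apply: smooth_L2; exact: smooth_mderiv. Qed.

Lemma ip_test_eq0 (g : 'rV[R]_n -> R) : L2 g ->
  (forall phi, test_fun Omega phi -> ip g phi = 0) -> aeO (fun x => g x = 0).
Proof. by move=> lg; apply: fundamental_lemma => //; exact: L2_integrable. Qed.

(** The difference of two candidates is orthogonal to all test functions. *)
Lemma is_wderiv_unique a u g h :
  is_wderiv Omega a u g -> is_wderiv Omega a u h -> aeO (fun x => g x = h x).
Proof.
move=> [lg wg] [lh wh].
have : aeO (fun x => g x + (-1) * h x = 0).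
  apply: ip_test_eq0 => [|phi tphi]; first exact: L2_lin.
  have lphi := test_L2 tphi.
  rewrite (ip_linl mO _ lg lh lphi).
  have := wg _ tphi; rewrite (wh _ tphi).
  have s0 : (-1) ^+ mi_size a != 0 :> R
    by rewrite expf_neq0// oppr_eq0 oner_eq0.
  by move=> /(mulfI s0) ->; rewrite mulN1r subrr.
by apply: filterS => x + Ox => /(_ Ox)/eqP; rewrite mulN1r subr_eq0 => /eqP.
Qed.

Lemma is_wderiv_lin a u v g h c : L2 u -> L2 v ->
  is_wderiv Omega a u g -> is_wderiv Omega a v h ->
  is_wderiv Omega a (fun x => u x + c * v x) (fun x => g x + c * h x).
Proof.
move=> lu lv [lg wg] [lh wh]; split; first exact: L2_lin.
move=> phi tphi; have lphi := test_L2 tphi; have ldphi := test_mderiv_L2 a tphi.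
by rewrite !ip_linl// wg// wh//; ring.
Qed.

Lemma wderivP a u : (exists g, is_wderiv Omega a u g) ->
  is_wderiv Omega a u (wderiv Omega a u).
Proof. by move=> h; exact: (xgetPex (fun=> 0) h). Qed.

Variable m : nat.
Local Notation H := (Hm Omega m).
Local Notation idx a := (mi_size (fun i => a i) <= m)%N.

Lemma Hm_L2 u : H u -> L2 u. Proof. by case. Qed.

Lemma Hm_wderiv u (a : {ffun 'I_n -> 'I_m.+1}) : H u -> idx a ->
  is_wderiv Omega (fun i => a i) u (wderiv Omega (fun i => a i) u).
Proof. by move=> [_ h] ha; apply: wderivP; exact: h. Qed.

Lemma Hm_wderiv_L2 u (a : {ffun 'I_n -> 'I_m.+1}) : H u -> idx a ->
  L2 (wderiv Omega (fun i => a i) u).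
Proof. by move=> hu ha; have [] := Hm_wderiv hu ha. Qed.

Lemma Hm_lin u v c : H u -> H v -> H (fun x => u x + c * v x).
Proof.
move=> hu hv; split; first exact: L2_lin (Hm_L2 hu) (Hm_L2 hv).
move=> a ha; eexists.
exact: is_wderiv_lin (Hm_L2 hu) (Hm_L2 hv) (Hm_wderiv hu ha) (Hm_wderiv hv ha).
Qed.

Lemma wderiv_lin u v c (a : {ffun 'I_n -> 'I_m.+1}) : H u -> H v -> idx a ->
  aeO (fun x => wderiv Omega (fun i => a i) (fun x => u x + c * v x) x =
     wderiv Omega (fun i => a i) u x + c * wderiv Omega (fun i => a i) v x).
Proof.
move=> hu hv ha; apply: is_wderiv_unique (Hm_wderiv (Hm_lin c hu hv) ha) _.
exact: is_wderiv_lin (Hm_L2 hu) (Hm_L2 hv) (Hm_wderiv hu ha) (Hm_wderiv hv ha).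
Qed.

(** A weak derivative depends only on the class of u modulo null functions: up
    to sign it pairs with phi as u pairs with D^a phi, and that pairing is
    bounded by |u|_L2. *)
Lemma wderiv_null u (a : {ffun 'I_n -> 'I_m.+1}) : H u -> idx a ->
  L2norm Omega u = 0 -> aeO (fun x => wderiv Omega (fun i => a i) u x = 0).
Proof.
move=> hu ha u0; have [lw ww] := Hm_wderiv hu ha.
apply: ip_test_eq0 => // phi tphi.
have ld := test_mderiv_L2 (fun i => a i) tphi.
have := ip_cs mO (Hm_L2 hu) ld.
rewrite u0 mul0r normr_le0 ww// mulf_eq0 expf_eq0 oppr_eq0 oner_eq0 andbF /=.
by move/eqP.
Qed.

(** The inner product behind [Hmnorm]. It is bilinear on H^m even though the
    chosen representatives of weak derivatives are linear only up to null
    sets. *)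
Definition hip (u v : 'rV[R]_n -> R) : R :=
  \sum_(a : {ffun 'I_n -> 'I_m.+1} | idx a)
    ip (wderiv Omega (fun i => a i) u) (wderiv Omega (fun i => a i) v).

Lemma hipC u v : hip u v = hip v u.
Proof. by apply: eq_bigr => a _; exact: ipC. Qed.

Lemma hip_linl u v w c : H u -> H v -> H w ->
  hip (fun x => u x + c * v x) w = hip u w + c * hip v w.
Proof.
move=> hu hv hw; rewrite /hip mulr_sumr -big_split /=; apply: eq_bigr => a ha.
have lu := Hm_wderiv_L2 hu ha; have lv := Hm_wderiv_L2 hv ha.
have lw := Hm_wderiv_L2 hw ha.
rewrite -(ip_linl mO c lu lv lw); apply: (ip_ae_eq mO _ _ lw).
- exact: (Hm_wderiv_L2 (Hm_lin c hu hv) ha).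
- exact: L2_lin.
- exact: wderiv_lin.
Qed.

Lemma hip_linr u v w c : H u -> H v -> H w ->
  hip w (fun x => u x + c * v x) = hip w u + c * hip w v.
Proof.
by move=> hu hv hw; rewrite hipC (hip_linl c hu hv hw) (hipC w u) (hipC w v).
Qed.

Lemma hip_ge0 u : 0 <= hip u u.
Proof. by apply: sumr_ge0 => a _; exact: ip_ge0. Qed.

Lemma HmnormE u : Hmnorm Omega m u = Num.sqrt (hip u u).
Proof. by rewrite /Hmnorm; congr Num.sqrt; apply: eq_bigr => a _;
  rewrite L2norm_sqr. Qed.

Lemma L2norm_wderiv_le u (a : {ffun 'I_n -> 'I_m.+1}) : idx a ->
  L2norm Omega (wderiv Omega (fun i => a i) u) <= Hmnorm Omega m u.
Proof.
move=> ha; rewrite HmnormE ler_wsqrtr// /hip (bigD1 a)//= lerDl.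
by apply: sumr_ge0 => b _; exact: ip_ge0.
Qed.

Lemma Hmnorm_sqr u : Hmnorm Omega m u ^+ 2 = hip u u.
Proof. by rewrite HmnormE sqr_sqrtr// hip_ge0. Qed.

Lemma Hmnorm_ge0 u : 0 <= Hmnorm Omega m u.
Proof. by rewrite HmnormE sqrtr_ge0. Qed.

Lemma hip_cs u v : H u -> H v ->
  `|hip u v| <= Hmnorm Omega m u * Hmnorm Omega m v.
Proof.
move=> hu hv; rewrite !HmnormE; apply: cauchy_schwarz_le;
  rewrite ?hip_ge0// => t.
have huv := Hm_lin t hu hv.
have := hip_ge0 (fun x => u x + t * v x).
rewrite (hip_linl t hu hv huv) (hip_linr t hu hv hu) (hip_linr t hu hv hv).
rewrite (hipC v u); move: (hip u u) (hip u v) (hip v v) => p q r.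
by congr (0 <= _); ring.
Qed.

Lemma Hmnorm_lin u v c : H u -> H v ->
  Hmnorm Omega m (fun x => u x + c * v x) <=
  Hmnorm Omega m u + `|c| * Hmnorm Omega m v.
Proof.
move=> hu hv; have huv := Hm_lin c hu hv; rewrite [leLHS]HmnormE.
have -> : hip (fun x => u x + c * v x) (fun x => u x + c * v x) =
   hip u u + (c * hip u v) *+ 2 + c ^+ 2 * hip v v.
  rewrite (hip_linl c hu hv huv) (hip_linr c hu hv hu) (hip_linr c hu hv hv).
  by rewrite (hipC v u); move: (hip u u) (hip u v) (hip v v) => p q r; ring.
have e : Num.sqrt (c ^+ 2 * hip v v) = `|c| * Hmnorm Omega m v.
  by rewrite sqrtrM ?sqr_ge0// sqrtr_sqr -HmnormE.
rewrite -e HmnormE; apply: sqrt_triangle.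
- exact: hip_ge0.
- by rewrite mulr_ge0 ?sqr_ge0// hip_ge0.
rewrite normrM (sqrtrM _ (sqr_ge0 c)) sqrtr_sqr mulrCA ler_wpM2l//.
by apply: le_trans (hip_cs hu hv) _; rewrite (HmnormE u) (HmnormE v).
Qed.

End weak_derivatives.

(** * Integration by parts against test functions *)

(** Compact support as a bound on the norm, a form inherited by derivatives
    and products. *)
Definition vanish (R : realType) (n : nat) (r : R) (f : 'rV[R]_n -> R) : Prop :=
  forall x, r < `|x| -> f x = 0.

Lemma compact_rV_norm_bounded (R : realType) (n : nat) (K : set 'rV[R]_n) :
  compact K -> exists2 r : R, 0 < r & forall x, K x -> `|x| <= r.
Proof.
move=> /compact_bounded[M [Mr hM]]; exists (`|M| + 1);
  first by rewrite ltr_wpDl.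
by move=> x Kx; apply: (hM (`|M| + 1)) => //;
  rewrite (le_lt_trans (ler_norm M))// ltrDl.
Qed.

Lemma test_fun_vanish (R : realType) (n : nat) (U : set 'rV[R]_n) phi :
  test_fun U phi -> exists2 r : R, 0 < r & vanish r phi.
Proof.
move=> [_ /compact_rV_norm_bounded[r r0 hr] _]; exists r => // x rx.
apply/eqP; apply: contraTT rx => h; rewrite -leNgt; apply: hr.
exact: subset_closure.
Qed.

Lemma pderiv_near0 (R : realType) (n : nat) (f : 'rV[R]_n -> R) i x :
  (\forall y \near x, f y = 0) -> pderiv i f x = 0.
Proof.
move=> h; rewrite /pderiv (near_eq_derive _ (g := cst 0))//.
exact: derive_cst.
Qed.

Lemma vanish_pderiv (R : realType) (n : nat) (r : R) (f : 'rV[R]_n -> R) i :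
  vanish r f -> vanish r (pderiv i f).
Proof.
move=> vf x rx; apply: pderiv_near0.
have : nbhs x [set y : 'rV[R]_n | r < `|y|].
  apply: open_nbhs_nbhs; split => //.
  apply: (@open_comp _ _ (@Num.norm R 'rV[R]_n) [set s | r < s]).
    by move=> y _; exact: norm_continuous.
  exact: open_gt.
by apply: filterS => y; exact: vf.
Qed.

Lemma norm_le_closed_bounded (R : realType) (n : nat) (r : R) :
  compact [set x : 'rV[R]_n | `|x| <= r].
Proof.
apply: bounded_closed_compact.
  by exists r; split; [exact: num_real|move=> N rN x /= /le_trans; apply;
    exact: ltW].
apply: (@closed_comp _ _ (@Num.norm R 'rV[R]_n) [set s | s <= r]).
  by move=> y _; exact: norm_continuous.
exact: closed_le.
Qed.

Lemma continuous_bounded_on (R : realType) (n : nat) (r : R) (f : 'rV[R]_n ->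
  R) :
  continuous f -> exists2 M, 0 <= M & forall x, `|x| <= r -> `|f x| <= M.
Proof.
move=> cf.
have := continuous_compact (continuous_subspaceT cf) (@norm_le_closed_bounded R
  n r).
move=> /compact_bounded[M [Mr hM]]; exists (`|M| + 1);
  first by rewrite addr_ge0.
move=> x cx; apply: (hM (`|M| + 1)); last by exists x.
by rewrite (le_lt_trans (ler_norm M))// ltrDl.
Qed.

Lemma measurable_norm_le (R : realType) (n : nat) (r : R) :
  measurable [set x : 'rV[R]_n | `|x| <= r].
Proof.
apply: measurable_closed_rV; apply: compact_closed;
  last exact: norm_le_closed_bounded.
exact: norm_hausdorff.
Qed.

Lemma integrable_ball_cst (R : realType) (n : nat) (r M : R) :
  (leb R n).-integrable [set x : 'rV[R]_n | `|x| <= r] (fun=> M%:E).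
Proof.
have mB := @measurable_norm_le R n r.
apply/integrableP; split; first exact: measurable_cst.
rewrite /= integral_cst//= lte_mul_pinfty ?lee_fin//.
apply: leb_bounded_fin => //; exists r; split; first exact: num_real.
by move=> N rN x /= /le_trans; apply; exact: ltW.
Qed.

Lemma vanish_integrable (R : realType) (n : nat) (r : R) (f : 'rV[R]_n -> R) :
  continuous f -> vanish r f -> (leb R n).-integrable setT (EFin \o f).
Proof.
move=> cf vf; have [M M0 hM] := continuous_bounded_on r cf.
have mB := @measurable_norm_le R n r.
rewrite (_ : EFin \o f = (EFin \o f) \_ [set x | `|x| <= r]); last first.
  apply/funext => x; rewrite patchE; case: ifPn => //= h.
  rewrite vf// ltNge; apply/negP => h'; by rewrite mem_set in h.
apply: (integrable_mkcond _ mB).1.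
apply: (@le_integrable _ _ _ _ _ mB _ (fun=> M%:E)).
- apply/measurable_EFinP; apply: measurable_funTS;
  exact: measurable_fun_continuous_rV.
- by move=> x xB; rewrite /= lee_fin [leRHS]ger0_norm//; exact: hM.
exact: integrable_ball_cst.
Qed.

Lemma is_derive_line (R : realType) (n : nat) (f : 'rV[R]_n -> R) i x (s : R) :
  smooth f -> is_derive s 1 (fun s : R => f (x + s *: delta_mx 0 i))
    (pderiv i f (x + s *: delta_mx 0 i)).
Proof.
move=> sf; set e := delta_mx 0 i.
have df : derivable f (x + s *: e) e by apply: diff_derivable;
  exact: smooth_diff.
have E : (fun h => h^-1 *: ((f \o shift (x + s *: e)) (h *: e) - f (x + s *:
  e))) =
    (fun h : R => h^-1 *: (((fun s : R => f (x + s *: e)) \o shift s) (h *: (1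
      : R)) - f (x + s *: e))).
  apply/funext => h /=; congr (_ *: (f _ - _)).
  by rewrite [h%:A]mulr1 scalerDl addrCA.
by apply: DeriveDef; rewrite /derivable /pderiv /derive -E.
Qed.

Lemma continuous_shift (R : realType) (n : nat) (f : 'rV[R]_n -> R)
  (c : 'rV[R]_n) : continuous f -> continuous (fun x : 'rV[R]_n => f (x + c)).
Proof.
move=> cf x; apply: (@continuous_comp _ _ _ (fun y : 'rV[R]_n => y + c) f).
  have h1 : (id : 'rV[R]_n -> 'rV[R]_n) @ x --> x by [].
  have h2 : (cst c : 'rV[R]_n -> 'rV[R]_n) @ x --> c
    by exact: (@cst_continuous 'rV[R]_n 'rV[R]_n c x).
  exact: (cvgD h1 h2).
exact: cf.
Qed.

(** Difference quotients integrate to 0 by translation invariance. They tend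
    to the derivative, and the mean value theorem bounds them on a fixed ball
    outside of which they vanish. *)
Lemma integral_pderiv_eq0 (R : realType) (n : nat) (r : R) (f : 'rV[R]_n ->
  R) i :
  smooth f -> vanish r f -> \int[leb R n]_x pderiv i f x = 0.
Proof.
move=> sf vf; set e : 'rV[R]_n := delta_mx 0 i.
have sp := smooth_pderiv i sf.
have cf := smooth_continuous sf; have cp := smooth_continuous sp.
have ne : `|e| <= 1.
  rewrite rV_norm_le//; apply/forallP => j; rewrite !mxE eqxx /=.
  by case: (j == i); rewrite ?normr1 ?normr0.
have [M M0 hM] := continuous_bounded_on (r + 2) cp.
pose t (m : nat) : R := m.+1%:R^-1.
have t0 m : 0 < t m by rewrite invr_gt0.
have t1 m : t m <= 1 by rewrite invf_le1// ler1n.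
(* Difference quotients in the direction e, with step 1 / (m + 1). *)
pose F m (x : 'rV[R]_n) : R := (t m)^-1 * (f (x + t m *: e) - f x).
have cF m : continuous (F m).
  move=> x; have h1 := @continuous_shift R n f (t m *: e) cf.
  have h2 := continuousB (h1 x) (cf x).
  exact: (continuousM (@cst_continuous _ R (t m)^-1 x) h2).
have bF m x : `|F m x| <= M * \1_[set x : 'rV[R]_n | `|x| <= r + 1] x.
  rewrite indicE; case: (boolP (x \in _)) => [|] h.
    rewrite mulr1; move/set_mem: h => /= h.
    have [||c cin] := @MVT_segment R (fun s => f (x + s *: e))
      (fun s => pderiv i f (x + s *: e)) 0 (t m) (ltW (t0 m)).
    - by move=> s _; exact: is_derive_line.
    - apply: derivable_within_continuous => s _.
      by have [] := is_derive_line i x s sf.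
    rewrite scale0r addr0 subr0 /F => ->.
    rewrite mulrCA mulVf ?gt_eqF// mulr1; apply: hM.
    move: cin; rewrite in_itv/= => /andP[c0 ct].
    rewrite (le_trans (ler_normD _ _))// (_ : r + 2 = (r + 1) + 1);
      last by ring.
    rewrite lerD// normrZ ger0_norm// mulr_ile1//; exact: le_trans ct _.
  have {}h : r + 1 < `|x|.
    by rewrite ltNge; apply/negP => h'; rewrite mem_set in h.
  rewrite mulr0 /F !vf ?subrr ?mulr0 ?normr0//.
    by apply: lt_trans h; rewrite ltrDl.
  have : `|x| <= `|x + t m *: e| + `|t m *: e|.
    by rewrite -{1}(addrK (t m *: e) x) ler_normB.
  have : `|t m *: e| <= 1.
    by rewrite normrZ ger0_norm ?mulr_ile1// ltW.
  lra.
have iF m : (\int[leb R n]_x (F m x)%:E = 0)%E.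
  have i1 : (leb R n).-integrable setT (EFin \o f)
    by exact: vanish_integrable cf vf.
  have mf : measurable_fun setT (EFin \o f) by case/integrableP : i1.
  have i2 : (leb R n).-integrable setT (fun x => (f (x + t m *: e))%:E).
    apply: (@vanish_integrable _ _ (r + 1) (fun x => f (x + t m *: e))).
      exact: continuous_shift.
    move=> x h; apply: vf.
    have : `|x| <= `|x + t m *: e| + `|t m *: e|.
      by rewrite -{1}(addrK (t m *: e) x) ler_normB.
    have : `|t m *: e| <= 1.
      by rewrite normrZ ger0_norm ?mulr_ile1// ltW.
    lra.
  under eq_integral do rewrite EFinM EFinB.
  rewrite integralZl//; last exact: integrableB.
  rewrite integralB//.
  rewrite (@integral_shift _ _ (t m *: e) _ mf) subee ?mule0//.
  exact: integrable_fin_num.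
have [_ _] : [/\ (leb R n).-integrable setT (fun x => (pderiv i f x)%:E),
   (\int[leb R n]_x `|(F m x)%:E - (pderiv i f x)%:E|)%E @[m --> \oo] --> 0%E &
   (\int[leb R n]_x (F m x)%:E)%E @[m --> \oo] -->
   (\int[leb R n]_x (pderiv i f x)%:E)%E].
  apply: (@dominated_convergence _ _ _ (leb R n) setT measurableT
    (fun m x => (F m x)%:E) (fun x => (pderiv i f x)%:E)
    (fun x => (M * \1_[set x : 'rV[R]_n | `|x| <= r + 1] x)%:E)).
  - by move=> m; apply/measurable_EFinP; exact: measurable_fun_continuous_rV.
  - by apply/measurable_EFinP; exact: measurable_fun_continuous_rV.
  - apply: aeW => x _; apply: cvg_EFin; first exact: nearW.
    have cv : (fun h : R => h^-1 *: (f (h *: e + x) - f x)) @ 0^' --> pderiv i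
      f x.
      exact: (diff_derivable (v := e) (smooth_diff x sf)).
    have ct : t m @[m --> \oo] --> (0 : R)^'.
      move=> P hP; have h : \forall m \near \oo, t m != 0 -> P (t m).
        exact: (@cvg_harmonic R _ hP).
      suff : \forall m \near \oo, P (t m) by [].
      by apply: filterS h => m; apply; rewrite gt_eqF.
    have := cvg_comp _ _ ct cv; rewrite (_ : _ \o _ = fun m => F m x)//.
    by apply/funext => m; rewrite /F /GRing.scale /= [x + _]addrC.
  - have mB := @measurable_norm_le R n (r + 1).
    rewrite (_ : (fun x => _) = (fun=> M%:E) \_ [set x | `|x| <= r + 1]).
      by apply: (integrable_mkcond _ mB).1; exact: integrable_ball_cst.
    apply/funext => x; rewrite patchE indicE.
    by case: ifPn => _; rewrite ?mulr1 ?mulr0.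
  - by apply: aeW => x m _; rewrite abse_EFin lee_fin; exact: bF.
rewrite (_ : (fun m => _) = fun=> 0%E); last by apply/funext => m; exact: iF.
move=> /(cvg_unique _ (cvg_cst _)) => /(_ (@ereal_hausdorff R)) e0.
by rewrite /Rintegral -e0.
Qed.

Lemma test_fun_pderiv (R : realType) (n : nat) (U : set 'rV[R]_n) phi i :
  test_fun U phi -> test_fun U (pderiv i phi).
Proof.
move=> [sp cp hp].
have h : closure [set x | pderiv i phi x != 0] `<=` closure [set x | phi x !=
  0].
  rewrite [X in _ `<=` X](closure_id _).1; last exact: closed_closure.
  apply: closure_subset => x /=; apply: contraNP => hx.
  apply/eqP/pderiv_near0.
  have : nbhs x (~` closure [set x | phi x != 0]).
    by apply: open_nbhs_nbhs; split => //; apply: closed_openC;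
      exact: closed_closure.
  apply: filterS => y hy; apply/eqP; apply: contra_notT hy => hy.
  exact: subset_closure.
split; first exact: smooth_pderiv.
  apply: (subclosed_compact _ cp) => //; exact: closed_closure.
exact: subset_trans hp.
Qed.

Lemma test_fun_out (R : realType) (n : nat) (U : set 'rV[R]_n) phi x :
  test_fun U phi -> ~ U x -> phi x = 0.
Proof.
move=> [_ _ hp] Ux; apply/eqP; apply: contra_notT Ux => h; apply: hp.
exact: subset_closure.
Qed.

Lemma ip_test (R : realType) (n : nat) (U : set 'rV[R]_n) g phi :
  test_fun U phi -> ip U g phi = \int[leb R n]_x (g x * phi x).
Proof.
move=> tp; rewrite /ip Rintegral_mkcond; apply: eq_Rintegral => x _.
rewrite patchE; case: ifPn => // /negP h;
  rewrite (test_fun_out tp) ?mulr0// => Ux.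
by apply: h; rewrite inE.
Qed.

Lemma smoothM (R : realType) (n : nat) (f g : 'rV[R]_n -> R) :
  smooth f -> smooth g -> smooth (fun x => f x * g x).
Proof.
by move=> /smooth_ckP sf /smooth_ckP sg; apply/smooth_ckP => k; exact: ckM.
Qed.

(** The product f phi has compact support, so its derivative integrates to 0. *)
Lemma integration_by_parts (R : realType) (n : nat) (U : set 'rV[R]_n) f phi i :
  smooth f -> test_fun U phi ->
  ip U f (pderiv i phi) = - ip U (pderiv i f) phi.
Proof.
move=> sf tp; have tdp := test_fun_pderiv i tp.
rewrite !(ip_test _ tp) !(ip_test _ tdp).
have [sp _ _] := tp; have sdp := smooth_pderiv i sp;
  have sdf := smooth_pderiv i sf.
have [r r0 vp] := test_fun_vanish tp.
have v1 : vanish r (fun x => f x * phi x) by move=> x h; rewrite vp ?mulr0.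
have v2 : vanish r (fun x => f x * pderiv i phi x).
  by move=> x h; rewrite (vanish_pderiv i vp h) mulr0.
have v3 : vanish r (fun x => pderiv i f x * phi x) by move=> x h;
  rewrite vp ?mulr0.
have := integral_pderiv_eq0 i (smoothM sf sp) v1.
rewrite (_ : pderiv i _ = fun x => pderiv i f x * phi x + f x * pderiv i phi
  x); last first.
  by apply/funext => x; apply: pderivM; exact: smooth_diff.
rewrite RintegralD//.
- by move/eqP; rewrite addrC addr_eq0 => /eqP.
- by apply: (vanish_integrable _ v3); apply: smooth_continuous; exact: smoothM.
- by apply: (vanish_integrable _ v2); apply: smooth_continuous; exact: smoothM.
Qed.

Lemma mderiv_axis (R : realType) (n : nat) (i : 'I_n) (k : nat) (f : 'rV[R]_n
  -> R) :
  mderiv (fun l => if l == i then k else 0%N) f = iter k (pderiv i) f.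
Proof.
rewrite /mderiv.
have : forall s : seq 'I_n, uniq s ->
  foldr (fun l g => iter (if l == i then k else 0%N) (pderiv l) g) f s =
  if i \in s then iter k (pderiv i) f else f.
  elim=> //= l s IH /andP[ls us]; rewrite in_cons (eq_sym i) IH//.
  by case: eqVneq => [<-|] //=; rewrite (negbTE ls).
by move=> ->; rewrite ?enum_uniq// mem_enum.
Qed.

Lemma mderiv0 (R : realType) (n : nat) (f : 'rV[R]_n -> R) :
  mderiv (fun=> 0%N) f = f.
Proof. by rewrite /mderiv; elim: (enum 'I_n). Qed.

Lemma mi_size_axis (n : nat) (i : 'I_n) (k : nat) :
  mi_size (fun l : 'I_n => if l == i then k else 0%N) = k.
Proof. by rewrite /mi_size -big_mkcond big_pred1_eq. Qed.

Lemma is_wderiv_axis (R : realType) (n : nat) (U : set 'rV[R]_n) (i : 'I_n) k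
  (f : 'rV[R]_n -> R) : open U -> bounded_set U -> smooth f ->
  is_wderiv U (fun l => if l == i then k else 0%N) f (iter k (pderiv i) f).
Proof.
move=> oU bU sf; have siter j : smooth (iter j (pderiv i) f).
  by elim: j => //= j; exact: smooth_pderiv.
split; first exact: smooth_L2.
move=> phi tp; rewrite mi_size_axis mderiv_axis.
elim: k phi tp => [|k IH] phi tp; first by rewrite expr0 mul1r.
rewrite iterSr IH; last exact: test_fun_pderiv.
by rewrite integration_by_parts// exprS mulN1r mulrN mulNr.
Qed.

Lemma mi_size_le1 (n : nat) (a : {ffun 'I_n -> 'I_2}) :
  (mi_size (fun i => a i) <= 1)%N ->
  (fun i => a i : nat) = (fun=> 0%N) \/
  exists i, (fun l => a l : nat) = fun l => if l == i then 1%N else 0%N.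
Proof.
move=> h; have [a0|] := pselect (forall i, a i = 0%N :> nat).
  by left; apply/funext.
move=> /existsNP[i /eqP ai]; right; exists i; apply/funext => l.
move: h; rewrite /mi_size (bigD1 i)//=.
case: eqVneq => [->|li].
  by case: (a i : nat) ai => [|[|k]].
rewrite (bigD1 l)//=; move: ai; rewrite -lt0n.
by move: (\sum_(_ < _ | _) _)%N => s; lia.
Qed.

(** Without this, the H^1 norm of u - phi could be computed from junk values
    of [wderiv], and the closure defining [H10] would not be a subspace. *)
Lemma test_fun_Hm1 (R : realType) (n : nat) (U : set 'rV[R]_n) phi :
  open U -> bounded_set U -> test_fun U phi -> Hm U 1 phi.
Proof.
move=> oU bU tp; have [sp _ _] := tp; split; first exact: test_L2.
move=> a /mi_size_le1[->|[i ->]]; last by eexists; exact: is_wderiv_axis.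
exists phi; split; first exact: test_L2.
move=> psi tpsi; rewrite mderiv0 /mi_size big1// expr0 mul1r//.
Qed.

Lemma test_fun_lin (R : realType) (n : nat) (U : set 'rV[R]_n) phi psi c :
  test_fun U phi -> test_fun U psi -> test_fun U (fun x => phi x + c * psi x).
Proof.
move=> [sp cp hp] [sq cq hq].
have h : closure [set x | phi x + c * psi x != 0] `<=`
   closure [set x | phi x != 0] `|` closure [set x | psi x != 0].
  rewrite -closureU; apply: closure_subset => x /=; apply: contraNP.
  by move=> /not_orP[/negP/negPn/eqP -> /negP/negPn/eqP ->];
    rewrite mulr0 addr0.
split; first exact: smooth_lin.
  apply: (subclosed_compact _ (compactU cp cq)) => //; exact: closed_closure.
by move=> x /h[/hp|/hq].
Qed.

Lemma H10_lin (R : realType) (n : nat) (U : set 'rV[R]_n) u v c :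
  open U -> bounded_set U -> H10 U u -> H10 U v ->
    H10 U (fun x => u x + c * v x).
Proof.
move=> oU bU [hu au] [hv av]; split; first exact: Hm_lin.
move=> e e0; have e2 : 0 < e / 2 by rewrite divr_gt0.
have c1 : 0 < `|c| + 1 by rewrite ltr_wpDl.
have [phi [tphi dphi]] := au _ e2.
have [psi [tpsi dpsi]] := av (e / 2 / (`|c| + 1)) (divr_gt0 e2 c1).
(* The tolerance e / 2 is divided by |c| + 1, as c may be 0. *)
exists (fun x => phi x + c * psi x); split; first exact: test_fun_lin.
have hphi := test_fun_Hm1 oU bU tphi; have hpsi := test_fun_Hm1 oU bU tpsi.
have hu' : Hm U 1 (fun x => u x - phi x).
  by under eq_fun do rewrite -mulN1r; exact: Hm_lin.
have hv' : Hm U 1 (fun x => v x - psi x).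
  by under eq_fun do rewrite -mulN1r; exact: Hm_lin.
have -> : (fun x => u x + c * v x - (phi x + c * psi x)) =
    fun x => (u x - phi x) + c * (v x - psi x).
  by apply/funext => x; ring.
apply: le_lt_trans (Hmnorm_lin oU bU c hu' hv') _.
rewrite [ltRHS]splitr ltr_leD//.
apply: (@le_trans _ _ (`|c| * (e / 2 / (`|c| + 1)))).
  by rewrite ler_wpM2l// ltW.
by rewrite mulrA ler_pdivrMr// mulrC ler_wpM2l ?ltW// ltrDl.
Qed.

(** * Linear functionals on finite-dimensional function spaces *)

Section finite_dimension.
Variables (R : fieldType) (T : Type).
Variables (V : set (T -> R)) (Z : (T -> R) -> Prop).
Hypothesis V0 : V (fun=> 0).
Hypothesis V_lin : forall f g c, V f -> V g -> V (fun x => f x + c * g x).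
Hypothesis Z_scale : forall f c, Z f -> Z (fun x => c * f x).

Definition lincomb N (v : 'I_N -> T -> R) (c : 'rV[R]_N) : T -> R :=
  fun x => \sum_i c 0 i * v i x.

Definition linear_on (l : (T -> R) -> R) :=
  forall f g c, V f -> V g -> l (fun x => f x + c * g x) = l f + c * l g.

Lemma lincomb_in_lin N (v : 'I_N -> T -> R) (c : 'rV[R]_N) :
  (forall i, V (v i)) ->
  V (lincomb v c) /\
  forall l, linear_on l -> l (lincomb v c) = \sum_i c 0 i * l (v i).
Proof.
move=> hv; rewrite /lincomb.
elim: (index_enum _) => [|i s [IHV IHl]].
  under eq_fun do rewrite big_nil; split => // l hl.
  have := hl (fun=> 0) (fun=> 0) 1 V0 V0; under eq_fun do rewrite mulr0 addr0.
  by rewrite big_nil mul1r => /eqP; rewrite -subr_eq subrr eq_sym => /eqP.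
under eq_fun do rewrite big_cons addrC; split; first exact: V_lin.
by move=> l hl; rewrite hl// IHl// big_cons addrC.
Qed.

(** Independence modulo Z, which stands for the functions vanishing almost
    everywhere and spares the quotient space. *)
Definition independent N (v : 'I_N -> T -> R) :=
  (forall i, V (v i)) /\ forall c : 'rV[R]_N, Z (lincomb v c) -> c = 0.

Variable D : nat.
Hypothesis dim_le : forall N (v : 'I_N -> T -> R), independent v -> (N <= D)%N.

(** In a maximal independent family, adjoining one more w in V creates a
    relation, and the coefficient of w in it cannot be 0. *)
Lemma exists_basis : exists N (v : 'I_N -> T -> R), independent v /\
  forall w, V w -> exists c : 'rV[R]_N, Z (fun x => w x - lincomb v c x).
Proof.
pose P N := `[< exists v : 'I_N -> T -> R, independent v >].
have P0 : exists N, P N.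
  exists 0%N; apply/asboolP; exists (fun=> fun=> 0); split; first by case.
  by move=> c _; exact: thinmx0.
have PD N : P N -> (N <= D)%N by move=> /asboolP[v /dim_le].
case: (ex_maxnP P0 PD) => N /asboolP[v iv] Nmax.
exists N, v; split => // w Vw; apply: contrapT => /forallNP hw.
suff /Nmax : P N.+1 by rewrite ltnn.
apply/asboolP.
(* The family v with w adjoined in position 0. *)
pose w1 (i : 'I_(1 + N)) : T -> R :=
  match fintype.split i with inl _ => w | inr j => v j end.
suff iw : @independent (1 + N) w1 by exists w1.
split.
  by move=> i; rewrite /w1; case: fintype.split => // j; exact: iv.1.
move=> c; have lE x : lincomb w1 c x = c 0 (lshift N (0 : 'I_1)) * w x +
    lincomb v (rsubmx c) x.
  rewrite /lincomb (@big_split_ord _ _ _ 1 N) /= big_ord_recl big_ord0 addr0.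
  congr (_ * _ + _); first by rewrite /w1 -[lshift N _]/(unsplit (inl (0 :
    'I_1))) unsplitK.
  apply: eq_bigr => i _; rewrite mxE; congr (_ * _).
  by rewrite /w1 -[rshift 1 i]/(unsplit (inr i)) unsplitK.
have [c0|c0] := eqVneq (c 0 (lshift N (0 : 'I_1))) 0.
  rewrite (_ : lincomb w1 c = lincomb v (rsubmx c)); last first.
    by apply/funext => x; rewrite lE c0 mul0r add0r.
  move=> /iv.2 r0; apply/rowP => i; rewrite !mxE.
  rewrite -(splitK i); case: fintype.split => j /=; first by rewrite ord1.
  by have /rowP/(_ j) := r0; rewrite !mxE.
move=> /(@Z_scale _ (c 0 (lshift N (0 : 'I_1)))^-1) Zc; exfalso.
apply: (hw (- (c 0 (lshift N (0 : 'I_1)))^-1 *: rsubmx c)).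
rewrite (_ : (fun x => _) = fun x => (c 0 (lshift N (0 : 'I_1)))^-1 * lincomb
  w1 c x)//.
apply/funext => x; rewrite lE mulrDr mulKf//; congr (_ + _).
rewrite /lincomb mulr_sumr -sumrN; apply: eq_bigr => i _.
by rewrite !mxE; ring.
Qed.

(** In a basis b becomes a square matrix. Non-degeneracy makes its left kernel
    trivial, hence the matrix is invertible: uniqueness for one argument gives
    solvability. *)
Lemma bilinear_representation (b : (T -> R) -> (T -> R) -> R)
  (l : (T -> R) -> R) :
  (forall v, V v -> linear_on (b^~ v)) -> (forall w, V w -> linear_on (b w)) ->
  linear_on l ->
  (forall w v, V w -> V v -> Z w -> b w v = 0) ->
  (forall w, V w -> Z w -> l w = 0) ->
  (forall v, V v -> (forall w, V w -> b w v = 0) -> Z v) ->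
  exists2 v, V v & forall w, V w -> b w v = l w.
Proof.
move=> bl br ll bZ lZ bnd.
have [N [v [[Vv iv] hv]]] := exists_basis.
pose M : 'M[R]_N := \matrix_(i, j) b (v j) (v i).
have VL c : V (lincomb v c) := (lincomb_in_lin c Vv).1.
have LL c := (lincomb_in_lin c Vv).2.
(* A functional that vanishes on Z is determined by its values on the basis. *)
have det (l1 l2 : (T -> R) -> R) : linear_on l1 -> linear_on l2 ->
    (forall w, V w -> Z w -> l1 w = 0) -> (forall w, V w -> Z w -> l2 w = 0) ->
    (forall i, l1 (v i) = l2 (v i)) -> forall w, V w -> l1 w = l2 w.
  move=> h1 h2 z1 z2 e w Vw; have [c Zc] := hv w Vw.
  have Vd : V (fun x => w x - lincomb v c x).
    by under eq_fun do rewrite -mulN1r; exact: V_lin.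
  have wE : w = fun x => (w x - lincomb v c x) + 1 * lincomb v c x.
    by apply/funext => x; rewrite mul1r subrK.
  rewrite wE h1// h2// z1// z2// !LL//.
  by congr (_ + _ * _); apply: eq_bigr => i _; rewrite e.
have mE c j : (c *m M) 0 j = b (v j) (lincomb v c).
  by rewrite (LL c _ (br _ (Vv j))) mxE; apply: eq_bigr => i _; rewrite mxE.
have uM : M \in unitmx.
  rewrite -row_free_unit -kermx_eq0; apply/rowV0P => c /sub_kermxP cM.
  apply: iv; apply: bnd => // w Vw.
  apply: (det (b^~ (lincomb v c)) (fun=> 0)) => //.
  - exact: bl.
  - by move=> f g a _ _; rewrite mulr0 addr0.
  - by move=> z Vz Zz; exact: bZ.
  - by move=> i; rewrite -mE cM mxE.
exists (lincomb v ((\row_j l (v j)) *m invmx M)) => //.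
apply: det => //; first exact: bl.
- by move=> z Vz Zz; exact: bZ.
- by move=> i; rewrite -mE mulmxKV// mxE.
Qed.

End finite_dimension.

(** * The finite element space *)

Lemma is_poly_on_lin (R : realType) (n k : nat) (T : set 'rV[R]_n) u v c :
  is_poly_on k T u -> is_poly_on k T v ->
    is_poly_on k T (fun x => u x + c * v x).
Proof.
move=> [cu hu] [cv hv]; exists (fun a => cu a + c * cv a) => x Tx.
rewrite hu// hv// mulr_sumr -big_split /=; apply: eq_bigr => a _.
by rewrite mulrDl mulrA.
Qed.

Lemma within_continuous_lin (R : realType) (n : nat) (K : set 'rV[R]_n)
  (u v : 'rV[R]_n -> R) c :
  {within K, continuous u} -> {within K, continuous v} ->
  {within K, continuous (fun x => u x + c * v x)}.
Proof.
move=> cu cv x; apply: (continuousD (f := u : subspace K -> R));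
  first exact: cu.
apply: (continuousM (s := fun=> c) (t := v : subspace K -> R)); last exact: cv.
exact: cst_continuous.
Qed.

Lemma C1_closure_lin (R : realType) (n : nat) (U : set 'rV[R]_n) u v c :
  C1_closure U u -> C1_closure U v -> C1_closure U (fun x => u x + c * v x).
Proof.
move=> [cu du gu] [cv dv gv]; split.
- exact: within_continuous_lin.
- move=> x Ux; apply: differentiableD; first exact: du.
  by apply: differentiableZ; exact: dv.
move=> i; have [g [cg eg]] := gu i; have [h [ch eh]] := gv i.
exists (fun x => g x + c * h x); split; first exact: within_continuous_lin.
move=> x Ux; rewrite pderivD; [|exact: du|by apply: differentiableZ; exact: dv].
by rewrite pderivZ ?eg ?eh//; exact: dv.
Qed.

Lemma fe_space_lin (R : realType) (n : nat) (U : set 'rV[R]_n) k Th u v c :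
  open U -> bounded_set U ->
  fe_space U k Th u -> fe_space U k Th v ->
    fe_space U k Th (fun x => u x + c * v x).
Proof.
move=> oU bU [cu hu pu] [cv hv pv]; split.
- exact: C1_closure_lin.
- exact: H10_lin.
- by move=> T hT; apply: is_poly_on_lin; [exact: pu|exact: pv].
Qed.

Lemma fe_space0 (R : realType) (n : nat) (U : set 'rV[R]_n) k Th u :
  open U -> bounded_set U -> fe_space U k Th u -> fe_space U k Th (fun=> 0).
Proof.
move=> oU bU fu; have := fe_space_lin (-1) oU bU fu fu.
by under eq_fun do rewrite mulN1r subrr.
Qed.

Lemma matrix_left_kernel (F : fieldType) (N D : nat) (A : 'M[F]_(N, D)) :
  (D < N)%N -> exists2 c : 'rV_N, c != 0 & c *m A = 0.
Proof.
move=> DN; have /rowV0Pn[c /sub_kermxP cA c0] : kermx A != 0.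
  rewrite kermx_eq0 /row_free neq_ltn (leq_ltn_trans (rank_leq_col A))//.
by exists c.
Qed.

(** A piecewise polynomial is determined by its finitely many coefficients,
    so more functions than coefficients are linearly dependent. *)
Lemma fe_space_dim (R : realType) (n : nat) (U : set 'rV[R]_n) k Th :
  finite_set Th -> exists D, forall N (v : 'I_N -> 'rV[R]_n -> R),
  (forall i, fe_space U k Th (v i)) -> (D < N)%N ->
  exists2 c : 'rV_N, c != 0 & forall T, Th T -> forall x, T x ->
    lincomb v c x = 0.
Proof.
move=> /finite_seqP[s sE]; pose I := {ffun 'I_n -> 'I_k.+1}.
exists (size s * #|I|)%N => N v fv DN.
have /choice[co hco] (p : 'I_N * 'I_(size s)) : exists c : I -> R,
    forall x, nth set0 s p.2 x -> v p.1 x =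
    \sum_(a : I | (mi_size (fun i => a i) <= k)%N) c a * \prod_i x 0 i ^+ a i.
  have [_ _] := fv p.1; apply; rewrite sE /=; exact: mem_nth.
pose A := \matrix_(i < N) mxvec (\matrix_(t < size s, j < #|I|) co (i,
  t) (enum_val j)).
have [c c0 cA] := matrix_left_kernel A DN.
exists c => // T; rewrite sE /= => Ts x Tx.
have ts : (index T s < size s)%N by rewrite index_mem.
pose t := Ordinal ts.
have Tx' : nth set0 s t x by rewrite /= nth_index.
rewrite /lincomb; under eq_bigr do rewrite (hco (_, t) x Tx') mulr_sumr.
rewrite exchange_big big1// => a _.
have /rowP/(_ (mxvec_index t (enum_rank a))) := cA; rewrite !mxE => e.
under eq_bigr do rewrite mulrA;
  rewrite -mulr_suml (_ : \sum_(_ < _) _ = 0) ?mul0r//.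
rewrite -[RHS]e; apply: eq_bigr => i _; congr (_ * _).
by rewrite mxE mxvecE mxE enum_rankK.
Qed.

(** * The bilinear form *)

(** The multi-index of D_i D_j, in the finite-function form used by [Hmnorm]. *)
Definition second_idx (n : nat) (i j : 'I_n) : {ffun 'I_n -> 'I_3} :=
  [ffun l => inord ((l == i) + (l == j))].

Lemma second_idxE (n : nat) (i j : 'I_n) :
  (fun l => second_idx i j l : nat) = fun l => ((l == i) + (l == j))%N.
Proof.
by apply/funext => l; rewrite ffunE inordK//; case: (l == i); case: (l == j).
Qed.

Lemma mi_size_second_idx (n : nat) (i j : 'I_n) :
  (mi_size (fun l => second_idx i j l) <= 2)%N.
Proof.
have sum1 (m : 'I_n) : (\sum_(l < n) (l == m) = 1)%N.
  by rewrite (bigD1 m)//= eqxx big1// => l /negbTE ->.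
by rewrite second_idxE /mi_size big_split /= !sum1.
Qed.

Lemma sub_linear_combination (F : comNzRingType) (e c a a1 a2 b b1 b2 : F) :
  a = a1 + c * a2 -> b = b1 + c * b2 ->
  e * a - b = (e * a1 - b1) + c * (e * a2 - b2).
Proof. by move=> -> ->; ring. Qed.

Section bilinear_form.
Variables (R : realType) (n : nat) (Omega : set 'rV[R]_n).
Hypothesis oO : open Omega.
Hypothesis bO : bounded_set Omega.
Variable A : 'rV[R]_n -> 'M[R]_n.
Hypothesis cA : {within closure Omega, continuous A}.

Local Notation L2 := (L2 Omega).
Local Notation ip := (ip Omega).
Local Notation H2 := (Hm Omega 2).
Let mO : measurable Omega := measurable_open_rV oO.

Lemma L2_sum (I : Type) (s : seq I) (F : I -> 'rV[R]_n -> R) :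
  (forall i, L2 (F i)) -> L2 (fun x => \sum_(i <- s) F i x).
Proof.
move=> hF; elim: s => [|i s IH].
  under eq_fun do rewrite big_nil.
  by apply: smooth_L2 => //; apply/smooth_ckP => k; exact: ck_cst.
under eq_fun do rewrite big_cons addrC -[F i _]mul1r.
exact: L2_lin.
Qed.

Lemma ip_suml (I : Type) (s : seq I) (F : I -> 'rV[R]_n -> R) h :
  (forall i, L2 (F i)) -> L2 h ->
  ip (fun x => \sum_(i <- s) F i x) h = \sum_(i <- s) ip (F i) h.
Proof.
move=> hF lh; elim: s => [|i s IH].
  under eq_fun do rewrite big_nil.
  rewrite big_nil /ip; under eq_Rintegral do rewrite mul0r.
  by rewrite Rintegral_cst// mul0r.
under eq_fun do rewrite big_cons addrC -[F i _]mul1r.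
by rewrite (ip_linl mO _ (L2_sum s hF) (hF i) lh) IH big_cons mul1r addrC.
Qed.

Lemma wD2_L2 i j u : H2 u -> L2 (wD2 Omega i j u).
Proof.
move=> hu; rewrite /wD2 -second_idxE.
exact: (Hm_wderiv_L2 hu (mi_size_second_idx i j)).
Qed.

Lemma L2norm_wD2_le i j u : L2norm Omega (wD2 Omega i j u) <= Hmnorm Omega 2 u.
Proof.
by rewrite /wD2 -second_idxE; exact: L2norm_wderiv_le (mi_size_second_idx i j).
Qed.

Lemma ip_wD2_lin i j u v c h : H2 u -> H2 v -> L2 h ->
  ip (wD2 Omega i j (fun x => u x + c * v x)) h =
  ip (wD2 Omega i j u) h + c * ip (wD2 Omega i j v) h.
Proof.
move=> hu hv lh.
rewrite -(ip_linl mO c (wD2_L2 i j hu) (wD2_L2 i j hv) lh).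
apply: (ip_ae_eq mO _ _ lh).
- exact: (wD2_L2 i j (Hm_lin oO bO c hu hv)).
- exact: (L2_lin mO c (wD2_L2 i j hu) (wD2_L2 i j hv)).
by rewrite /wD2 -second_idxE; exact: (wderiv_lin oO bO c hu hv
  (mi_size_second_idx i j)).
Qed.

Lemma laplacian_L2 u : H2 u -> L2 (laplacian Omega u).
Proof. by move=> hu; apply: L2_sum => i; exact: wD2_L2. Qed.

Let cAij i j : {within closure Omega, continuous (fun x => A x i j)}.
Proof.
move=> x; apply: (@continuous_comp (subspace (closure Omega)) _ _ A (fun M :
  'M[R]_n => M i j)).
  exact: cA.
exact: coord_continuous.
Qed.

Lemma coef_bounded : exists2 M, 0 <= M &
  forall i j x, closure Omega x -> `|A x i j| <= M.
Proof.
have /choice[M hM] (p : 'I_n * 'I_n) : exists M, forall x, closure Omega x ->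
  `|A x p.1 p.2| <= M.
  by apply: continuous_closure_bounded => //; exact: cAij.
exists (\sum_p `|M p|); first exact: sumr_ge0.
move=> i j x cx; apply: le_trans (hM (i, j) x cx) _.
by rewrite (bigD1 (i, j))//= (le_trans (ler_norm _))// lerDl sumr_ge0.
Qed.

Lemma L2_mul_bounded (a f : 'rV[R]_n -> R) M :
  measurable_fun Omega (a : 'rV[R]_n -> measurableTypeR R) ->
  0 <= M -> (forall x, Omega x -> `|a x| <= M) -> L2 f ->
  L2 (fun x => a x * f x) /\
  L2norm Omega (fun x => a x * f x) <= M * L2norm Omega f.
Proof.
move=> ma M0 hM lf.
have iM : (leb R n).-integrable Omega (fun x => ((M ^+ 2)%:E * (f x ^+
  2)%:E)%E).
  by apply: integrableZl => //; exact: L2_sqr_integrable.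
have maf : measurable_fun Omega ((fun x => a x * f x) : 'rV[R]_n ->
  measurableTypeR R).
  exact: (measurable_funM ma lf.1).
have le x : Omega x -> (a x * f x) ^+ 2 <= M ^+ 2 * f x ^+ 2.
  move=> Ox; rewrite exprMn ler_wpM2r ?sqr_ge0// -real_normK ?num_real//.
  by rewrite lerXn2r ?nnegrE//; exact: hM.
have le' : (\int[leb R n]_(x in Omega) ((a x * f x) ^+ 2)%:E <=
    \int[leb R n]_(x in Omega) ((M ^+ 2)%:E * (f x ^+ 2)%:E))%E.
  apply: ge0_le_integral => //.
  - by move=> x _; rewrite lee_fin sqr_ge0.
  - by apply/measurable_EFinP; exact: measurable_funX.
  - exact: measurable_int iM.
have laf : L2 (fun x => a x * f x).
  split => //; apply: le_lt_trans le' _.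
  rewrite ge0_integralZl//; last 3 first.
  - by apply: measurable_int (L2_sqr_integrable lf).
  - by move=> x _; rewrite lee_fin sqr_ge0.
  - by rewrite lee_fin sqr_ge0.
  by apply: lte_mul_pinfty; rewrite ?lee_fin ?sqr_ge0//; exact: lf.2.
split => //; rewrite /L2norm -[leRHS]ger0_norm ?mulr_ge0 ?sqrtr_ge0//.
rewrite -sqrtr_sqr ler_wsqrtr// exprMn sqr_sqrtr ?ip_ge0// /Defs.ip.
rewrite -RintegralZl//; last exact: L2_mul_integrable.
by apply: le_Rintegral => //; exact: L2_mul_integrable.
Qed.

Let mAij i j : measurable_fun Omega ((fun x => A x i j) : 'rV[R]_n ->
  measurableTypeR R).
Proof. by have [] := continuous_L2 oO bO (@cAij i j). Qed.

Lemma coef_mul_L2 i j f : L2 f -> L2 (fun x => A x i j * f x).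
Proof.
move=> lf; have [M M0 hM] := coef_bounded.
apply: (L2_mul_bounded (@mAij i j) M0 _ lf).1 => x Ox; apply: hM.
exact: subset_closure.
Qed.

(** The Laplacian and A : D^2 u are linear in u only up to null sets. Expanding
    the form into pairings of single second derivatives makes linearity and
    boundedness a matter of each term. *)
Lemma bformE eps u v : H2 u -> H2 v -> bform Omega A eps u v =
  eps * \sum_i \sum_l ip (wD2 Omega i i u) (wD2 Omega l l v) -
  \sum_i \sum_j ip (wD2 Omega i j u) (fun x => A x i j * v x).
Proof.
move=> hu hv; rewrite /bform; congr (_ * _ - _).
  rewrite /laplacian ip_suml; [|by move=> i; exact: wD2_L2|exact: laplacian_L2].
  apply: eq_bigr => i _; rewrite ipC ip_suml; [|by move=> l;
    exact: wD2_L2|exact: wD2_L2].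
  by apply: eq_bigr => l _; exact: ipC.
rewrite /AD2 ip_suml; last exact: Hm_L2 hv.
  apply: eq_bigr => i _; rewrite ip_suml; last exact: Hm_L2 hv.
    by apply: eq_bigr => j _; apply: eq_Rintegral => x _; rewrite mulrAC mulrC.
  by move=> j; apply: coef_mul_L2; exact: wD2_L2.
by move=> i; apply: L2_sum => j; apply: coef_mul_L2; exact: wD2_L2.
Qed.

Lemma bform_linl eps u v w c : H2 u -> H2 v -> H2 w ->
  bform Omega A eps (fun x => u x + c * v x) w =
  bform Omega A eps u w + c * bform Omega A eps v w.
Proof.
move=> hu hv hw; have huv := Hm_lin oO bO c hu hv.
rewrite (bformE eps huv hw) (bformE eps hu hw) (bformE eps hv hw).
apply: sub_linear_combination.
  rewrite mulr_sumr -big_split; apply: eq_bigr => i _.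
  rewrite mulr_sumr -big_split; apply: eq_bigr => l _.
  exact: (ip_wD2_lin i i c hu hv (wD2_L2 l l hw)).
rewrite mulr_sumr -big_split; apply: eq_bigr => i _.
rewrite mulr_sumr -big_split; apply: eq_bigr => j _.
exact: (ip_wD2_lin i j c hu hv (coef_mul_L2 i j (Hm_L2 hw))).
Qed.

Lemma bform_linr eps u v w c : H2 u -> H2 v -> H2 w ->
  bform Omega A eps w (fun x => u x + c * v x) =
  bform Omega A eps w u + c * bform Omega A eps w v.
Proof.
move=> hu hv hw; have huv := Hm_lin oO bO c hu hv.
rewrite (bformE eps hw huv) (bformE eps hw hu) (bformE eps hw hv).
apply: sub_linear_combination.
  rewrite mulr_sumr -big_split; apply: eq_bigr => i _.
  rewrite mulr_sumr -big_split; apply: eq_bigr => l _.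
  rewrite ipC (ip_wD2_lin l l c hu hv (wD2_L2 i i hw)).
  apply: (congr2 (fun p q => p + c * q)); exact: ipC.
rewrite mulr_sumr -big_split; apply: eq_bigr => i _.
rewrite mulr_sumr -big_split; apply: eq_bigr => j _.
have lu := coef_mul_L2 i j (Hm_L2 hu); have lv := coef_mul_L2 i j (Hm_L2 hv).
apply: etrans _ (ip_linr mO c lu lv (wD2_L2 i j hw)).
by apply: eq_Rintegral => x _; congr (_ * _); rewrite mulrDr mulrCA.
Qed.

Lemma ip_ae0 f h : L2 f -> L2 h ->
  {ae leb R n, forall x, Omega x -> f x = 0} -> ip f h = 0.
Proof.
move=> lf lh f0; have l0 : L2 (fun=> 0).
  by apply: smooth_L2 => //; apply/smooth_ckP => k; exact: ck_cst.
rewrite (ip_ae_eq mO lf l0 lh f0) /Defs.ip.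
by under eq_Rintegral do rewrite mul0r; rewrite Rintegral_cst// mul0r.
Qed.

Lemma bform_null eps w v : H2 w -> H2 v -> L2norm Omega w = 0 ->
  bform Omega A eps w v = 0.
Proof.
move=> hw hv w0; rewrite (bformE eps hw hv).
have w2 i j h : L2 h -> ip (wD2 Omega i j w) h = 0.
  move=> lh; apply: (ip_ae0 (wD2_L2 i j hw) lh); rewrite /wD2 -second_idxE.
  exact: (wderiv_null oO bO hw (mi_size_second_idx i j) w0).
rewrite big1 ?mulr0 ?sub0r ?big1 ?oppr0//.
  by move=> i _; rewrite big1// => j _; apply: w2; apply: coef_mul_L2;
    exact: Hm_L2 hv.
by move=> i _; rewrite big1// => l _; apply: w2; exact: wD2_L2.
Qed.

Lemma hip_null m w v : Hm Omega m w -> Hm Omega m v -> L2norm Omega w = 0 ->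
  hip Omega m w v = 0.
Proof.
move=> hw hv w0; rewrite /hip big1// => a ha.
apply: (ip_ae0 (Hm_wderiv_L2 hw ha) (Hm_wderiv_L2 hv ha)).
exact: (wderiv_null oO bO hw ha w0).
Qed.

(** Second derivatives of v appear only with the factor eps; the other term
    costs no more than the L^2 norm of v. *)
Lemma bform_bound : exists2 M, 0 <= M & forall eps u v K, 0 <= eps ->
  H2 u -> H2 v -> (forall l, L2norm Omega (wD2 Omega l l v) <= K) ->
  `|bform Omega A eps u v| <=
    (eps * (n%:R ^+ 2 * K) + n%:R ^+ 2 * M * L2norm Omega v) * Hmnorm Omega 2 u.
Proof.
have [M M0 hM] := coef_bounded; exists M => // eps u v K eps0 hu hv hK.
have N0 := Hmnorm_ge0 Omega 2 u.
have sum2 (F : 'I_n -> 'I_n -> R) B : (forall i j, `|F i j| <= B) ->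
    `|\sum_i \sum_j F i j| <= n%:R ^+ 2 * B.
  move=> hF; apply: le_trans (ler_norm_sum _ _ _) _.
  apply: (@le_trans _ _ (\sum_(i < n) n%:R * B)).
    apply: ler_sum => i _; apply: le_trans (ler_norm_sum _ _ _) _.
    apply: (@le_trans _ _ (\sum_(j < n) B)); first exact: ler_sum.
    by rewrite sumr_const card_ord mulr_natl.
  by rewrite sumr_const card_ord -[leLHS]mulr_natl mulrA expr2.
rewrite (bformE eps hu hv) mulrDl; apply: le_trans (ler_normB _ _) _.
move: (n%:R ^+ 2) sum2 => N2 sum2; apply: lerD.
  rewrite normrM ger0_norm// -!mulrA ler_wpM2l//.
  apply: (sum2 (fun i l => ip (wD2 Omega i i u) (wD2 Omega l l v))) => i l.
  apply: le_trans (ip_cs mO (wD2_L2 i i hu) (wD2_L2 l l hv)) _.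
  rewrite mulrC ler_pM ?sqrtr_ge0//; exact: L2norm_wD2_le.
rewrite -!mulrA.
apply: (sum2 (fun i j => ip (wD2 Omega i j u) (fun x => A x i j * v x))) => i j.
have [la lea] := L2_mul_bounded (@mAij i j) M0
  (fun x Ox => hM i j x (subset_closure Ox)) (Hm_L2 hv).
apply: le_trans (ip_cs mO (wD2_L2 i j hu) la) _.
rewrite mulrC mulrA ler_pM ?sqrtr_ge0//; exact: L2norm_wD2_le.
Qed.

End bilinear_form.

(** * Polynomials on a cube *)

Section tensor_polynomials.
Variables (R : realType) (n k : nat).
Local Notation I := {ffun 'I_n -> 'I_k.+1}.

Definition monom (f : I) (x : 'rV[R]_n) : R := \prod_i x 0 i ^+ f i.

(** Degree at most k in each variable, rather than in total: affine
    substitution and interpolation then factor over the coordinates. *)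
Definition tpoly (c : I -> R) (x : 'rV[R]_n) : R := \sum_f c f * monom f x.

Lemma smooth_monom f : smooth (monom f).
Proof.
apply/smooth_ckP => j; apply: ck_prod => i.
elim: (nat_of_ord (f i)) => [|m IH].
  by under eq_fun do rewrite expr0; exact: ck_cst.
by under eq_fun do rewrite exprS; apply: ckM => //; exact: ck_coord.
Qed.

Lemma smooth_tpoly c : smooth (tpoly c).
Proof.
apply/smooth_ckP => j; apply: ck_sum => f; apply: ckM; first exact: ck_cst.
by have /smooth_ckP := smooth_monom f; exact.
Qed.

Lemma pderiv_sum (J : Type) (s : seq J) (c : J -> R) (F : J -> 'rV[R]_n ->
  R) l :
  (forall f, smooth (F f)) ->
  pderiv l (fun x => \sum_(f <- s) c f * F f x) =
  fun x => \sum_(f <- s) c f * pderiv l (F f) x.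
Proof.
move=> sF; elim: s => [|f s IH].
  under eq_fun do rewrite big_nil; apply/funext => x.
  by rewrite big_nil pderiv_cst.
under eq_fun do rewrite big_cons addrC; rewrite pderiv_lin//; last first.
  apply/smooth_ckP => j; apply: ck_sum => g; apply: ckM; first exact: ck_cst.
  by have /smooth_ckP := sF g; exact.
by rewrite IH; apply/funext => x; rewrite big_cons addrC.
Qed.

(** The binomial expansions of (x0_i + d y_i)^m in the n coordinates,
    multiplied out. *)
Lemma tpoly_affine (x0 : 'rV[R]_n) (d : R) (c : I -> R) : 0 < d ->
  exists c' : I -> R, forall x, tpoly c x = tpoly c' (d^-1 *: (x - x0)).
Proof.
move=> d0.
(* Coefficient of y^j in (x0_i + d y)^m; it is 0 for j > m, so the sum may
   run over all j <= k. *)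
pose e (i : 'I_n) (m j : nat) : R := (x0 0 i ^+ (m - j) * d ^+ j) *+ 'C(m, j).
have eE i (m : 'I_k.+1) (y : R) : (x0 0 i + d * y) ^+ m = \sum_(j < k.+1) e i m
  j * y ^+ j.
  rewrite exprDn (big_ord_widen k.+1 (fun j => (x0 0 i ^+ (m - j) * (d * y) ^+
    j) *+ 'C(m, j)))//.
  rewrite big_mkcond; apply: eq_bigr => j _; rewrite /e exprMn.
  case: ifPn => [_|]; first by rewrite mulrA mulrnAl.
  by rewrite -leqNgt => mj; rewrite bin_small// mulr0n mul0r.
exists (fun g : I => \sum_f c f * \prod_i e i (f i) (g i)) => x.
rewrite /tpoly; under [RHS]eq_bigr do rewrite mulr_suml.
rewrite exchange_big; apply: eq_bigr => f _ /=.
under eq_bigr do rewrite -mulrA; rewrite -mulr_sumr; congr (_ * _).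
rewrite /monom; under [RHS]eq_bigr do rewrite -big_split.
rewrite -(bigA_distr_bigA (fun (i : 'I_n) (j : 'I_k.+1) => e i (f i) j * (d^-1
  *: (x - x0)) 0 i ^+ j)).
apply: eq_bigr => i _; rewrite -eE !mxE mulrA divff ?gt_eqF// mul1r.
by rewrite [x0 0 i + _]addrC subrK.
Qed.

(** Values on a tensor grid inside the cube determine the coefficients: weight
    them by products of entries of an inverse Vandermonde matrix. *)
Lemma tpoly_eq0 (r : R) (c : I -> R) : 0 < r ->
  (forall x, cube 0 r x -> tpoly c x = 0) -> forall f, c f = 0.
Proof.
move=> r0 h f.
(* k + 1 distinct points of ]0, r[. *)
pose t (m : 'I_k.+1) : R := r / m.+2%:R.
have t_inj : injective t.
  move=> a b /(mulfI (lt0r_neq0 r0))/invr_inj/eqP; rewrite eqr_nat => /eqP[];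
    exact: val_inj.
pose V : 'M[R]_k.+1 := \matrix_(i, j) t j ^+ i.
have uV : V \in unitmx.
  rewrite unitmxE (_ : V = Vandermonde k.+1 (\row_j t j)); last first.
    by apply/matrixP => i j; rewrite !mxE.
  rewrite det_Vandermonde unitfE; apply/prodf_neq0 => i _;
    apply/prodf_neq0 => j ij.
  rewrite !mxE subr_eq0; apply: contraTneq ij => /t_inj ->; by rewrite ltnn.
pose W := invmx V.
(* In each coordinate, the weights W single out one power of t. *)
have WE (a b : 'I_k.+1) : \sum_m t m ^+ a * W m b = (a == b)%:R.
  have /matrixP/(_ a b) := mulmxV uV; rewrite !mxE => <-.
  by apply: eq_bigr => m _; rewrite mxE.
have : \sum_(g : I) tpoly c (\row_i t (g i)) * \prod_i W (g i) (f i) = c f.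
  rewrite /tpoly; under eq_bigr do rewrite mulr_suml.
  rewrite exchange_big /= (bigD1 f)//= [X in _ + X]big1 ?addr0.
    under eq_bigr do rewrite -mulrA; rewrite -mulr_sumr -[RHS]mulr1;
      congr (_ * _).
    rewrite /monom; under eq_bigr do rewrite -big_split /=.
    under eq_bigr do under eq_bigr do rewrite mxE.
    rewrite -(bigA_distr_bigA (fun (i : 'I_n) (j : 'I_k.+1) => t j ^+ f i * W j
      (f i))) big1// => i _.
    by rewrite WE eqxx.
  move=> f' f'f.
  under eq_bigr do rewrite -mulrA; rewrite -mulr_sumr.
  rewrite /monom; under eq_bigr do rewrite -big_split /=.
  under eq_bigr do under eq_bigr do rewrite mxE.
  rewrite -(bigA_distr_bigA (fun (i : 'I_n) (j : 'I_k.+1) => t j ^+ f' i * W j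
    (f i))).
  have [i fi] : exists i, f' i != f i.
    apply/existsP; apply: contraNT f'f; rewrite negb_exists => /forallP hf.
    by apply/eqP/ffunP => i; have := hf i; rewrite negbK => /eqP.
  by rewrite (bigD1 i)//= WE (negbTE fi) mul0r mulr0.
move=> <-; apply: big1 => g _; rewrite h ?mul0r// => i.
rewrite !mxE subr0 ger0_norm ?divr_ge0 ?ltW//.
by rewrite ltr_pdivrMr// ltr_pMr// ltr1n.
Qed.

End tensor_polynomials.

Lemma open_cube (R : realType) (n : nat) (c : 'rV[R]_n) (r : R) :
  0 < r -> open (cube c r).
Proof.
move=> r0; rewrite (_ : cube c r = ball c r); first exact: ball_open.
apply/seteqP; split => x; rewrite -ball_normE /ball_ /=.
  by move/(cubeP _ _ r0); rewrite distrC.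
by rewrite distrC => h; apply/(cubeP _ _ r0).
Qed.

Lemma bounded_cube (R : realType) (n : nat) (c : 'rV[R]_n) (r : R) :
  0 < r -> bounded_set (cube c r).
Proof.
move=> r0; exists (`|c| + r); split; first exact: num_real.
move=> N hN x /(cubeP _ _ r0) h /=;
  rewrite -(subrK c x) (le_trans (ler_normD _ _))//.
by rewrite addrC (le_trans _ (ltW hN))// lerD2l ltW.
Qed.

(** A continuous f that does not vanish at x is nonzero on a small cube, and
    cubes have positive measure. *)
Lemma continuous_L2norm0 (R : realType) (n : nat) (U : set 'rV[R]_n) f :
  open U -> bounded_set U -> smooth f -> L2norm U f = 0 -> forall x, U x ->
    f x = 0.
Proof.
move=> oU bU sf f0; have mU := measurable_open_rV oU;
  have lf := smooth_L2 oU bU sf.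
have ae0 : {ae leb R n, forall x, U x -> f x = 0}.
  apply: ip_test_eq0 => // phi tphi.
  have := ip_cs mU lf (test_L2 oU bU tphi).
  by rewrite f0 mul0r normr_le0 => /eqP.
move=> x Ux; apply: contrapT => fx.
have : nbhs x (U `&` [set y | f y != 0]).
  apply: filterI; first exact: open_nbhs_nbhs.
  have := @smooth_continuous _ _ _ sf x; move/(_ [set y | y != 0]); apply.
  by apply: open_nbhs_nbhs; split; [exact: open_neq|apply/eqP].
move=> /nbhs_ballP[e /= e0 he].
have : (leb R n (cube x e) = 0)%E.
  apply/negligibleP; first exact: measurable_cube.
  apply: negligibleS ae0 => y /(cubeP _ _ e0) h /= hy.
  have [Uy /eqP fy] : (U `&` [set y | f y != 0]) y.
    by apply: he; rewrite -ball_normE /ball_ /= distrC.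
  by apply: fy; apply: hy.
rewrite leb_cube// => /eqP; rewrite eqe expf_eq0 mulf_eq0 pnatr_eq0 /=.
by rewrite gt_eqF// andbF.
Qed.

Section tensor_polynomial_bounds.
Variables (R : realType) (n k : nat) (r : R).
Hypothesis r0 : 0 < r.
Local Notation I := {ffun 'I_n -> 'I_k.+1}.
Local Notation B := (cube (0 : 'rV[R]_n) r).

Let oB : open B := @open_cube R n 0 r r0.
Let bB : bounded_set B := @bounded_cube R n 0 r r0.
Let mB : measurable B := measurable_open_rV oB.
Let lm (f : I) : L2 B (monom f) := smooth_L2 oB bB (smooth_monom f).

Lemma ip_tpolyl (c : I -> R) g : L2 B g ->
  ip B (tpoly c) g = \sum_f c f * ip B (monom f) g.
Proof.
move=> lg; rewrite /tpoly ip_suml//.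
  apply: eq_bigr => f _; rewrite /ip; under eq_Rintegral do rewrite -mulrA.
  by rewrite RintegralZl//; exact: L2_mul_integrable.
move=> f; apply: smooth_L2 => //; apply/smooth_ckP => j.
by apply: ckM; [exact: ck_cst|exact: ((smooth_ckP _).1 (smooth_monom f))].
Qed.

(** The Gram matrix of the monomials in L^2 of the cube is invertible, since a
    vector in its kernel is a polynomial of norm 0. Its inverse recovers c
    from the pairings of the polynomial with the monomials, and these are
    bounded by Cauchy-Schwarz. *)
Lemma tpoly_coef_bound : exists2 K, 0 <= K &
  forall (c : I -> R) f, `|c f| <= K * L2norm B (tpoly c).
Proof.
pose G : 'M[R]_#|{: I}| :=
  \matrix_(a, b) ip B (monom (enum_val a)) (monom (enum_val b)).
pose row c : 'rV[R]_#|{: I}| := \row_a c (enum_val a).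
have rG c b : (row c *m G) 0 b = ip B (tpoly c) (monom (enum_val b)).
  rewrite mxE ip_tpolyl//.
  rewrite [RHS](reindex (fun a : 'I_#|{: I}| => enum_val a)) /=; last first.
    by apply: onW_bij; exact: enum_val_bij.
  by apply: eq_bigr => a _; rewrite !mxE.
have uG : G \in unitmx.
  rewrite -row_free_unit -kermx_eq0; apply/rowV0P => v /sub_kermxP vG.
  pose c (f : I) := v 0 (enum_rank f).
  have vE : v = row c by apply/rowP => a; rewrite !mxE /c enum_valK.
  have q0 : L2norm B (tpoly c) = 0.
    rewrite /L2norm (ip_tpolyl _ (smooth_L2 oB bB (smooth_tpoly c))).
    rewrite big1 ?sqrtr0// => f _; rewrite ipC.
    have := rG c (enum_rank f); rewrite -vE vG mxE enum_rankK => <-.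
    by rewrite mulr0.
  apply/rowP => a; rewrite vE !mxE.
  apply: (tpoly_eq0 r0) => x; apply: continuous_L2norm0 => //.
  exact: smooth_tpoly.
exists (\sum_b \sum_a L2norm B (monom (enum_val b)) * `|(invmx G) b a|).
  by apply: sumr_ge0 => b _; apply: sumr_ge0 => a _;
    rewrite mulr_ge0 ?sqrtr_ge0.
move=> c f.
have -> : c f = (row c *m G *m invmx G) 0 (enum_rank f).
  by rewrite mulmxK// mxE enum_rankK.
rewrite mxE mulr_suml; apply: le_trans (ler_norm_sum _ _ _) _;
  apply: ler_sum => b _.
rewrite mulr_suml (bigD1 (enum_rank f))//= rG normrM ler_wpDr//.
  by apply: sumr_ge0 => a _; rewrite !mulr_ge0 ?sqrtr_ge0.
rewrite mulrAC ler_wpM2r// mulrC.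
exact: (ip_cs mB (smooth_L2 oB bB (smooth_tpoly c)) (lm _)).
Qed.

Lemma tpoly_second_deriv_bound : exists2 K, 0 <= K &
  forall (c : I -> R) l y, `|y| <= 1 ->
    `|pderiv l (pderiv l (tpoly c)) y| <= K * L2norm B (tpoly c).
Proof.
have [K K0 hK] := tpoly_coef_bound.
have /choice[M hM] (p : I * 'I_n) : exists M, 0 <= M /\ forall y, `|y| <= 1 ->
    `|pderiv p.2 (pderiv p.2 (monom p.1 : 'rV[R]_n -> R)) y| <= M.
  have [|M M0 h] := @continuous_bounded_on R n 1 (pderiv p.2 (pderiv p.2 (monom
    p.1))).
    by apply: smooth_continuous; do 2 apply: smooth_pderiv; exact: smooth_monom.
  by exists M.
exists (\sum_f \sum_l K * M (f, l)).
  by apply: sumr_ge0 => f _; apply: sumr_ge0 => l _;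
    rewrite mulr_ge0// (hM (f, l)).1.
move=> c l y y1.
rewrite /tpoly (pderiv_sum _ _ _ (@smooth_monom _ _ _)).
rewrite pderiv_sum; last by move=> f; apply: smooth_pderiv; exact: smooth_monom.
apply: le_trans (ler_norm_sum _ _ _) _; rewrite mulr_suml;
  apply: ler_sum => f _.
rewrite normrM.
apply: (@le_trans _ _ (K * L2norm B (tpoly c) * M (f, l))).
  by rewrite ler_pM//; exact: (hM (f, l)).2.
rewrite mulrAC ler_wpM2r ?sqrtr_ge0// (bigD1 l)//= lerDl.
by apply: sumr_ge0 => l' _; rewrite mulr_ge0// (hM (f, l')).1.
Qed.

End tensor_polynomial_bounds.

(** * The inverse estimate *)

Lemma pderiv_scale (R : realType) (n : nat) (q : 'rV[R]_n -> R) (s : R)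
  (x0 : 'rV[R]_n) l : smooth q ->
  pderiv l (fun x => q (s *: (x - x0))) =
  fun x => s * pderiv l q (s *: (x - x0)).
Proof.
move=> sq; apply/funext => x; set e : 'rV[R]_n := delta_mx 0 l.

have h1 := is_derive_line l (s *: (x - x0)) (s * 0) sq.
have h2 : is_derive (0 : R) (1 : R) (fun t : R => s * t) s.
  have := is_deriveZ s (is_derive_id (0 : R) (1 : R)).
  by rewrite [s *: _]mulr1.
have [_ h3] := is_derive1_comp h1 h2.
transitivity ('D_1 (fun t : R => q (s *: (x - x0) + (s * t) *: e)) 0).
  have E2 : (fun h : R => h^-1 *: (((fun x => q (s *: (x - x0))) \o shift x) (h
    *: e) -
        q (s *: (x - x0)))) =
      (fun h : R => h^-1 *: (((fun t : R => q (s *: (x - x0) + (s * t) *: e))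
        \o shift (0 : R))
        (h *: (1 : R)) - q (s *: (x - x0) + (s * 0) *: e))).
    apply/funext => h /=.
    rewrite [h%:A]mulr1 addr0 mulr0 scale0r addr0; congr (_ *: (q _ - _)).
    by rewrite -addrA scalerDr scalerA [RHS]addrC.
  exact: (congr1 (fun F : R -> R => lim (F @ 0^')) E2).
by rewrite h3 mulr0 scale0r addr0 mulrC.
Qed.

Lemma differentiable_scale (R : realType) (n : nat) (q : 'rV[R]_n -> R) (s : R)
  (x0 x : 'rV[R]_n) : smooth q -> differentiable (fun x => q (s *: (x - x0))) x.
Proof.
move=> sq; apply: (@differentiable_comp _ _ _ _ (fun x : 'rV[R]_n => s *: (x -
  x0)) q).
  apply: differentiableZ; apply: differentiableB; first by [].
  exact: differentiable_cst.
exact: smooth_diff.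
Qed.

Lemma is_poly_on_tpoly (R : realType) (n k : nat) (T : set 'rV[R]_n) v :
  is_poly_on k T v -> exists c : {ffun 'I_n -> 'I_k.+1} -> R,
    forall x, T x -> v x = tpoly c x.
Proof.
move=> [c hc].
exists (fun a : {ffun 'I_n -> 'I_k.+1} => if (mi_size (fun i => a i) <= k)%N
  then c a else 0) => x Tx.
rewrite hc// big_mkcond /tpoly; apply: eq_bigr => a _.
by case: ifP => // _; rewrite mul0r.
Qed.

Lemma L2_subset (R : realType) (n : nat) (U W : set 'rV[R]_n) f :
  measurable U -> measurable W -> W `<=` U -> L2 U f -> L2 W f.
Proof.
move=> mU mW WU [mf lf]; split; first exact: (measurable_funS mU WU mf).
apply: le_lt_trans lf; apply: ge0_subset_integral => //.
  by apply/measurable_EFinP; exact: measurable_funX.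
by move=> x _; rewrite lee_fin sqr_ge0.
Qed.

Lemma test_funS (R : realType) (n : nat) (U W : set 'rV[R]_n) phi :
  W `<=` U -> test_fun W phi -> test_fun U phi.
Proof. by move=> WU [sp cp hp]; split => //; exact: subset_trans WU. Qed.

(** Test functions supported in W only see p, for which the weak derivative is
    the classical one by two integrations by parts. *)
Lemma wD2_local (R : realType) (n : nat) (U W : set 'rV[R]_n) v p l :
  open U -> bounded_set U -> open W -> W `<=` U -> Hm U 2 v -> smooth p ->
  (forall x, W x -> v x = p x) ->
  {ae leb R n, forall x, W x -> wD2 U l l v x = pderiv l (pderiv l p) x}.
Proof.
move=> oU bU oW WU hv sp vp.
have bW : bounded_set W.
  by have [M [Mr hM]] := bU; exists M; split => // N MN x /WU; exact: hM.
have mU := measurable_open_rV oU; have mW := measurable_open_rV oW.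
have lw : L2 W (wD2 U l l v) := L2_subset mU mW WU (wD2_L2 l l hv).
have sdp := smooth_pderiv l sp; have sddp := smooth_pderiv l sdp.
have ld := smooth_L2 oW bW sddp.
have : {ae leb R n, forall x, W x ->
    wD2 U l l v x + (-1) * pderiv l (pderiv l p) x = 0}.
  apply: ip_test_eq0 => //; first exact: L2_lin.
  move=> phi tphi; have tU := test_funS WU tphi.
  rewrite (ip_linl mW (-1) lw ld (test_L2 oW bW tphi)).
  have [_ /(_ _ tU)] := Hm_wderiv hv (mi_size_second_idx l l).
  rewrite second_idxE -/(wD2 U l l v).
  rewrite (_ : (fun i => _) = fun i => if i == l then 2%N else 0%N); last first.
    by apply/funext => i; case: eqP.
  rewrite mi_size_axis mderiv_axis /= sqrrN expr1n mul1r.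
  have td := test_fun_pderiv l tphi; have tdd := test_fun_pderiv l td.
  have tddU := test_funS WU tdd.
  rewrite (ip_test _ tU) -(ip_test _ tphi) => <-.
  rewrite (ip_test _ tddU) -(ip_test _ tdd) mulN1r.
  rewrite -(integration_by_parts l sdp tphi).
  have -> : ip W v (pderiv l (pderiv l phi)) = ip W p (pderiv l (pderiv l phi)).
    by apply: eq_Rintegral => x; rewrite inE => Wx; rewrite vp.
  by rewrite (integration_by_parts l sp td) addNr.
by apply: filterS => x + Wx => /(_ Wx)/eqP; rewrite mulN1r subr_eq0 => /eqP.
Qed.

(** In the variable y = (x - x0) / d, the set W lies between a fixed cube and
    the unit ball. A second derivative in x is d^-2 times one in y, and the
    volume factors d^n of W and of the cube cancel. *)
Lemma polynomial_inverse_estimate (R : realType) (n k : nat) (r : R) : 0 < r ->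
  exists2 K, 0 <= K &
  forall (c : {ffun 'I_n -> 'I_k.+1} ->
    R) (x0 : 'rV[R]_n) (d : R) (W : set 'rV[R]_n) l,
    0 < d -> open W -> cube x0 (r * d) `<=` W -> (forall x, W x ->
      `|x - x0| <= d) ->
    (\int[leb R n]_(x in W) (pderiv l (pderiv l (tpoly c)) x ^+ 2)%:E <=
     (K * d ^- 4)%:E * \int[leb R n]_(x in W) (tpoly c x ^+ 2)%:E)%E.
Proof.
move=> r0; have [K0 K00 hK0] := @tpoly_second_deriv_bound R n k r r0.
(* W lies in a cube of side 4 d, whence the factor 4^n. *)
exists (K0 ^+ 2 * 4 ^+ n); first by rewrite mulr_ge0 ?exprn_ge0.
move=> c x0 d W l d0 oW QW Wd.
have mW := measurable_open_rV oW.
have mc (f : 'rV[R]_n -> R) : continuous f ->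
    measurable_fun W (fun x : 'rV[R]_n => (f x ^+ 2)%:E).
  move=> cf; apply/measurable_EFinP; apply: measurable_funX;
    apply: measurable_funTS.
  exact: measurable_fun_continuous_rV.
have [c' cc'] := tpoly_affine x0 c d0.
have sq := @smooth_tpoly R n k c'; have sq1 := smooth_pderiv l sq.
set N := L2norm (cube 0 r) (tpoly c').
have d2p x : pderiv l (pderiv l (tpoly c)) x =
    d^-1 ^+ 2 * pderiv l (pderiv l (tpoly c')) (d^-1 *: (x - x0)).
  rewrite (funext cc' : tpoly c = _) (pderiv_scale _ _ _ sq).
  rewrite (_ : pderiv l _ = fun x => d^-1 * pderiv l (fun x => pderiv l (tpoly
    c') (d^-1 *: (x - x0))) x).
    by rewrite (pderiv_scale _ _ _ sq1) mulrA.
  apply/funext => y; apply: pderivZ; exact: differentiable_scale.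
have le2 x : W x -> pderiv l (pderiv l (tpoly c)) x ^+ 2 <= d ^- 4 * (K0 ^+ 2 *
  N ^+ 2).
  move=> Wx; rewrite d2p -real_normK ?num_real// normrM exprMn.
  rewrite (_ : `|d^-1 ^+ 2| ^+ 2 = d ^- 4); last first.
    by rewrite real_normK ?num_real// -exprM exprVn.
  rewrite ler_wpM2l ?invr_ge0 ?exprn_ge0 ?(ltW d0)// -exprMn.
  rewrite lerXn2r ?nnegrE ?mulr_ge0 ?sqrtr_ge0//; apply: hK0.
  by rewrite normrZ ger0_norm ?invr_ge0 ?(ltW d0)// mulrC ler_pdivrMr// mul1r
    Wd.
have rd0 : 0 < r * d by rewrite mulr_gt0.
have NE : ((d ^+ n * N ^+ 2)%:E =
    \int[leb R n]_(x in cube x0 (r * d)) (tpoly c x ^+ 2)%:E)%E.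
  have mQ := @measurable_cube R n x0 (r * d).
  have oB := @open_cube R n 0 r r0; have bB := @bounded_cube R n 0 r r0.
  rewrite (ge0_integral_affine x0 d0 mQ); last 2 first.
  - by apply: measurable_funS (mc _ _) => //; apply: smooth_continuous;
    exact: smooth_tpoly.
  - by move=> x _; rewrite lee_fin sqr_ge0.
  rewrite (_ : affine x0 d @^-1` _ = cube 0 r); last first.
    apply/seteqP; split => y /=.
      move/(cubeP _ _ rd0); rewrite /affine addrC addKr => h;
        apply/(cubeP _ _ r0).
      by move: h; rewrite normrZ gtr0_norm// mulrC ltr_pM2r// subr0.
    move/(cubeP _ _ r0); rewrite subr0 => h; apply/(cubeP _ _ rd0).
    by rewrite /affine addrC addKr normrZ gtr0_norm// mulrC ltr_pM2r.
  rewrite EFinM; congr (_ * _)%E.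
  rewrite L2norm_sqr /ip /Rintegral fineK.
    apply: eq_integral => y _; rewrite cc' /affine addrC addKr scalerA mulVf
      ?gt_eqF//.
    by rewrite scale1r expr2.
  apply: integrable_fin_num; first exact: measurable_open_rV.
  by apply: L2_mul_integrable; [exact: measurable_open_rV|exact:
    smooth_L2|exact: smooth_L2].
apply: (@le_trans _ _ (\int[leb R n]_(x in W) (d ^- 4 * (K0 ^+ 2 * N ^+
  2))%:E)%E).
  apply: ge0_le_integral => //.
  - by move=> x _; rewrite lee_fin sqr_ge0.
  - apply: mc; apply: smooth_continuous.
    exact: (smooth_pderiv l (smooth_pderiv l (smooth_tpoly c))).
rewrite integral_cst//.
apply: (@le_trans _ _ ((d ^- 4 * (K0 ^+ 2 * N ^+ 2))%:E * ((4 * d) ^+ n)%:E)%E).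
  apply: lee_wpmul2l.
    by rewrite lee_fin !mulr_ge0 ?exprn_ge0 ?invr_ge0 ?exprn_ge0 ?sqrtr_ge0
      ?(ltW d0).
  have d20 : 0 < 2 * d by rewrite mulr_gt0.
  rewrite (_ : (4 * d) ^+ n = (2 * (2 * d)) ^+ n); last by rewrite mulrA -natrM.
  rewrite -(leb_cube x0 d20); apply: le_measure; rewrite ?inE//.
    exact: measurable_cube.
  move=> x Wx; apply/(cubeP _ _ d20); apply: le_lt_trans (Wd x Wx) _.
  by rewrite ltr_pMl// ltr1n.
have regroup (a b : R) :
    a * (K0 ^+ 2 * b) * (4 * d) ^+ n = K0 ^+ 2 * 4 ^+ n * a * (d ^+ n * b).
  by rewrite exprMn; ring.
rewrite -EFinM regroup EFinM NE; apply: lee_wpmul2l.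
  by rewrite lee_fin !mulr_ge0 ?exprn_ge0 ?invr_ge0 ?exprn_ge0 ?(ltW d0).
apply: ge0_subset_integral => //.
- exact: measurable_cube.
- by apply: mc; apply: smooth_continuous; exact: smooth_tpoly.
- by move=> x _; rewrite lee_fin sqr_ge0.
Qed.

Section euclidean_norm.
Variables (R : realType) (n : nat).
Implicit Type x : 'rV[R]_n.

Lemma norm_le_enorm x : `|x| <= enorm x.
Proof.
rewrite rV_norm_le ?sqrtr_ge0//; apply/forallP => i.
rewrite -sqrtr_sqr ler_wsqrtr// (bigD1 i)//= lerDl.
by apply: sumr_ge0 => j _; exact: sqr_ge0.
Qed.

Lemma enorm_le x : (0 < n)%N -> enorm x <= n%:R * `|x|.
Proof.
move=> n0; rewrite -[leRHS]ger0_norm ?mulr_ge0// -sqrtr_sqr ler_wsqrtr//.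
apply: (@le_trans _ _ (\sum_(i < n) `|x| ^+ 2)).
  apply: ler_sum => i _; rewrite -real_normK ?num_real// lerXn2r ?nnegrE//.
  by have := lexx `|x|; rewrite rV_norm_le// => /forallP; exact.
rewrite sumr_const card_ord -[leLHS]mulr_natl exprMn ler_wpM2r ?sqr_ge0//.
by rewrite -natrX ler_nat -{1}(expn1 n) leq_pexp2l.
Qed.

Lemma enorm_le_diam (T : set 'rV[R]_n) x y : (0 < n)%N -> bounded_set T ->
  T x -> T y -> enorm (x - y) <= diam T.
Proof.
move=> n0 [M [Mr hM]] Tx Ty; apply: ub_le_sup; last by exists x, y.
exists (n%:R * ((M + 1) + (M + 1))) => _ [u [v [Tu Tv ->]]].
apply: le_trans (enorm_le _ n0) _; rewrite ler_wpM2l//.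
by apply: le_trans (ler_normB _ _) _; apply: lerD; apply: hM => //;
  rewrite ltrDl.
Qed.

End euclidean_norm.

Lemma L2norm_sqr_integral (R : realType) (n : nat) (U : set 'rV[R]_n) f :
  measurable U -> L2 U f ->
  ((L2norm U f ^+ 2)%:E = \int[leb R n]_(x in U) (f x ^+ 2)%:E)%E.
Proof.
move=> mU lf; rewrite L2norm_sqr /ip /Rintegral fineK.
  by apply: eq_integral => x _; rewrite expr2.
by apply: integrable_fin_num => //; exact: L2_mul_integrable.
Qed.

Section mesh.
Variables (R : realType) (n : nat) (Omega : set 'rV[R]_n).
Hypotheses (oO : open Omega) (bO : bounded_set Omega).
Variable Th : set (set 'rV[R]_n).
Hypothesis hTh : is_mesh Omega Th.

Lemma mesh_element_bounded T : Th T -> bounded_set T.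
Proof.
move=> hT; have [_ cov _ _] := hTh.
have [r r0 hr] := compact_rV_norm_bounded (compact_closure_bounded bO).
exists r; split; first exact: num_real.
move=> N rN x Tx; apply: le_trans (hr x _) (ltW rN).
by rewrite -cov; exists T.
Qed.

Lemma mesh_seq : exists2 s : seq (set 'rV[R]_n), uniq s & forall T,
  Th T <-> T \in s.
Proof.
have [/finite_seqP[s sE] _ _ _] := hTh; exists (undup s);
  first exact: undup_uniq.
by move=> T; rewrite mem_undup sE.
Qed.

(** The open elements are disjoint and exhaust Omega up to the boundaries of
    the elements, which are null sets. *)
Lemma ge0_integral_mesh (s : seq (set 'rV[R]_n)) (f : 'rV[R]_n -> \bar R) :
  uniq s -> (forall T, Th T <-> T \in s) -> measurable_fun Omega f ->
  (forall x, Omega x -> (0 <= f x)%E) ->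
  (\int[leb R n]_(x in Omega) f x =
   \sum_(T <- s) \int[leb R n]_(x in interior T) f x)%E.
Proof.
move=> us sE mf f0; have [_ cov hT disj] := hTh.
have mO := measurable_open_rV oO.
have mI (T : set 'rV[R]_n) : measurable (interior T).
  by apply: measurable_open_rV; exact: open_interior.
pose W := \big[setU/set0]_(T <- s) interior T.
have WO : W `<=` Omega.
  rewrite /W -bigcup_seq => x [T /= /sE /hT[_ _ _ TO _]]; exact: TO.
have mW : measurable W by apply: bigsetU_measurable.
have N0 : (leb R n (Omega `\` W) = 0)%E.
  apply/negligibleP; first exact: measurableD.
  have : (leb R n).-negligible (\big[setU/set0]_(T <- s) (T `\` interior T)).
    rewrite big_seq; elim/big_ind : _ => [|A B|T /sE /hT[TE _ _ _ T0]].
    - exact: negligible_set0.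
    - exact: negligibleU.
    - apply/negligibleP => //; apply: measurableD => //.
      by apply: measurable_closed_rV; rewrite TE; exact: closed_closure.
  apply: negligibleS; rewrite -bigcup_seq => x [Ox Wx].
  have : closure Omega x by exact: subset_closure.
  rewrite -cov => -[T hTT Tx]; exists T; first by apply/sE.
  split => // iTx; apply: Wx; rewrite /W -bigcup_seq.
  by exists T => //; apply/sE.
rewrite (ge0_negligible_integral _ _ mf f0 N0)//; last exact: measurableD.
rewrite setDD setIidr// ge0_integral_bigsetU//.
- apply/trivIsetP => T T' /sE hT1 /sE hT2 /eqP TT'; exact: disj.
- exact: measurable_funS mf.
- by move=> x Wx; apply: f0; exact: WO.
Qed.

End mesh.

Section inverse_estimate.
Variables (R : realType) (n : nat) (Omega : set 'rV[R]_n).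
Hypotheses (n0 : (0 < n)%N) (oO : open Omega) (bO : bounded_set Omega).
Variables (k : nat) (hs : set R) (Th : R -> set (set 'rV[R]_n)).
Hypotheses (hTh : mesh_family Omega hs Th) (hsr : shape_regular hs Th)
  (hqu : quasi_uniform hs Th)
  (hconf : forall h, hs h -> fe_space Omega k (Th h) `<=` H2H10 Omega).

(** By shape regularity an element contains a Euclidean ball of radius
    sigma diam T, hence a cube of half-side sigma diam T / n; by
    quasi-uniformity diam T is at least tau h. *)
Lemma element_inverse_estimate : exists2 K, 0 <= K & forall h T v l,
  hs h -> Th h T -> fe_space Omega k (Th h) v ->
  (\int[leb R n]_(x in interior T) (wD2 Omega l l v x ^+ 2)%:E <=
   (K * h ^- 4)%:E * \int[leb R n]_(x in interior T) (v x ^+ 2)%:E)%E.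
Proof.
have [sigma [sigma0 hsigma]] := hsr; have [tau [tau0 htau]] := hqu.
have r0 : 0 < sigma / n%:R by rewrite divr_gt0// ltr0n.
have [K K0 hK] := @polynomial_inverse_estimate R n k _ r0.
exists (K * tau ^- 4); first by rewrite mulr_ge0// invr_ge0 exprn_ge0// ltW.
move=> h T v l hh hT fv.
have [h0 mesh _] := hTh hh; have [_ _ /(_ _ hT)[_ _ _ TO _] _] := mesh.
have [_ _ /(_ _ hT)/is_poly_on_tpoly[c vc]] := fv.
have [Hv _] := hconf hh fv.
have bT := mesh_element_bounded bO mesh hT.
have dth := htau _ _ hh hT.
have d0 : 0 < diam T by apply: lt_le_trans dth; rewrite mulr_gt0.
(* The centre of the inscribed ball serves as the origin of the scaling. *)
have [x0 ball] := hsigma _ _ hh hT.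
have Tx0 : T x0.
  apply: ball; rewrite /= subrr; apply: (@le_lt_trans _ _ 0);
    last by rewrite mulr_gt0.
  by rewrite (le_trans (enorm_le _ n0))// normr0 mulr0.
have oI := @open_interior _ T; have mI := measurable_open_rV oI.
have QI : cube x0 (sigma / n%:R * diam T) `<=` interior T.
  have q0 : 0 < sigma / n%:R * diam T by rewrite mulr_gt0.
  rewrite -open_subsetE; last exact: open_cube.
  move=> y /(cubeP _ _ q0) hy; apply: ball => /=.
  apply: le_lt_trans (enorm_le _ n0) _.
  by rewrite mulrC -ltr_pdivlMr ?ltr0n// mulrAC.
have Id x : interior T x -> `|x - x0| <= diam T.
  move=> Ix; apply: le_trans (norm_le_enorm _) _; apply: enorm_le_diam => //.
  exact: interior_subset.
have mO := measurable_open_rV oO.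
have vI x : interior T x -> v x = tpoly c x.
  by move=> Ix; apply: vc; exact: interior_subset.
rewrite (@ge0_ae_eq_integral _ _ _ (leb R n) _ _
  (fun x => (pderiv l (pderiv l (tpoly c)) x ^+ 2)%:E)) //; last first.
- have := wD2_local l oO bO oI TO Hv (smooth_tpoly c) vI.
  by apply: filterS => x + Ix => /(_ Ix) ->.
- by move=> x _; rewrite lee_fin sqr_ge0.
- by move=> x _; rewrite lee_fin sqr_ge0.
- apply/measurable_EFinP; apply: measurable_funX; apply: measurable_funTS.
  apply: measurable_fun_continuous_rV; apply: smooth_continuous.
  exact: (smooth_pderiv l (smooth_pderiv l (smooth_tpoly c))).
- apply/measurable_EFinP; apply: measurable_funX.
  exact: (measurable_funS mO TO (wD2_L2 l l Hv).1).
apply: le_trans (hK c x0 (diam T) _ l d0 oI QI Id) _.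
have -> : (\int[leb R n]_(x in interior T) (v x ^+ 2)%:E =
    \int[leb R n]_(x in interior T) (tpoly c x ^+ 2)%:E)%E.
  by apply: eq_integral => x; rewrite inE => Ix; rewrite vI.
apply: lee_wpmul2r; first by apply: integral_ge0 => x _;
  rewrite lee_fin sqr_ge0.
rewrite lee_fin -mulrA ler_wpM2l// -invfM -exprMn lef_pV2 ?posrE ?exprn_gt0
  ?mulr_gt0//.
by rewrite lerXn2r ?nnegrE ?(ltW d0)// ltW// mulr_gt0.
Qed.

(** Sum of the estimates on the elements, with equal constants. *)
Lemma inverse_estimate : exists2 C, 0 <= C & forall h v l,
  hs h -> fe_space Omega k (Th h) v ->
  L2norm Omega (wD2 Omega l l v) <= C * h ^- 2 * L2norm Omega v.
Proof.
have [K K0 hK] := element_inverse_estimate.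
exists (Num.sqrt K); first exact: sqrtr_ge0.
move=> h v l hh fv; have [h0 mesh _] := hTh hh.
have mO := measurable_open_rV oO.
have [Hv _] := hconf hh fv; have lv := Hm_L2 Hv; have lw := wD2_L2 l l Hv.
have [s us sE] := mesh_seq mesh.
have msq f : L2 Omega f -> measurable_fun Omega (fun x => (f x ^+ 2)%:E).
  by move=> lf; apply/measurable_EFinP; exact: (measurable_funX _ lf.1).
have C0 : 0 <= Num.sqrt K * h ^- 2 * L2norm Omega v.
  by rewrite !mulr_ge0 ?sqrtr_ge0// invr_ge0 exprn_ge0// ltW.
rewrite -(@ler_pXn2r _ 2) ?nnegrE ?sqrtr_ge0//.
rewrite -lee_fin (L2norm_sqr_integral mO lw) !exprMn sqr_sqrtr//.
rewrite EFinM (L2norm_sqr_integral mO lv) -exprVn -exprM exprVn.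
rewrite !(ge0_integral_mesh oO mesh us sE)//; try exact: msq;
  try by move=> x _; rewrite lee_fin sqr_ge0.
rewrite ge0_sume_distrr; last first.
  by move=> T _; apply: integral_ge0 => x _; rewrite lee_fin sqr_ge0.
rewrite big_seq [leRHS]big_seq; apply: lee_sum => T /sE hT.
exact: hK.
Qed.

End inverse_estimate.

(** * Discrete inf-sup condition and quasi-optimality *)

Section galerkin.
Variables (R : realType) (n : nat) (Omega : set 'rV[R]_n).
Hypotheses (oO : open Omega) (bO : bounded_set Omega).
Variables (A : 'rV[R]_n -> 'M[R]_n) (k : nat) (Th : set (set 'rV[R]_n)).
Hypothesis cA : {within closure Omega, continuous A}.
Hypothesis hTh : is_mesh Omega Th.
Local Notation V := (fe_space Omega k Th).
Hypothesis hconf : V `<=` H2H10 Omega.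
Hypothesis V_nonempty : V !=set0.

Let mO : measurable Omega := measurable_open_rV oO.
Let null (w : 'rV[R]_n -> R) := L2 Omega w /\ L2norm Omega w = 0.

Let V_H2 v : V v -> Hm Omega 2 v. Proof. by case/hconf. Qed.

Let V_L2 v : V v -> L2 Omega v. Proof. by move=> /V_H2/Hm_L2. Qed.

Let V_zero : V (fun=> 0).
Proof. by have [u Vu] := V_nonempty; exact: fe_space0 Vu. Qed.

Let null_scale w c : null w -> null (fun x => c * w x).
Proof.
move=> [lw w0]; have lz := L2_cst mO (leb_bounded_fin mO bO) 0.
have e : (fun x => c * w x) = fun x => 0 + c * w x by apply/funext => x;
  rewrite add0r.
have lcw : L2 Omega (fun x => c * w x) by rewrite e; exact: L2_lin.
split => //; apply/eqP; rewrite sqrtr_eq0.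
have -> : ip Omega (fun x => c * w x) (fun x => c * w x) = c ^+ 2 * ip Omega w
  w.
  rewrite /ip -RintegralZl//; last exact: L2_mul_integrable.
  by apply: eq_Rintegral => x _; rewrite expr2 mulrACA.
by rewrite -L2norm_sqr w0 expr0n mulr0.
Qed.

Let V_dim : exists D, forall N (v : 'I_N -> 'rV[R]_n -> R),
  independent V null v -> (N <= D)%N.
Proof.
have [fTh cov _ _] := hTh; have [D hD] := @fe_space_dim R n Omega k Th fTh.
exists D => N v [Vv iv]; rewrite leqNgt; apply/negP => DN.
have [c c0 hc] := hD N v Vv DN.
have Vc : V (lincomb v c).
  by have [] := lincomb_in_lin V_zero (fun f g a => fe_space_lin a oO bO) c Vv.
apply/negP: c0; rewrite negbK; apply/eqP/iv; split; first exact: V_L2.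
apply/eqP; rewrite sqrtr_eq0 le_eqVlt; apply/orP; left; apply/eqP.
have -> : ip Omega (lincomb v c) (lincomb v c) =
    \int[leb R n]_(x in Omega) ((fun=> 0) x : R);
      last by rewrite Rintegral_cst// mul0r.
apply: eq_Rintegral => x; rewrite inE => Ox.
have : closure Omega x by exact: subset_closure.
by rewrite -cov => -[T hT Tx]; rewrite (hc T hT x Tx) mul0r.
Qed.

Lemma fe_representation b l :
  (forall v, V v -> linear_on V (b^~ v)) -> (forall w, V w ->
    linear_on V (b w)) ->
  linear_on V l ->
  (forall w v, V w -> V v -> L2norm Omega w = 0 -> b w v = 0) ->
  (forall w, V w -> L2norm Omega w = 0 -> l w = 0) ->
  (forall v, V v -> (forall w, V w -> b w v = 0) -> L2norm Omega v = 0) ->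
  exists2 v, V v & forall w, V w -> b w v = l w.
Proof.
move=> bl br ll bz lz bn; have [D hD] := V_dim.
apply: (@bilinear_representation _ _ V null V_zero _ null_scale D hD) => //.
- by move=> f g c; exact: fe_space_lin.
- by move=> w v Vw Vv [_]; exact: bz.
- by move=> w Vw [_]; exact: lz.
- by move=> v Vv h; split; [exact: V_L2|exact: bn].
Qed.

(** Riesz representation in V_h: the class of candidates from which the
    definition of the discrete adjoint chooses is not empty. *)
Lemma discrete_adjointP eps w v : V w -> V v ->
  ip Omega (discrete_adjoint Omega A V eps w) v = bform Omega A eps v w.
Proof.
move=> Vw Vv.
have : exists2 g, V g & forall v, V v -> ip Omega g v = bform Omega A eps v w.
  apply: (@fe_representation (fun v g => ip Omega g v) (fun v => bform Omega A
    eps v w)).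
  - by move=> g Vg f f' c Vf Vf'; apply: ip_linr => //; exact: V_L2.
  - by move=> g Vg f f' c Vf Vf'; apply: ip_linl => //; exact: V_L2.
  - by move=> f f' c Vf Vf'; apply: bform_linl => //; exact: V_H2.
  - move=> f g Vf Vg f0; apply/eqP; rewrite -normr_le0.
    by rewrite (le_trans (ip_cs mO (V_L2 Vg) (V_L2 Vf)))// f0 mulr0.
  - by move=> f Vf f0; apply: bform_null => //; exact: V_H2.
  - by move=> g Vg h; rewrite /L2norm h// sqrtr0.
move=> [g Vg hg].
have ex : exists g, V g /\ forall v, V v ->
  ip Omega g v = bform Omega A eps v w.
  by exists g.
by have [_] := xgetPex (fun=> 0) ex; apply.
Qed.

Variables (eps C : R).
Hypothesis stab : forall v, V v ->
  L2norm Omega v <= C * Hm2norm Omega V (discrete_adjoint Omega A V eps v).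
Hypothesis C0 : 0 <= C.

(** Adjoint stability freed of the negative norm. The case K = 0 is
    uniqueness for the adjoint problem. *)
Lemma adjoint_bound v K : V v -> 0 <= K ->
  (forall w, V w -> bform Omega A eps w v <= K * Hmnorm Omega 2 w) ->
  L2norm Omega v <= C * K.
Proof.
move=> Vv K0 hK; apply: le_trans (stab Vv) _; rewrite ler_wpM2l// /Hm2norm.
set S := [set q | _]; have [->|/set0P S0] := eqVneq S set0;
  first by rewrite sup0.
apply: ge_sup => // _ [w [Vw _ ->]]; rewrite discrete_adjointP//.
(* If w has norm 0, the quotient in the negative norm is 0 by convention. *)
have [->|w0] := eqVneq (Hmnorm Omega 2 w) 0; first by rewrite invr0 mulr0.
by rewrite ler_pdivrMr ?hK// lt_neqAle eq_sym w0 Hmnorm_ge0.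
Qed.

(** The transpose of adjoint stability. The test function v is the one that
    represents the H^2 inner product with w through b; stability applied to v
    bounds it, because b(z, v) = (z, w)_H2 <= |z|_H2 |w|_H2. *)
Lemma discrete_inf_sup w : V w -> exists v, [/\ V v,
  bform Omega A eps w v = Hmnorm Omega 2 w ^+ 2 &
  L2norm Omega v <= C * Hmnorm Omega 2 w].
Proof.
move=> Vw.
have [v Vv hv] : exists2 v, V v & forall z, V z ->
    bform Omega A eps z v = hip Omega 2 z w.
  apply: fe_representation.
  - by move=> g Vg f f' c Vf Vf'; apply: bform_linl => //; exact: V_H2.
  - by move=> g Vg f f' c Vf Vf'; apply: bform_linr => //; exact: V_H2.
  - by move=> f f' c Vf Vf'; apply: hip_linl => //; exact: V_H2.
  - by move=> f g Vf Vg f0; apply: bform_null => //; exact: V_H2.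
  - by move=> f Vf f0; apply: hip_null => //; exact: V_H2.
  - move=> v Vv h; apply/eqP; rewrite eq_le sqrtr_ge0 andbT -(mulr0 C).
    by apply: adjoint_bound => // z Vz; rewrite h// mul0r.
exists v; split => //; first by rewrite hv// Hmnorm_sqr.
apply: adjoint_bound => //; first exact: Hmnorm_ge0.
move=> z Vz; rewrite hv// mulrC; apply: le_trans (ler_norm _) _.
by apply: hip_cs => //; exact: V_H2.
Qed.

End galerkin.

Lemma ler_error_constants (F : realFieldType) (a b c d e N E P : F) :
  0 <= a -> 0 <= c -> 0 <= N -> 0 <= E -> e * d <= P ->
  (e * (a * (c * d * N)) + b * N) * E <= (a * P * c + b) * N * E.
Proof.
move=> a0 c0 N0 E0 le_edP; rewrite ler_wpM2r// mulrDl lerD2r.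
rewrite (_ : e * _ = a * (e * d) * c * N); last by ring.
by rewrite ler_wpM2r// ler_wpM2r// ler_wpM2l.
Qed.

Lemma ler_of_sqr_le (F : realFieldType) (x a c N E : F) :
  0 <= x -> 0 <= a -> 0 <= c -> 0 <= E -> x ^+ 2 <= a * N * E -> N <= c * x ->
  x <= a * c * E.
Proof.
move=> x0 a0 c0 E0 le1 le2; have [->|xn0] := eqVneq x 0;
  first by rewrite !mulr_ge0.
have xp : 0 < x by rewrite lt_neqAle eq_sym xn0.
rewrite -(ler_pM2r xp) -expr2; apply: le_trans le1 _.
rewrite (_ : a * c * E * x = a * (c * x) * E); last by ring.
by rewrite ler_wpM2r// ler_wpM2l.
Qed.

Section cea.
Variables (R : realType) (n : nat) (n0 : (0 < n)%N).
Variables (Omega : set 'rV[R]_n) (oO : open Omega) (bO : bounded_set Omega).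
Variables (A : 'rV[R]_n -> 'M[R]_n) (cA : {within closure Omega, continuous A}).
Variables (k : nat) (hs : set R) (Th : R -> set (set 'rV[R]_n)).
Hypotheses (hTh : mesh_family Omega hs Th) (hsr : shape_regular hs Th)
  (hqu : quasi_uniform hs Th)
  (hconf : forall h, hs h -> fe_space Omega k (Th h) `<=` H2H10 Omega).
Variables (beta C0 h0 : R) (hbeta : 2 <= beta) (C00 : 0 < C0) (h00 : 0 < h0).
Hypothesis hstab : adjoint_stability Omega A k hs Th C0 beta h0.

Lemma eps_inverse_bound h eps : 0 < h -> h < h0 -> eps <= C0 * h `^ beta ->
  eps * h ^- 2 <= C0 * h0 `^ (beta - 2).
Proof.
move=> hp hh0 he; rewrite ler_pdivrMr ?exprn_gt0//; apply: le_trans he _.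
rewrite -mulrA ler_wpM2l ?(ltW C00)//.
have -> : h `^ beta = h `^ (beta - 2) * h `^ 2.
  have hne : (beta - 2 + 2 == 0) ==> (h != 0) by rewrite (gt_eqF hp) implybT.
  by rewrite -(powRD hne) subrK.
rewrite powR_mulrn ?(ltW hp)// ler_wpM2r ?exprn_ge0 ?(ltW hp)//.
by apply: ge0_ler_powR; rewrite ?nnegrE ?subr_ge0// ltW.
Qed.

(** Galerkin orthogonality replaces b(u_h - v_h, v) by b(u - v_h, v), for the
    test function v that the inf-sup condition attaches to u_h - v_h. *)
Lemma quasi_optimality : exists2 C, 0 < C & forall h eps, hs h -> h < h0 ->
  0 < eps -> eps <= C0 * h `^ beta -> forall f u uh vh,
  weak_solution Omega A eps f u -> fe_space Omega k (Th h) uh ->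
  (forall v, fe_space Omega k (Th h) v ->
    bform Omega A eps uh v = ip Omega f v) ->
  fe_space Omega k (Th h) vh ->
  Hmnorm Omega 2 (fun x => u x - uh x) <= C * Hmnorm Omega 2 (fun x => u x - vh
    x).
Proof.
have [Cs [Cs0 hCs]] := hstab.
have [Ci Ci0 hCi] := inverse_estimate n0 oO bO hTh hsr hqu hconf.
have [M M0 hM] := bform_bound oO bO cA.
pose C1 := n%:R ^+ 2 * (C0 * h0 `^ (beta - 2)) * Ci + n%:R ^+ 2 * M.
have C10 : 0 <= C1.
  by rewrite addr_ge0 ?mulr_ge0 ?sqr_ge0 ?powR_ge0// ltW.
exists (1 + C1 * Cs); first by rewrite ltr_pwDl// mulr_ge0// ltW.
move=> h eps hh hh0 eps0 epsh f u uh vh [[Hu _] hu] Vuh huh Vvh.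
have [hp mesh _] := hTh hh.
have Huh := (hconf hh Vuh).1; have Hvh := (hconf hh Vvh).1.
have subE (a b : 'rV[R]_n -> R) : (fun x => a x - b x) = fun x => a x + (-1) *
  b x.
  by apply/funext => x; rewrite mulN1r.
pose w : 'rV[R]_n -> R := fun x => uh x + (-1) * vh x.
have Vw : fe_space Omega k (Th h) w := fe_space_lin (-1) oO bO Vuh Vvh.
have Hw := (hconf hh Vw).1.
have ne : fe_space Omega k (Th h) !=set0 by exists uh.
have [v [Vv bv lv]] := discrete_inf_sup oO bO cA mesh (hconf hh) ne
  (hCs h eps hh hh0 eps0 epsh) (ltW Cs0) Vw.
have [Hv Hv0] := hconf hh Vv.
set E := Hmnorm Omega 2 (fun x => u x - vh x).
have E0 : 0 <= E by exact: Hmnorm_ge0.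
have Huv : Hm Omega 2 (fun x => u x - vh x) by rewrite subE; exact: Hm_lin.
have bw : bform Omega A eps w v = bform Omega A eps (fun x => u x - vh x) v.
  rewrite subE (bform_linl oO bO cA eps (-1) Hu Hvh Hv).
  rewrite (bform_linl oO bO cA eps (-1) Huh Hvh Hv).
  by rewrite (huh _ Vv) (hu _ (conj Hv Hv0)).
have le1 : Hmnorm Omega 2 w ^+ 2 <= C1 * L2norm Omega v * E.
  rewrite -bv bw; apply: le_trans (ler_norm _) _.
  have le_b := hM eps _ _ _ (ltW eps0) Huv Hv (fun l => hCi h v l hh Vv).
  have le_c := @ler_error_constants R (n%:R ^+ 2) (n%:R ^+ 2 * M) Ci (h ^- 2)
    eps
    (L2norm Omega v) E _ (sqr_ge0 _) Ci0 (L2norm_ge0 Omega v) E0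
    (eps_inverse_bound hp hh0 epsh).
  exact: le_trans le_b le_c.
have le2 : Hmnorm Omega 2 w <= C1 * Cs * E.
  exact: ler_of_sqr_le (Hmnorm_ge0 Omega 2 w) C10 (ltW Cs0) E0 le1 lv.
have -> : (fun x => u x - uh x) = fun x => (u x - vh x) + (-1) * w x.
  by apply/funext => x; rewrite /w; ring.
apply: le_trans (Hmnorm_lin oO bO (-1) Huv Hw) _.
rewrite normrN1 mul1r mulrDl mul1r; exact: lerD (lexx _) le2.
Qed.

End cea.

(** * The error estimates *)

Unset Implicit Arguments.
Set Strict Implicit.

Theorem theorem4p9 (R : realType) (n : nat) (hn : (0 < n)%N)
  (Omega : set 'rV[R]_n) (hOo : open Omega) (hOc : connected Omega)
  (hO0 : Omega !=set0) (hOb : bounded_set Omega)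
  (A : 'rV[R]_n -> 'M[R]_n) (hAc : {within closure Omega, continuous A})
  (hAe : uniformly_elliptic Omega A)
  (hwp : well_posed Omega A)
  (k : nat) (hs : set R) (Th : R -> set (set 'rV[R]_n))
  (hTh : mesh_family Omega hs Th) (hsr : shape_regular hs Th)
  (hqu : quasi_uniform hs Th)
  (hconf : forall h, hs h -> fe_space Omega k (Th h) `<=` H2H10 Omega)
  (hint : interpolation_estimates Omega k hs Th)
  (beta C0 h0 : R) (hbeta : 2 <= beta) (hC0 : 0 < C0) (hh0 : 0 < h0)
  (hstab : adjoint_stability Omega A k hs Th C0 beta h0) :
  (exists C : R, 0 < C /\
    forall h eps : R, hs h -> h < h0 -> 0 < eps -> eps <= C0 * h `^ beta ->
    forall f u uh : 'rV[R]_n -> R, L2 Omega f ->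
    weak_solution Omega A eps f u ->
    fe_space Omega k (Th h) uh ->
    (forall vh, fe_space Omega k (Th h) vh ->
       bform Omega A eps uh vh = ip Omega f vh) ->
    Hmnorm Omega 2 (fun x => u x - uh x) <=
      C * inf [set d | exists vh, fe_space Omega k (Th h) vh /\
                 d = Hmnorm Omega 2 (fun x => u x - vh x)]) /\
  (forall s : R, 2 <= s -> exists C : R, 0 < C /\
    forall h eps : R, hs h -> h < h0 -> 0 < eps -> eps <= C0 * h `^ beta ->
    forall f u uh : 'rV[R]_n -> R, L2 Omega f ->
    weak_solution Omega A eps f u ->
    fe_space Omega k (Th h) uh ->
    (forall vh, fe_space Omega k (Th h) vh ->
       bform Omega A eps uh vh = ip Omega f vh) ->
    Hs Omega s u ->
    Hmnorm Omega 2 (fun x => u x - uh x) <=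
      C * h `^ (Num.min k.+1%:R s - 2) *
      Hsnorm Omega (Num.min k.+1%:R s) u).
Proof.
have [C C_gt0 cea] := quasi_optimality hn hOo hOb hAc hTh hsr hqu hconf
  hbeta hC0 hh0 hstab.
split.
  exists C; split => // h eps hh hh0' eps0 epsh f u uh Lf wu Vuh huh.
  rewrite -ler_pdivrMl//; apply: lb_le_inf; first by eexists; exists uh.
  move=> _ [vh [Vvh ->]]; rewrite ler_pdivrMl//.
  exact: (cea h eps hh hh0' eps0 epsh f u uh vh wu Vuh huh Vvh).
move=> s s2; have [Ci [Ci_gt0 interp]] := hint s s2.
exists (C * Ci); split; first by rewrite mulr_gt0.
move=> h eps hh hh0' eps0 epsh f u uh Lf wu Vuh huh Hsu.
have [vh [Vvh /(_ 2%N isT) le_interp]] := interp h u hh Hsu wu.1.2.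
apply: le_trans (cea h eps hh hh0' eps0 epsh f u uh vh wu Vuh huh Vvh) _.
by rewrite -2!mulrA ler_pM2l// mulrA.
Qed.
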